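(* Assume $0\le\gamma\le2$, (H1) and (H2). Let $f$ be a solution of the Boltzmann–Fermi–Dirac equation with initial datum $f_0$, and suppose there are $0<\epsilon<1$, $\bar v\in\mathbb{R}^3$, $r_0>0$ and $\delta>0$ with $|\bar v|<r_0$ and $\epsilon\le f_0(v)\le1-\epsilon$ whenever $|v-\bar v|\le\delta$. Then there exist functions $C_1(t)>0$, $C_2(t)>0$ for $t>0$, depending only on $\|f_0\|_{1,2},\gamma,C_b,c_b,\delta,\epsilon,r_0$, such that for all $t>0$ and a.e. $v\in\mathbb{R}^3$ $$C_1(t)e^{-C_2(t)|v|^2}\le f(t,v)\le1-C_1(t)e^{-C_2(t)|v|^p},\qquad p=\frac{2\ln3}{\ln2},$$ and $\inf_{T^{-1}\le t\le T}C_1(t)>0$, $\sup_{T^{-1}\le t\le T}C_2(t)<\infty$ for every $1\le T<\infty$.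
   Context: Throughout, $v,v_*\in\mathbb{R}^3$, $\sigma\in\mathbb{S}^2$, and the post-collisional velocities are $v'=\frac{v+v_*}{2}+\frac{|v-v_*|}{2}\sigma$, $v'_*=\frac{v+v_*}{2}-\frac{|v-v_*|}{2}\sigma$; the angle $\theta\in[0,\pi]$ is defined by $\cos\theta=\frac{v-v_*}{|v-v_*|}\cdot\sigma$. The collision kernel is $B(v-v_*,\sigma)=|v-v_*|^\gamma b(\cos\theta)$ with $\gamma\ge0$ and $b\ge0$ measurable with $b(\cos(\pi-\theta))=b(\cos\theta)$. For a function $g$ we write $g=g(v)$, $g_*=g(v_* )$, $g'=g(v')$, $g'_*=g(v'_* )$. (H1): $0<C_b:=2\pi\int_0^\pi b(\cos\theta)\sin\theta\,d\theta<\infty$. (H2): there is $c_b>0$ with $b(\cos\theta)>c_b$ for $\theta\in[\pi/4,3\pi/4]$. Weighted norms: $\|f\|_{1,s}=\int_{\mathbb{R}^3}|f(v)|(1+|v|^2)^{s/2}dv$. $Q_{FD}(f,f)(v)=\int_{\mathbb{R}^3\times\mathbb{S}^2}B(v-v_*,\sigma)\big(f'f'_*(1-f)(1-f_* )-ff_*(1-f')(1-f'_* )\big)\,d\sigma\,dv_*$. A solution of the Boltzmann–Fermi–Dirac equation with initial datum $f_0\in L^1_2$, $0\le f_0\le1$, is a function $f(t,v)$ such that (i) $f\in C([0,\infty),L^1_2(\mathbb{R}^3))$ and $0\le f\le 1$ on $[0,\infty)\times\mathbb{R}^3$; (ii) $f(t,v)=f_0(v)+\int_0^tQ_{FD}(f,f)(\tau,v)\,d\tau$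 for all $t\ge0$ and all $v\notin Z$, where $Z$ is a null set independent of $t$; (iii) $\int_{\mathbb{R}^3}(1,v,|v|^2)f(t,v)\,dv=\int_{\mathbb{R}^3}(1,v,|v|^2)f_0(v)\,dv$ for all $t\ge0$. *)

(* Defs.v *)
From HB Require Import structures.
From mathcomp Require Import all_boot all_order all_algebra.
From mathcomp Require Import all_classical all_reals all_analysis.
Set Implicit Arguments. Unset Strict Implicit. Unset Printing Implicit Defensive.
Import Order.TTheory GRing.Theory Num.Theory.
Import numFieldNormedType.Exports.
Local Open Scope classical_set_scope.
Local Open Scope ring_scope.

Notation leb1 R := (@lebesgue_measure R).
Notation leb2 R := (product_measure1 (leb1 R) (leb1 R)).
Notation leb3 R := (product_measure1 (leb2 R) (leb1 R)).

Section BFD.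
Variable R : realType.

Definition vec3 := ((R * R) * R)%type.

Definition vx (v : vec3) : R := v.1.1.
Definition vy (v : vec3) : R := v.1.2.
Definition vz (v : vec3) : R := v.2.

Definition vmk (a b c : R) : vec3 := ((a, b), c).
Definition vadd (v w : vec3) : vec3 := vmk (vx v + vx w) (vy v + vy w) (vz v + vz w).
Definition vsub (v w : vec3) : vec3 := vmk (vx v - vx w) (vy v - vy w) (vz v - vz w).
Definition vscale (a : R) (v : vec3) : vec3 := vmk (a * vx v) (a * vy v) (a * vz v).
Definition vdot (v w : vec3) : R := vx v * vx w + vy v * vy w + vz v * vz w.
Definition vnorm (v : vec3) : R := Num.sqrt (vdot v v).

(* The unit sphere S^2 in spherical coordinates: sigma(th, ph), with        *)
(* th in [0, pi], ph in [0, 2 pi]; its surface measure is sin th dth dph.    *)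
Definition sph (th ph : R) : vec3 :=
  vmk (sin th * cos ph) (sin th * sin ph) (cos th).

Definition vpost (v vs s : vec3) : vec3 :=
  vadd (vscale (2^-1) (vadd v vs)) (vscale (vnorm (vsub v vs) / 2) s).
Definition vpost_s (v vs s : vec3) : vec3 :=
  vsub (vscale (2^-1) (vadd v vs)) (vscale (vnorm (vsub v vs) / 2) s).

Definition costheta (v vs s : vec3) : R :=
  vdot (vscale (vnorm (vsub v vs))^-1 (vsub v vs)) s.

Definition kernB (gamma : R) (b : R -> R) (v vs s : vec3) : R :=
  (vnorm (vsub v vs)) `^ gamma * b (costheta v vs s).

Definition itv0pi : set R := `[0, pi].
Definition Cb_ext (b : R -> R) : \bar R :=
  ((2 * pi)%:E * \int[leb1 R]_(th in itv0pi) (b (cos th) * sin th)%:E)%E.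

Definition norm12 (g : vec3 -> R) : \bar R :=
  (\int[leb3 R]_v (`|g v| * (1 + vnorm v ^+ 2))%:E)%E.

Definition inL12 (g : vec3 -> R) : Prop :=
  measurable_fun setT g /\ (norm12 g < +oo)%E.

(* Integrand of Q_FD(f,f)(tau, v) with respect to d vs d sigma.  The        *)
(* collision variable is z = ((vs, th), ph) where (th, ph) are the spherical *)
(* coordinates of sigma; the surface element sin th is included.            *)
Definition QFD_integrand (gamma : R) (b : R -> R) (f : R -> vec3 -> R)
    (tau : R) (v : vec3) (z : (vec3 * R) * R) : R :=
  let vs := z.1.1 in
  let th := z.1.2 in
  let s := sph th z.2 in
  let v' := vpost v vs s in
  let vs' := vpost_s v vs s in
  kernB gamma b v vs s *
  (f tau v' * f tau vs' * (1 - f tau v) * (1 - f tau vs)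
   - f tau v * f tau vs * (1 - f tau v') * (1 - f tau vs')) * sin th.

Definition coll_dom : set ((vec3 * R) * R) :=
  [set z | 0 <= z.1.2 <= pi /\ 0 <= z.2 <= 2 * pi].

Definition QFD (gamma : R) (b : R -> R) (f : R -> vec3 -> R) (tau : R) (v : vec3) : R :=
  Rintegral (product_measure1 (product_measure1 (leb3 R) (leb1 R)) (leb1 R))
    coll_dom (QFD_integrand gamma b f tau v).

Definition QFD_time_integrand (gamma : R) (b : R -> R) (f : R -> vec3 -> R)
    (v : vec3) (p : ((R * vec3) * R) * R) : R :=
  QFD_integrand gamma b f p.1.1.1 v ((p.1.1.2, p.1.2), p.2).

Definition time_coll_dom (t : R) : set (((R * vec3) * R) * R) :=
  [set p | 0 <= p.1.1.1 <= t /\ 0 <= p.1.2 <= pi /\ 0 <= p.2 <= 2 * pi].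

Definition BFD_solution (gamma : R) (b : R -> R) (f0 : vec3 -> R)
    (f : R -> vec3 -> R) : Prop :=
  (forall t : R, 0 <= t -> inL12 (f t)) /\
  (forall t : R, 0 <= t -> forall e : R, 0 < e -> exists2 d : R, 0 < d &
     forall s : R, 0 <= s -> `|s - t| < d -> (norm12 (fun v => (f s v - f t v)%R) < e%:E)%E) /\
  (forall (t : R) (v : vec3), 0 <= t -> 0 <= f t v <= 1) /\
  (* (ii) mild form of the equation, off a null set Z independent of t;   *)
  (* the time-collision integral is required to be a Lebesgue integral.    *)
  (exists Z : set vec3, (leb3 R).-negligible Z /\
     forall (t : R) (v : vec3), 0 <= t -> ~ Z v ->
       (product_measure1 (product_measure1 (product_measure1 (leb1 R) (leb3 R))
           (leb1 R)) (leb1 R)).-integrable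
          (time_coll_dom t) (fun p => (QFD_time_integrand gamma b f v p)%:E) /\
       f t v = f0 v + Rintegral (leb1 R) `[0, t] (fun tau => QFD gamma b f tau v)) /\
  (forall t : R, 0 <= t ->
     Rintegral (leb3 R) setT (f t) = Rintegral (leb3 R) setT f0 /\
     Rintegral (leb3 R) setT (fun v => vx v * f t v) = Rintegral (leb3 R) setT (fun v => vx v * f0 v) /\
     Rintegral (leb3 R) setT (fun v => vy v * f t v) = Rintegral (leb3 R) setT (fun v => vy v * f0 v) /\
     Rintegral (leb3 R) setT (fun v => vz v * f t v) = Rintegral (leb3 R) setT (fun v => vz v * f0 v) /\
     Rintegral (leb3 R) setT (fun v => vnorm v ^+ 2 * f t v)
       = Rintegral (leb3 R) setT (fun v => vnorm v ^+ 2 * f0 v)).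

Definition pexp : R := 2 * ln 3 / ln 2.

Definition itvm11 : set R := `[-1, 1].

End BFD.

(* Main.v *)
(* Write w for v_*.  Both h = f and h = 1 - f satisfy d/dt h = (1 - h) A[h] - h A[1 - h],
   where A[h](v) is the integral of B h(v') h(w') (1 - h(w)); hence a Gaussian lower bound
   for such h gives the two inequalities, as p >= 2.  For fixed sigma and angle the map
   w -> v' is a change of variables, so that conservation of mass and energy gives
   0 <= A[h](v), A[1 - h](v) <= K (1 + |v|^2).  Therefore positivity of h and 1 - h on
   |v - vbar| <= delta persists in time.  If h >= a for |v - vbar|^2 <= delta^2 (2^n + 1) / 2,
   then the w near vbar and the sigma nearly orthogonal to (v - vbar) + (w - vbar) show
   A[h] >= c 2^-n a^2 for |v - vbar|^2 <= delta^2 (2^(n+1) + 1) / 2.  Waiting a time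
   proportional to 2^-n at each step yields the bounds a_(n+1) = q 4^-n a_n^2, thus
   a_n >= x^(2^n) for some x > 0, and 2^n is comparable to |v|^2 at the n-th radius. *)
Require Import Defs.
From HB Require Import structures.
From mathcomp Require Import all_boot all_order all_algebra.
From mathcomp Require Import all_classical all_reals all_analysis.
From mathcomp Require Import measurable_realfun ring lra.
Import Order.TTheory GRing.Theory Num.Theory.
Import numFieldNormedType.Exports.
Set Implicit Arguments.
Unset Strict Implicit.
Unset Printing Implicit Defensive.
Local Open Scope classical_set_scope.
Local Open Scope ring_scope.

(** * Measurability and Tonelli *)

(** At fixed sigma the map from w to w' degenerates as theta tends to pi, and the map from w to v'
    as theta tends to 0. The gain is therefore cut at cos theta = 0: in each half only the factor
    reached by the nonsingular map is kept, the other being at most 1, and the symmetry of b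
    identifies the two kernels. The function 1 - f is not integrable, so A[1 - f] is bounded through
    its factor f(w) instead. All pointwise information on h holds off a null set Z only; the same
    change of variables, with exponent 0 and applied to the indicator of Z, shows that almost every
    relevant collision keeps v' and w' outside Z. The mild equation has a right-hand side that is
    merely bounded and measurable in time, so trajectories are compared through difference
    inequalities and not by differentiation. The factor 4^-n in the recursion has two sources: the
    band of admissible sigma has width of order 2^-n, and the loss rate grows like 2^n on the n-th
    ball, so that h saturates after a time of order 2^-n and longer waiting gains nothing. *)

Section measurability_combinators.
Context d (T : measurableType d) (R : realType).
Implicit Types (f g : T -> R) (F G : T -> \bar R).

Lemma mfunEFin f : measurable_fun setT f -> measurable_fun setT (fun x => (f x)%:E).
Proof. by move=> ?; apply/measurable_EFinP. Qed.

Lemma mfun_addr f g : measurable_fun setT f -> measurable_fun setT g ->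
  measurable_fun setT (fun x => f x + g x).
Proof. exact: measurable_funD. Qed.

Lemma mfun_oppr f : measurable_fun setT f -> measurable_fun setT (fun x => - f x).
Proof. exact: measurable_funN. Qed.

Lemma mfun_mulr f g : measurable_fun setT f -> measurable_fun setT g ->
  measurable_fun setT (fun x => f x * g x).
Proof. exact: measurable_funM. Qed.

Lemma mfun_expr n f : measurable_fun setT f -> measurable_fun setT (fun x => f x ^+ n).
Proof. exact: measurable_funX. Qed.

Lemma mfun_norm f : measurable_fun setT f -> measurable_fun setT (fun x => `|f x|).
Proof. by move=> ?; apply: measurableT_comp. Qed.

(** Inversion is discontinuous at 0, so the line is split into the point 0 and its open
    complement. *)
Lemma mfun_invr f : measurable_fun setT f -> measurable_fun setT (fun x => (f x)^-1).
Proof.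
move=> mf; apply: (@measurableT_comp _ _ _ _ _ _ (@GRing.inv R)) => //.
have -> : [set: R] = [set 0] `|` ~` [set 0] by rewrite setUv.
apply/measurable_funU => //; first exact: measurableC.
split; first exact: measurable_fun_set1.
apply: open_continuous_measurable_fun => //.
  by apply: closed_openC; exact: closed_eq.
by move=> x; rewrite inE /= => /eqP x0; exact: inv_continuous.
Qed.

Lemma mfun_sin f : measurable_fun setT f -> measurable_fun setT (fun x => sin (f x)).
Proof.
move=> mf; apply: (@measurableT_comp _ _ _ _ _ _ (@sin R)) => //.
by apply: continuous_measurable_fun; exact: continuous_sin.
Qed.

Lemma mfun_cos f : measurable_fun setT f -> measurable_fun setT (fun x => cos (f x)).
Proof.
move=> mf; apply: (@measurableT_comp _ _ _ _ _ _ (@cos R)) => //.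
by apply: continuous_measurable_fun; exact: continuous_cos.
Qed.

Lemma mfun_sqrt f : measurable_fun setT f ->
  measurable_fun setT (fun x => Num.sqrt (f x)).
Proof.
move=> mf; apply: (@measurableT_comp _ _ _ _ _ _ (@Num.sqrt R)) => //.
by apply: continuous_measurable_fun; exact: sqrt_continuous.
Qed.

Lemma mfun_powR p f : measurable_fun setT f -> measurable_fun setT (fun x => f x `^ p).
Proof. by move=> mf; apply: (@measurableT_comp _ _ _ _ _ _ (@powR R ^~ p)). Qed.

Lemma mfun_lt f g : measurable_fun setT f -> measurable_fun setT g ->
  measurable_fun setT (fun x => f x < g x).
Proof. exact: measurable_fun_ltr. Qed.

Lemma mfun_le f g : measurable_fun setT f -> measurable_fun setT g ->
  measurable_fun setT (fun x => f x <= g x).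
Proof. exact: measurable_fun_ler. Qed.

Lemma mfun_and (a b : T -> bool) : measurable_fun setT a -> measurable_fun setT b ->
  measurable_fun setT (fun x => a x && b x).
Proof. exact: measurable_and. Qed.

Lemma mfun_bool (a : T -> bool) : measurable_fun setT a ->
  measurable_fun setT (fun x => (a x)%:R : R).
Proof. by move=> ma; apply: (@measurableT_comp _ _ _ _ _ _ (fun b : bool => b%:R : R)). Qed.

Lemma measurable_setb (p : T -> bool) : measurable_fun setT p -> measurable [set x | p x].
Proof. by move=> mp; rewrite -[X in measurable X]setTI; exact: (mp measurableT [set true]). Qed.

Lemma mfun_adde F G : measurable_fun setT F -> measurable_fun setT G ->
  measurable_fun setT (fun x => F x + G x)%E.
Proof. exact: emeasurable_funD. Qed.

Lemma mfun_mule F G : measurable_fun setT F -> measurable_fun setT G ->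
  measurable_fun setT (fun x => F x * G x)%E.
Proof. exact: emeasurable_funM. Qed.

Lemma mfun_pair d1 d2 (T1 : measurableType d1) (T2 : measurableType d2)
    (a : T -> T1) (b : T -> T2) : measurable_fun setT a -> measurable_fun setT b ->
  measurable_fun setT (fun x => (a x, b x)).
Proof. exact: measurable_fun_pair. Qed.

Lemma mfun_fst d1 d2 (T1 : measurableType d1) (T2 : measurableType d2)
    (a : T -> T1 * T2) : measurable_fun setT a -> measurable_fun setT (fun x => (a x).1).
Proof. by move=> ma; apply: (measurableT_comp measurable_fst). Qed.

Lemma mfun_snd d1 d2 (T1 : measurableType d1) (T2 : measurableType d2)
    (a : T -> T1 * T2) : measurable_fun setT a -> measurable_fun setT (fun x => (a x).2).
Proof. by move=> ma; apply: (measurableT_comp measurable_snd). Qed.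

Lemma mfun_comp d1 d2 (T1 : measurableType d1) (T2 : measurableType d2)
    (h : T1 -> T2) (a : T -> T1) : measurable_fun setT h -> measurable_fun setT a ->
  measurable_fun setT (fun x => h (a x)).
Proof. by move=> mh ma; apply: (measurableT_comp mh). Qed.

Lemma mfun_comp2 d1 d2 d3 (T1 : measurableType d1) (T2 : measurableType d2)
    (T3 : measurableType d3) (h : T1 -> T2 -> T3) (a : T -> T1) (b : T -> T2) :
  measurable_fun setT (fun p => h p.1 p.2) -> measurable_fun setT a ->
  measurable_fun setT b -> measurable_fun setT (fun x => h (a x) (b x)).
Proof.
move=> mh ma mb.
exact: (mfun_comp (h := fun p => h p.1 p.2) (a := fun x => (a x, b x)) mh (mfun_pair ma mb)).
Qed.

End measurability_combinators.

Ltac mfun_step :=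
  cbv beta;
  match goal with
  | H : measurable_fun setT ?f |- measurable_fun _ ?f => exact: H
  | |- measurable_fun _ (fun _ => ?c) => exact: measurable_cst
  | |- measurable_fun _ (fun x => x) => exact: measurable_id
  | |- measurable_fun _ (Order.lt ?c) => apply: (mfun_lt (f := cst c) (g := id))
  | |- measurable_fun _ (Order.le ?c) => apply: (mfun_le (f := cst c) (g := id))
  | |- measurable_fun _ id => exact: measurable_id
  | |- measurable_fun _ (cst _) => exact: measurable_cst
  | |- measurable_fun _ sin => apply: (mfun_sin (f := id))
  | |- measurable_fun _ cos => apply: (mfun_cos (f := id))
  | |- measurable_fun _ fst => exact: measurable_fst
  | |- measurable_fun _ snd => exact: measurable_snd
  | |- measurable_fun _ (fun x => (@?f x)%:E) => apply: (mfunEFin (f := f))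
  | |- measurable_fun _ (fun x => (@?f x + @?g x)%R) =>
      first [apply: (mfun_addr (f := f) (g := g)) | apply: (mfun_adde (F := f) (G := g))]
  | |- measurable_fun _ (fun x => (- @?f x)%R) => apply: (mfun_oppr (f := f))
  | |- measurable_fun _ (fun x => (@?f x * @?g x)%R) => apply: (mfun_mulr (f := f) (g := g))
  | |- measurable_fun _ (fun x => (@?f x ^+ _)%R) => apply: (mfun_expr _ (f := f))
  | |- measurable_fun _ (fun x => `|@?f x|%R) => apply: (mfun_norm (f := f))
  | |- measurable_fun _ (fun x => (@?f x)^-1%R) => apply: (mfun_invr (f := f))
  | |- measurable_fun _ (fun x => sin (@?f x)) => apply: (mfun_sin (f := f))
  | |- measurable_fun _ (fun x => cos (@?f x)) => apply: (mfun_cos (f := f))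
  | |- measurable_fun _ (fun x => Num.sqrt (@?f x)) => apply: (mfun_sqrt (f := f))
  | |- measurable_fun _ (fun x => @?f x `^ _) => apply: (mfun_powR _ (f := f))
  | |- measurable_fun _ (fun x => (@?f x < @?g x)%R) => apply: (mfun_lt (f := f) (g := g))
  | |- measurable_fun _ (fun x => (@?f x <= @?g x)%R) => apply: (mfun_le (f := f) (g := g))
  | |- measurable_fun _ (fun x => @?f x && @?g x) => apply: (mfun_and (a := f) (b := g))
  | |- measurable_fun _ (fun x => (nat_of_bool (@?f x))%:R) => apply: (mfun_bool (a := f))
  | |- measurable_fun _ (fun x => (@?f x * @?g x)%E) => apply: (mfun_mule (F := f) (G := g))
  | |- measurable_fun _ (fun x => (@?f x, @?g x)) => apply: (mfun_pair (a := f) (b := g))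
  | |- measurable_fun _ (fun x => (@?f x).1) => apply: (mfun_fst (a := f))
  | |- measurable_fun _ (fun x => (@?f x).2) => apply: (mfun_snd (a := f))
  | H : measurable_fun setT ?h |- measurable_fun _ (fun x => ?h (@?f x)) =>
      apply: (mfun_comp (h := h) (a := f) H)
  | H : measurable_fun setT (fun p => ?h p.1 p.2)
      |- measurable_fun _ (fun x => ?h (@?f x) (@?g x)) => 
      let h0 := fresh in
      have h0 := mfun_comp2 (h := h) (a := f) (b := g) H; apply: h0
  | H : measurable_fun setT (fun p => ?h p.1 p.2) |- measurable_fun _ (?h ?u) =>
      let h0 := fresh in
      have h0 := mfun_comp2 (h := h) (a := cst u) (b := id) H; apply: h0
  end.
Ltac mfun := rewrite /vsub /vadd /vscale /vnorm /vdot /sph /vmk /vx /vy /vz /=; repeat mfun_step.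

Section tonelli.
Local Open Scope ereal_scope.
Context d1 d2 (T1 : measurableType d1) (T2 : measurableType d2) (R : realType).
Variables (m1 : {sigma_finite_measure set T1 -> \bar R})
          (m2 : {sigma_finite_measure set T2 -> \bar R}).
Variable F : T1 -> T2 -> \bar R.
Hypothesis mF : measurable_fun setT (fun p => F p.1 p.2).
Hypothesis F0 : forall x y, 0 <= F x y.

Lemma mfun_integral2 : measurable_fun setT (fun x => \int[m2]_y F x y).
Proof. by apply: (@measurable_fun_fubini_tonelli_F _ _ _ _ _ m2 (fun p => F p.1 p.2)). Qed.

Lemma mfun_integral1 : measurable_fun setT (fun y => \int[m1]_x F x y).
Proof. by apply: (@measurable_fun_fubini_tonelli_G _ _ _ _ _ m1 (fun p => F p.1 p.2)). Qed.

Lemma tonelli_swap : \int[m1]_x \int[m2]_y F x y = \int[m2]_y \int[m1]_x F x y.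
Proof. by apply: (@fubini_tonelli _ _ _ _ _ m1 m2 (fun p => F p.1 p.2)). Qed.

Lemma tonelli_prod : \int[product_measure1 m1 m2]_p F p.1 p.2 = \int[m1]_x \int[m2]_y F x y.
Proof. by apply: (@fubini_tonelli1 _ _ _ _ _ m1 m2 (fun p => F p.1 p.2)). Qed.

Lemma mfun_sect1 x : measurable_fun setT (F x).
Proof. exact: (mfun_comp (h := fun p => F p.1 p.2) (a := fun y => (x, y)) mF (pair1_measurable x)). Qed.

Lemma mfun_sect2 y : measurable_fun setT (F^~ y).
Proof. exact: (mfun_comp (h := fun p => F p.1 p.2) (a := fun x => (x, y)) mF (pair2_measurable y)). Qed.

End tonelli.

Lemma integral_setb d (T : measurableType d) (R : realType)
    (m : {measure set T -> \bar R}) (p : T -> bool) (F : T -> \bar R) :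
  (\int[m]_(x in [set x | p x]) F x = \int[m]_x ((p x)%:R%:E * F x))%E.
Proof.
rewrite integral_mkcond; apply: eq_integral => x _; rewrite patchE.
have -> : (x \in [set x | p x]) = p x by apply/idP/idP => [/set_mem|/mem_set].
by case: (p x); rewrite ?mul1e ?mul0e.
Qed.

Arguments tonelli_swap {d1 d2 T1 T2 R} m1 m2 {F}.
Arguments tonelli_prod {d1 d2 T1 T2 R} m1 m2 {F}.
Arguments mfun_integral2 {d1 d2 T1 T2 R} m2 {F}.
Arguments mfun_integral1 {d1 d2 T1 T2 R} m1 {F}.

Section sigma_finite_product.
Local Open Scope ereal_scope.
Context d1 d2 (T1 : measurableType d1) (T2 : measurableType d2) (R : realType).
Variables (m1 : {sigma_finite_measure set T1 -> \bar R})
          (m2 : {sigma_finite_measure set T2 -> \bar R}).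

Lemma sigma_finite_product : sigma_finite [set: T1 * T2] (m1 \x m2).
Proof.
case/sigma_finiteP: (sigma_finiteT m1) => F [FT Fle Ffin].
case/sigma_finiteP: (sigma_finiteT m2) => G [GT Gle Gfin].
exists (fun n => F n `*` G n) => [|n].
  apply/esym; rewrite -subTset => -[x y] _.
  have [i _ Fx] : (\bigcup_k F k) x by rewrite -FT.
  have [j _ Gy] : (\bigcup_k G k) y by rewrite -GT.
  exists (maxn i j) => //; split.
    by move/subsetPset : (Fle _ _ (leq_maxl i j)); exact.
  by move/subsetPset : (Gle _ _ (leq_maxr i j)); exact.
have [mFn Fn] := Ffin n; have [mGn Gn] := Gfin n.
split; first exact: measurableX.
by rewrite product_measure1E// lte_mul_pinfty// ge0_fin_numE.
Qed.

(** The product carries its sigma-finiteness along, so that Tonelli can be iterated with space or a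
    collision domain as one factor. *)
Definition sfprod : {sigma_finite_measure set (T1 * T2)%type -> \bar R} :=
  HB.pack (m1 \x m2) (Measure_isSigmaFinite.Build _ _ _ (m1 \x m2) sigma_finite_product).

End sigma_finite_product.

Notation sleb2 R := (sfprod (leb1 R) (leb1 R)).
Notation sleb3 R := (sfprod (sleb2 R) (leb1 R)).

(** * Changes of variables on the line *)

Section substitution.
Context (R : realType).

(** If E is the region under the graph of g, the inner integral is g x * F (G x). The measure is
    then the image under G of the measure with density g, obtained from planar Lebesgue measure
    restricted to E. *)
Let graph_restr (E : set (R * R)) (mE : measurable E) (G : R -> R) (mG : measurable_fun setT G) :
  {m : {measure set (measurableTypeR R) -> \bar R} |
    forall F : R -> \bar R, measurable_fun setT F -> (forall x, 0 <= F x)%E ->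
      (\int[m]_y F y = \int[leb1 R]_x \int[leb1 R]_y (((x, y) \in E)%:R%:E * F (G x)))%E}.
Proof.
have mphi0 : measurable_fun setT (fun p : R * R => G p.1) by mfun.
pose T := measurableTypeR R.
have mphi : measurable_fun [set: T * T] (fun p : T * T => G p.1 : T) by exact: mphi0.
pose m2 : {measure set (T * T) -> \bar R} := leb2 R.
have mE' : measurable (E : set (T * T)) by [].
pose m3 : {measure set (T * T) -> \bar R} := mrestr m2 mE'.
unshelve eexists (pushforward m3 (fun p : T * T => G p.1 : T)); first exact: mphi.
move=> F mF F0.
have -> : (\int[pushforward m3 (fun p : T * T => G p.1 : T)]_y F y = \int[m3]_p F (G p.1))%E.
  have := @ge0_integral_pushforward _ _ (T * T)%type T R _ mphi m3 setT F measurableT mF (fun y _ => F0 y).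
  by rewrite preimage_setT.

have mFG : measurable_fun setT (fun p : R * R => F (G p.1)) by mfun.
have mFG' : measurable_fun [set: T * T] (fun p : T * T => F (G p.1)) by exact: mFG.
have -> : (\int[m3]_p F (G p.1) = \int[m3]_(p in E) F (G p.1))%E.
  rewrite (@ge0_negligible_integral _ (T * T)%type R m3 setT (~` E) (fun p => F (G p.1)))//.
  - by rewrite setDE setCK setTI.
  - exact: measurableC.
  - by rewrite /m3 /= /mrestr setICl; exact: measure0.
transitivity (\int[leb2 R]_(p in E) F (G p.1))%E.
  by apply: eq_measure_integral => //= A mA AE; rewrite /mrestr setIidl.
rewrite integral_mkcond.
transitivity (\int[leb2 R]_p (((p.1, p.2) \in E)%:R%:E * F (G p.1)))%E.
  apply: eq_integral => -[x y] _ /=; rewrite patchE.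
  by case: ifP; rewrite ?mul1e ?mul0e.
apply: (tonelli_prod (leb1 R) (leb1 R) (F := fun x y => (((x, y) \in E)%:R%:E * F (G x))%E)).
  apply: mfun_mule => //.
  apply: mfunEFin; rewrite (_ : (fun p => _) = \1_E); first exact: measurable_indic.
  by apply/funext => -[x y].
by move=> x y; rewrite mule_ge0.
Qed.

Variables (D : set R) (G H g : R -> R).
Hypotheses (mD : measurable D) (mG : measurable_fun setT G) (mg : measurable_fun setT g).
Hypothesis g0 : forall x, 0 <= g x.
Hypothesis H_homo : {homo H : x y / x < y}.
Hypothesis HD : forall a b, `[H a, H b] `<=` D.
Hypothesis HK : forall y, G (H y) = y.
Hypothesis GK : forall x, D x -> H (G x) = x.
Hypothesis dG : forall x, D x -> is_derive x 1 G (g x).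
Hypothesis cg : forall x, D x -> {for x, continuous g}.

(** Lebesgue measure is determined by half-open intervals. On []a, b]] the image measure is the
    integral of g over []H a, H b]], which the fundamental theorem of calculus evaluates as G (H b)
    - G (H a) = b - a. Only compact intervals [H a, H b] are integrated over, so D may be open or
    unbounded. *)
Lemma ge0_integral_subst (F : R -> \bar R) : measurable_fun setT F -> (forall x, 0 <= F x)%E ->
  (\int[leb1 R]_y F y = \int[leb1 R]_(x in D) ((g x)%:E * F (G x)))%E.
Proof.
pose E : set (R * R) := [set p | p.1 \in D /\ 0 < p.2 < g p.1].
have mE : measurable E.
  have -> : E = (D `*` setT) `&` [set p | ((0 < p.2) && (p.2 < g p.1)) ].
    by apply/seteqP; split => -[x y] /=; rewrite /E /= inE; [move=> [? ?]|move=> [[? ?] ?]].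
  apply: measurableI; first exact: measurableX.
  by apply: measurable_setb; mfun.
have [m mP] := graph_restr mE mG.
have mP' F' : measurable_fun setT F' -> (forall x, 0 <= F' x)%E ->
    (\int[m]_y F' y = \int[leb1 R]_(x in D) ((g x)%:E * F' (G x)))%E.
  move=> mF' F'0; rewrite mP// [RHS]integral_mkcond; apply: eq_integral => x _.
  rewrite patchE; case: ifPn => xD; last first.
    rewrite integral0_eq// => y _.
    have /negbTE -> : (x, y) \notin E by apply/negP => /set_mem[] /=; rewrite (negbTE xD).
    by rewrite mul0e.
  transitivity (\int[leb1 R]_y ((\1_(`]0, g x[%classic) y)%:E * F' (G x)))%E.
    apply: eq_integral => y _; rewrite indicE; congr (_%:R%:E * _)%E; congr nat_of_bool.
    apply/idP/idP => [/set_mem[/= _ h]|/set_mem]; first by apply/mem_set; rewrite /= in_itv.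
    by rewrite /= in_itv/= => h; apply/mem_set; split.
  rewrite /= ge0_integralZr//; last first.
    by apply/measurable_EFinP/measurable_indic.
  rewrite integral_indic// setIT; congr (_ * _)%E.
  etransitivity; first exact: lebesgue_measure_itv.
  rewrite /= lte_fin.
  case: ltP => [_|gx]; first by rewrite oppr0 adde0.
  by have -> : g x = 0 by apply/eqP; rewrite eq_le gx g0.
move=> mF F0; rewrite -mP'//.
apply: eq_measure_integral => A mA _.
apply: lebesgue_measure_unique => // _ [[a b] _ <-].
rewrite lebesgue_measure_itv/= -[RHS]mul1e -[RHS](integral_cst m)//=.
have mab : measurable (`]a, b]%classic : set R) by [].
rewrite integral_mkcond mP'; last 2 first.
- by apply/(measurable_restrictT _ _).1 => //; exact: measurable_cst.
- by move=> x; rewrite patchE; case: ifP.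
have [ab|ba] := ltP a b; last first.
  rewrite lte_fin ltNge ba /= integral0_eq// => x _.
  by rewrite patchE memNset ?mule0//= in_itv/= => /andP[/lt_le_trans h /h]; rewrite ltNge ba.
rewrite lte_fin ab.
have Hab := H_homo ab.
have cG x : H a <= x <= H b -> G x @[x --> x] --> G x.
  move=> xab; have [dGx _] : is_derive x 1 G (g x).
    by apply/dG/(HD (a := a) (b := b)); rewrite /= in_itv.
  by apply/differentiable_continuous/derivable1_diffP.
transitivity (\int[leb1 R]_(x in `]H a, H b]) (g x)%:E)%E.
  rewrite integral_itv_obnd_cbnd; last by apply/measurable_EFinP/measurable_funTS.
  rewrite (@continuous_FTC2 _ _ G)//.
  - by rewrite !HK.
  - apply/subspace_continuousP => x xab; apply: cvg_within_filter; exact/cg/(HD xab).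
  - split; first by move=> x /subset_itv_oo_cc/HD/dG[].
      by apply: cvg_at_right_filter; apply: cG; rewrite lexx ltW.
    by apply: cvg_at_left_filter; apply: cG; rewrite lexx ltW.
  - by move=> x /subset_itv_oo_cc/HD/dG ?; rewrite derive1E; apply: derive_val.
rewrite integral_mkcond [RHS]integral_mkcond; apply: eq_integral => x _.
rewrite !patchE.
have Hle y z : (H y <= H z) = (y <= z).
  have [yz|] := leP y z; last by move/H_homo; rewrite leNgt => ->.
  by move: yz; rewrite le_eqVlt => /predU1P[->|/H_homo/ltW ->//]; rewrite lexx.
have [xD|xD] := boolP (x \in D).
  have DGx : H (G x) = x by apply: GK; exact/set_mem.
  have -> : (x \in `]H a, H b]%classic) = (G x \in `]a, b]%classic).
    apply/idP/idP; rewrite !inE/= !in_itv/=.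
      by rewrite -{1 2}DGx Hle !ltNge Hle.
    by rewrite -{3 4}DGx Hle !ltNge Hle.
  by case: ifP; rewrite ?mule1 ?mule0.
rewrite memNset// => xab; move/negP : xD; apply; apply/mem_set.
by apply: (HD (a:=a) (b:=b)); exact: subset_itv_oc_cc xab.
Qed.

End substitution.
Section real_line.
Context (R : realType).
Implicit Types (F : R -> \bar R).

Lemma leb1_except (s : seq R) F1 F2 : measurable_fun setT F1 -> measurable_fun setT F2 ->
  (forall x, 0 <= F1 x)%E -> (forall x, 0 <= F2 x)%E ->
  (forall x, x \notin s -> F1 x = F2 x) -> (\int[leb1 R]_x F1 x = \int[leb1 R]_x F2 x)%E.
Proof.
move=> m1 m2 h1 h2 F12.
have cs : countable [set` s] by apply: finite_set_countable.
have ms : measurable ([set` s] : set R) by apply: countable_measurable => // x; exact: measurable_set1.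
rewrite (@ge0_negligible_integral _ (measurableTypeR R) R (leb1 R) setT [set` s] F1)//; last first.
  exact: countable_lebesgue_measure0.
rewrite [RHS](@ge0_negligible_integral _ (measurableTypeR R) R (leb1 R) setT [set` s] F2)//; last first.
  exact: countable_lebesgue_measure0.
by apply: eq_integral => x /set_mem[_ xs]; apply: F12; apply/negP.
Qed.

Lemma leb1_scale (a b : R) F : 0 < a -> measurable_fun setT F -> (forall x, 0 <= F x)%E ->
  (\int[leb1 R]_x F x = \int[leb1 R]_x (a%:E * F (a * x + b)%R))%E.
Proof.
move=> a0 mF F0.
apply: (@ge0_integral_subst R setT (fun x => a * x + b) (fun y => a^-1 * (y - b)) (cst a)) => //.
- by mfun.
- by move=> x; exact: ltW.
- by move=> x y xy; rewrite ltr_pM2l ?invr_gt0// ltrD2r.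
- by move=> y; rewrite mulVKf ?gt_eqF// subrK.
- by move=> x _; rewrite addrK mulKf ?gt_eqF.
- move=> x _; have -> : cst a x = a *: (1 : R) + 0 by rewrite /cst addr0 /GRing.scale /= mulr1.
  exact: is_deriveD.
- by move=> x _; exact: cst_continuous.
Qed.

Lemma leb1_shift (b : R) F : measurable_fun setT F -> (forall x, 0 <= F x)%E ->
  (\int[leb1 R]_x F (x + b)%R = \int[leb1 R]_x F x)%E.
Proof.
move=> mF F0; rewrite [RHS](@leb1_scale 1 b)//.
by apply: eq_integral => x _; rewrite mul1e mul1r.
Qed.

Lemma leb1_opp F : measurable_fun setT F -> (forall x, 0 <= F x)%E ->
  (\int[leb1 R]_x F (- x)%R = \int[leb1 R]_x F x)%E.
Proof.
move=> mF F0.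
have mN0 : measurable_fun setT (fun x : R => - x) by mfun.
have mN : measurable_fun [set: measurableTypeR R] (fun x : measurableTypeR R => - x : measurableTypeR R).
  by exact: mN0.
have := @ge0_integral_pushforward _ _ (measurableTypeR R) (measurableTypeR R) R _ mN
  (leb1 R) setT F measurableT mF (fun y _ => F0 y).
rewrite preimage_setT /= => <-; apply: eq_measure_integral => A mA _.
exact: lebesgue_measureN.
Qed.

(** The substitution y = - cot x, increasing from (0, pi) onto the line. It is the angular step of
    polar coordinates: a point at height y and angle th has abscissa y cot th. *)
Lemma leb1_cot F : measurable_fun setT F -> (forall x, 0 <= F x)%E ->
  (\int[leb1 R]_x F x =
   \int[leb1 R]_x ((0 < x < pi)%R%:R%:E * (((sin x) ^- 2)%:E * F (- (cos x / sin x))%R)))%E.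
Proof.
move=> mF F0; rewrite -integral_setb.
apply: (@ge0_integral_subst R _ (fun x => - (cos x / sin x)) (fun y => atan y + pi / 2)
  (fun x => (sin x) ^- 2)) => //.
- by apply: measurable_setb; mfun.
- by mfun.
- by apply: mfun_invr; mfun.
- by move=> x; rewrite invr_ge0 sqr_ge0.
- by move=> x y /lt_atan; rewrite ltrD2r.
- move=> a b x; rewrite /= in_itv/= => /andP[ax xb]; apply/andP; split.
    by apply: lt_le_trans ax; have := atan_gtNpi2 a; lra.
  by apply: le_lt_trans xb _; have := atan_ltpi2 b; lra.
- move=> y; rewrite cosDpihalf sinDpihalf mulNr opprK; exact: atanK.
- move=> x /andP[x0 xpi].
  rewrite (_ : - (cos x / sin x) = tan (x - pi / 2)); last first.
    rewrite /tan -[in cos x](subrK (pi / 2) x) -[in sin x](subrK (pi / 2) x).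
    by rewrite cosDpihalf sinDpihalf mulNr opprK.
  by rewrite tanK ?subrK// in_itv/=; apply/andP; split; lra.
- move=> x /andP[x0 xpi].
  have sx : sin x != 0 by rewrite gt_eqF// sin_gt0_pi// x0.
  apply: (is_derive_eq (is_deriveN (is_deriveM (is_derive_cos x) (is_deriveV sx (is_derive_sin x))))).
  rewrite /GRing.scale /=.
  have := cos2Dsin2 x; move: (cos x) (sin x) sx => c s s0 cs.
  by rewrite [RHS](_ : s ^- 2 = (c ^+ 2 + s ^+ 2) / s ^+ 2); [field|rewrite cs div1r].
- move=> x /andP[x0 xpi].
  have sx : sin x != 0 by rewrite gt_eqF// sin_gt0_pi// x0.
  apply: cvgV; first by rewrite expf_neq0.
  by apply: cvgM; exact: continuous_sin.
Qed.

(** If w has third coordinate z and horizontal part of squared length 4 c, then u = (z + |w|) / 2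
    satisfies z = u - c / u and |w| = u + c / u. The substitution thus describes the collision map
    on vertical lines. *)
Lemma leb1_hyperbola (c : R) F : 0 < c -> measurable_fun setT F -> (forall x, 0 <= F x)%E ->
  (\int[leb1 R]_x F x =
   \int[leb1 R]_x ((0 < x)%R%:R%:E * ((1 + c / x ^+ 2)%:E * F (x - c / x)%R)))%E.
Proof.
move=> c0 mF F0; rewrite -integral_setb.
have sq y : y ^+ 2 < (Num.sqrt (y ^+ 2 + 4 * c)) ^+ 2.
  by rewrite sqr_sqrtr; have := sqr_ge0 y; lra.
have sqE y : (Num.sqrt (y ^+ 2 + 4 * c)) ^+ 2 = y ^+ 2 + 4 * c.
  by rewrite sqr_sqrtr; have := sqr_ge0 y; lra.
have s0 y : 0 <= Num.sqrt (y ^+ 2 + 4 * c) by exact: sqrtr_ge0.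
(* The positive root of X ^ 2 - y X - c = 0, hence the inverse of x - c / x on positive x. *)
pose H y := (y + Num.sqrt (y ^+ 2 + 4 * c)) / 2.
have Hgt0 y : 0 < H y.
  by rewrite /H; have := sq y; have := s0 y; have := sqE y; nra.
have HK y : H y - c / H y = y.
  have := Hgt0 y; rewrite /H; have := sqE y.
  move: (Num.sqrt _) => t tE h; have -> : c = (t ^+ 2 - y ^+ 2) / 4 by lra.
  by field; lra.
have GK x : 0 < x -> H (x - c / x) = x.
  move=> x0; have h := Hgt0 (x - c / x); have := HK (x - c / x); set z := H _ in h *.
  move=> e; apply/eqP; rewrite -subr_eq0; apply/eqP.
  have : (z - x) * (1 + c / (z * x)) = 0.
    have -> : (z - x) * (1 + c / (z * x)) = (z - c / z) - (x - c / x).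
      by field; rewrite !gt_eqF.
    by rewrite e subrr.
  move/eqP; rewrite mulf_eq0 => /orP[/eqP//|/eqP].
  have : 0 < c / (z * x) by rewrite divr_gt0// mulr_gt0.
  by move: (c / _) => q; lra.
apply: (@ge0_integral_subst R _ (fun x => x - c / x) H (fun x => 1 + c / x ^+ 2)) => //.
- by apply: measurable_setb; mfun.
- by mfun.
- by mfun; apply: mfun_invr; mfun.
- by move=> x; rewrite addr_ge0// divr_ge0 ?sqr_ge0// ltW.
- move=> x y xy; rewrite ltNge; apply/negP => h.
  have := Hgt0 x; have := Hgt0 y; move=> hy hx.
  have : H y - c / H y <= H x - c / H x.
    by apply: lerB => //; rewrite ler_pM2l// lef_pV2.
  by rewrite !HK leNgt xy.
- by move=> a b x; rewrite /= in_itv/= => /andP[ax xb]; exact: lt_le_trans ax.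
- move=> x x0.
  have x0' : x != 0 by rewrite gt_eqF.
  apply: (is_derive_eq (is_deriveB (is_derive_id x 1) (is_deriveZ c (is_deriveV x0' (is_derive_id x 1))))).
  by rewrite /GRing.scale /=; field.
- move=> x x0; apply: cvgD; first exact: cvg_cst.
  apply: cvgM; first exact: cvg_cst.
  apply: cvgV; first by rewrite expf_neq0// gt_eqF.
  by apply: cvgM.
Qed.

End real_line.
(** * Polar coordinates and rotations *)

Section polar.
Context (R : realType).

Lemma integral_mull d (T : measurableType d) (m : {measure set T -> \bar R}) (k : R)
    (F : T -> \bar R) : 0 <= k -> measurable_fun setT F -> (forall x, 0 <= F x)%E ->
  (\int[m]_x (k%:E * F x) = k%:E * \int[m]_x F x)%E.
Proof. by move=> k0 mF F0; rewrite ge0_integralZl_EFin. Qed.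

(** Put x = - y t for fixed y, then t = - cot th, then y = r sin th for fixed th; the Jacobians y, 1
    / sin^2 th and sin th multiply to r. *)
Lemma polar_upper (F : R -> R -> \bar R) :
  measurable_fun setT (fun p => F p.1 p.2) -> (forall x y, 0 <= F x y)%E ->
  (\int[leb1 R]_x \int[leb1 R]_y ((0 < y)%R%:R%:E * F x y) =
   \int[leb1 R]_th ((0 < th < pi)%R%:R%:E * \int[leb1 R]_r ((0 < r)%R%:R%:E *
      (r%:E * F (r * cos th)%R (r * sin th)%R))))%E.
Proof.
move=> mF F0.
rewrite tonelli_swap; [|by mfun|by move=> x y; rewrite mule_ge0].
pose A (t y : R) : \bar R := ((0 < y)%R%:R%:E * (y%:E * F (- (y * t))%R y))%E.
have mA : measurable_fun setT (fun p => A p.1 p.2) by rewrite /A; mfun.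
have A0 t y : (0 <= A t y)%E.
  rewrite /A; case: ltP => y0; last by rewrite mul0e.
  by rewrite mul1e mule_ge0// lee_fin ltW.
transitivity (\int[leb1 R]_y \int[leb1 R]_t A t y)%E.
  apply: eq_integral => y _; rewrite /A; case: ltP => y0; last first.
    by rewrite !integral0_eq// => x _; rewrite mul0e.
  under eq_integral do rewrite mul1e.
  under [RHS]eq_integral do rewrite mul1e.
  rewrite -leb1_opp; [|by mfun|by []].
  rewrite (@leb1_scale _ y 0)//; last by mfun.
  by apply: eq_integral => x _; rewrite addr0.
rewrite -tonelli_swap// [LHS]leb1_cot; last 2 first.
- by apply: (mfun_integral2 (leb1 R) (F := A)).
- by move=> x; apply: integral_ge0.
apply: eq_integral => th _.
have [/andP[th0 thpi]|_] := boolP (0 < th < pi); last by rewrite !mul0e.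
have s0 : 0 < sin th by apply: sin_gt0_pi; rewrite th0.
rewrite !mul1e [X in (_ * X)%E = _](@leb1_scale _ (sin th) 0)//; last by apply: (mfun_sect1 mA).
rewrite -integral_mull; last 3 first.
- by rewrite invr_ge0 sqr_ge0.
- by rewrite /A; mfun.
- by move=> x; rewrite mule_ge0// lee_fin ltW.
apply: eq_integral => r _; rewrite addr0 /A pmulr_rgt0//.
case: ltP => r0; last by rewrite !mul0e !mule0.
rewrite !mul1e !muleA -!EFinM; congr (_%:E * F _ _)%E; field; lra.
Qed.

(** The lower half plane is the upper one under the point reflection, which adds pi to the angle.
    The finitely many angles where the halves meet are negligible. *)
Lemma polar_plane (F : R -> R -> \bar R) :
  measurable_fun setT (fun p => F p.1 p.2) -> (forall x y, 0 <= F x y)%E ->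
  (\int[leb1 R]_x \int[leb1 R]_y F x y =
   \int[leb1 R]_th ((0 <= th <= 2 * pi)%R%:R%:E * \int[leb1 R]_r ((0 < r)%R%:R%:E *
      (r%:E * F (r * cos th)%R (r * sin th)%R))))%E.
Proof.
move=> mF F0.
pose K (th : R) := (\int[leb1 R]_r ((0 < r)%R%:R%:E *
      (r%:E * F (r * cos th)%R (r * sin th)%R)))%E.
have K0 th : (0 <= K th)%E.
  apply: integral_ge0 => r _; case: ltP => r0; last by rewrite mul0e.
  by rewrite mul1e mule_ge0// lee_fin ltW.
have mK : measurable_fun setT K.
  apply: (mfun_integral2 (leb1 R)); first by mfun.
  move=> x r; case: ltP => r0; last by rewrite mul0e.
  by rewrite mul1e mule_ge0// lee_fin ltW.
transitivity (\int[leb1 R]_x (\int[leb1 R]_y ((0 < y)%R%:R%:E * F x y) +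
   \int[leb1 R]_y ((0 < - y)%R%:R%:E * F x y)))%E.
  apply: eq_integral => x _; rewrite -ge0_integralD//; last 4 first.
  - by move=> y _; rewrite mule_ge0.
  - by mfun.
  - by move=> y _; rewrite mule_ge0.
  - by mfun.
  apply: (@leb1_except _ [:: 0]); [by mfun|by mfun|by []| |].
    by move=> y; rewrite adde_ge0// mule_ge0.
  move=> y; rewrite inE oppr_gt0 => y0; case: ltgtP y0 => // _ _.
    by rewrite mul0e mul1e adde0.
  by rewrite mul0e mul1e add0e.
rewrite ge0_integralD//; last 4 first.
- by move=> x _; apply: integral_ge0 => y _; rewrite mule_ge0.
- apply: (mfun_integral2 (leb1 R) (F := fun x y => (0 < y)%R%:R%:E * F x y)%E); first by mfun.
  by move=> x y; rewrite mule_ge0.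
- by move=> x _; apply: integral_ge0 => y _; rewrite mule_ge0.
- apply: (mfun_integral2 (leb1 R) (F := fun x y => (0 < - y)%R%:R%:E * F x y)%E); first by mfun.
  by move=> x y; rewrite mule_ge0.
rewrite polar_upper//.
have -> : (\int[leb1 R]_x \int[leb1 R]_y ((0 < - y)%R%:R%:E * F x y) =
  \int[leb1 R]_x \int[leb1 R]_y ((0 < y)%R%:R%:E * F (- x)%R (- y)%R))%E.
  rewrite -leb1_opp; last 2 first.
  - apply: (mfun_integral2 (leb1 R) (F := fun x y => (0 < - y)%R%:R%:E * F x y)%E); first by mfun.
    by move=> x y; rewrite mule_ge0.
  - by move=> x; apply: integral_ge0 => y _; rewrite mule_ge0.
  apply: eq_integral => x _; rewrite -leb1_opp; [|by mfun|by move=> y; rewrite mule_ge0].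
  by apply: eq_integral => y _; rewrite opprK.
rewrite (@polar_upper (fun x y => F (- x) (- y))); [|by mfun|by []].
rewrite -/K.
have -> : (\int[leb1 R]_th ((0 < th < pi)%R%:R%:E * \int[leb1 R]_r ((0 < r)%R%:R%:E *
      (r%:E * F (- (r * cos th))%R (- (r * sin th))%R))) =
  \int[leb1 R]_th ((0 < th - pi < pi)%R%:R%:E * K th))%E.
  rewrite -(@leb1_shift _ pi (fun th => (0 < th - pi < pi)%R%:R%:E * K th)%E); last 2 first.
  - by mfun.
  - by move=> x; rewrite mule_ge0.
  apply: eq_integral => th _; rewrite addrK; congr (_ * _)%E; apply: eq_integral => r _.
  by rewrite cosDpi sinDpi !mulrN.
rewrite -[X in (X + _)%E]/(\int[leb1 R]_th ((0 < th < pi)%R%:R%:E * K th))%E.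
rewrite -[RHS]/(\int[leb1 R]_th ((0 <= th <= 2 * pi)%R%:R%:E * K th))%E.
rewrite -ge0_integralD//; last 4 first.
- by move=> x _; rewrite mule_ge0.
- by mfun.
- by move=> x _; rewrite mule_ge0.
- by mfun.
apply: (@leb1_except _ [:: 0; pi; 2 * pi]); [by mfun|by mfun| | |].
- by move=> x; rewrite adde_ge0// mule_ge0.
- by move=> x; rewrite mule_ge0.
move=> th; rewrite !inE !negb_or => /and3P[t0 t1 t2].
have pi0 := pi_gt0 R.
rewrite -ge0_muleDl// -EFinD -natrD; congr (_%:R%:E * _)%E.
case: (ltgtP th 0) t0 => // th0 _; case: (ltgtP th pi) t1 => // th1 _;
case: (ltgtP th (2 * pi)) t2 => // th2 _ /=;
do ?[case: ltP => ? /=]; do ?[case: leP => ? /=]; first [by []|by exfalso; lra].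
Qed.

(** The indicators of the chart belong to the weight, so that [sphint] iterates integrals over whole
    lines and the Tonelli lemmas apply directly. *)
Definition sphW (th ph : R) : R :=
  sin th * (0 <= th <= pi)%R%:R * (0 <= ph <= 2 * pi)%R%:R.

Definition sphint (Psi : vec3 R -> \bar R) : \bar R :=
  (\int[leb1 R]_th \int[leb1 R]_ph ((sphW th ph)%:E * Psi (sph th ph)))%E.

Lemma sphW_ge0 th ph : 0 <= sphW th ph.
Proof.
rewrite /sphW mulr_ge0//; have [/sin_ge0_pi h|] := boolP (0 <= th <= pi).
  by rewrite mulr1.
by rewrite mulr0.
Qed.

Lemma mfun_sphW d (T : measurableType d) (a b : T -> R) : measurable_fun setT a ->
  measurable_fun setT b -> measurable_fun setT (fun x => sphW (a x) (b x)).
Proof. by move=> ma mb; rewrite /sphW; mfun. Qed.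

Lemma integral_leb3 (F : vec3 R -> \bar R) : measurable_fun setT F -> (forall v, 0 <= F v)%E ->
  (\int[leb3 R]_v F v =
   \int[leb1 R]_z \int[leb1 R]_x \int[leb1 R]_y F (vmk x y z))%E.
Proof.
move=> mF F0.
have mF' : measurable_fun setT (fun p => F (p.1, p.2)) by mfun.
transitivity (\int[leb1 R]_z \int[leb2 R]_q F (q, z))%E.
  transitivity (\int[leb3 R]_p F (p.1, p.2))%E; first by apply: eq_integral => -[p z] _.
  have h1 := tonelli_prod (sleb2 R) (leb1 R) (F := fun p z => F (p, z)) mF' (fun x y => F0 (x, y)).
  have h2 := tonelli_swap (sleb2 R) (leb1 R) (F := fun p z => F (p, z)) mF' (fun x y => F0 (x, y)).
  by etransitivity; [exact: h1|exact: h2].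
apply: eq_integral => z _.
transitivity (\int[leb2 R]_p F (p.1, p.2, z))%E.
  by apply: eq_integral => -[x y] _.
have mFz : measurable_fun setT (fun p : R * R => F (p.1, p.2, z)) by mfun.
exact: (tonelli_prod (leb1 R) (leb1 R) (F := fun x y => F (x, y, z)) mFz (fun x y => F0 (x, y, z))).
Qed.

(** Plane polar coordinates in (x, y) produce a horizontal radius, which together with z ranges over
    a half plane; there [polar_upper] applies again. The Jacobians r sin th and r multiply to r ^ 2
    sin th. *)
Lemma polar_space (F : vec3 R -> \bar R) : measurable_fun setT F -> (forall v, 0 <= F v)%E ->
  (\int[leb3 R]_v F v =
   sphint (fun s => \int[leb1 R]_r ((0 < r)%R%:R%:E * ((r ^+ 2)%:E * F (vscale r s)))))%E.
Proof.
move=> mF F0; rewrite (integral_leb3 mF F0).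
under eq_integral => z _.
  rewrite (@polar_plane (fun x y => F (vmk x y z))); [|by mfun|by []].
  over.
have pos (r : R) X : (0 <= X)%E -> (0 <= (0 < r)%R%:R%:E * (r%:E * X))%E.
  by move=> X0; case: ltP => r0; rewrite ?mul0e// mul1e mule_ge0// lee_fin ltW.
rewrite /= tonelli_swap; last 2 first.
- apply: mfun_mule; first by mfun.
  apply: (mfun_integral2 (leb1 R) (F := fun p r => (0 < r)%R%:R%:E * (r%:E *
      F (vmk (r * cos p.2) (r * sin p.2) p.1))))%E; first by mfun.
  by move=> p r; exact: pos.
- by move=> z ph; rewrite mule_ge0// integral_ge0// => r _; exact: pos.
rewrite /sphint [RHS]tonelli_swap; last 2 first.
- apply: mfun_mule; first by apply: mfunEFin; apply: mfun_sphW; mfun.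
  apply: (mfun_integral2 (leb1 R) (F := fun p r => (0 < r)%R%:R%:E * ((r ^+ 2)%:E *
      F (vscale r (sph p.1 p.2)))))%E; first by mfun.
  by move=> p r; rewrite mule_ge0// mule_ge0// lee_fin sqr_ge0.
- move=> th ph; rewrite mule_ge0 ?lee_fin ?sphW_ge0// integral_ge0// => r _.
  by rewrite mule_ge0// mule_ge0// lee_fin sqr_ge0.
apply: eq_integral => ph _.
rewrite integral_mull//; last 2 first.
- apply: (mfun_integral2 (leb1 R) (F := fun z r => (0 < r)%R%:R%:E * (r%:E *
      F (vmk (r * cos ph) (r * sin ph) z))))%E; first by mfun.
  by move=> p r; exact: pos.
- by move=> z; rewrite integral_ge0// => r _; exact: pos.
(* [polar_upper] asks for an integrand that is nonnegative on the whole plane, so the first Jacobian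
   r is replaced by its absolute value. *)
have -> : (\int[leb1 R]_x \int[leb1 R]_r ((0 < r)%R%:R%:E * (r%:E * F (vmk (r * cos ph) (r * sin ph) x))) =
  \int[leb1 R]_x \int[leb1 R]_r ((0 < r)%R%:R%:E * (`|r|%:E * F (vmk (r * cos ph) (r * sin ph) x))))%E.
  apply: eq_integral => x _; apply: eq_integral => r _; case: ltP => r0; last by rewrite !mul0e.
  by rewrite gtr0_norm.
rewrite (@polar_upper (fun z r => `|r|%:E * F (vmk (r * cos ph) (r * sin ph) z))%E); last 2 first.
- by mfun.
- by move=> x y; rewrite mule_ge0.
rewrite -integral_mull//; last 2 first.
- apply: mfun_mule; first by mfun.
  apply: (mfun_integral2 (leb1 R) (F := fun th r => (0 < r)%R%:R%:E * (r%:E * (`|r * sin th|%:E *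
      F (vmk (r * sin th * cos ph) (r * sin th * sin ph) (r * cos th))))))%E; first by mfun.
  by move=> p r; apply: pos; rewrite mule_ge0.
- by move=> z; rewrite mule_ge0// integral_ge0// => r _; apply: pos; rewrite mule_ge0.
apply: eq_integral => th _; rewrite /sphW.
have [/andP[t0 tpi]|tout] := boolP (0 < th < pi); last first.
  have -> : sin th * (0 <= th <= pi)%R%:R = 0; last by rewrite !(mul0r, mul0e, mule0).
  have [/andP[a b]|] := boolP (0 <= th <= pi); last by rewrite mulr0.
  move: tout; rewrite negb_and -!leNgt => /orP[a'|b'].
    have -> : th = 0 by lra.
    by rewrite sin0 mul0r.
  have -> : th = pi by lra.
  by rewrite sinpi mul0r.
have s0 : 0 < sin th by apply: sin_gt0_pi; rewrite t0.
have -> : (0 <= th <= pi) = true by rewrite !ltW.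
rewrite mulr1 [sin th * _]mulrC EFinM -muleA mul1e; congr (_ * _)%E.
rewrite -integral_mull ?ltW//; last 2 first.
- by mfun.
- by move=> r; rewrite mule_ge0// mule_ge0// lee_fin sqr_ge0.
apply: eq_integral => r _; case: ltP => r0; last by rewrite !(mul0e, mule0).
rewrite !mul1e gtr0_norm ?mulr_gt0// !muleA -!EFinM; congr (_%:E * F _)%E; first by ring.
by rewrite /vscale /sph /vmk /vx /vy /vz /= !mulrA.
Qed.

End polar.
Section rotations.
Context (R : realType).

Lemma leb1_affine (a b : R) (F : R -> \bar R) : a != 0 -> measurable_fun setT F ->
  (forall x, 0 <= F x)%E ->
  (\int[leb1 R]_x F x = \int[leb1 R]_x (`|a|%:E * F (a * x + b)%R))%E.
Proof.
move=> a0 mF F0; case: (ltgtP a 0) a0 => // a0 _; last first.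
  by rewrite gtr0_norm// -leb1_scale.
rewrite ltr0_norm// -leb1_opp// (@leb1_scale _ (- a) (- b)) ?oppr_gt0//; last by mfun.
by apply: eq_integral => x _; rewrite opprD mulNr !opprK.
Qed.

(** For c <> 0 the rotation is a succession of two maps changing one coordinate each, x to c x - s y
    and then y to (s x + y) / c, with Jacobians c and 1 / c. For c = 0 the axes are exchanged up to
    signs. *)
Lemma plane_rot (c s : R) (F : R -> R -> \bar R) : c ^+ 2 + s ^+ 2 = 1 ->
  measurable_fun setT (fun p => F p.1 p.2) -> (forall x y, 0 <= F x y)%E ->
  (\int[leb1 R]_x \int[leb1 R]_y F (c * x - s * y)%R (s * x + c * y)%R =
   \int[leb1 R]_x \int[leb1 R]_y F x y)%E.
Proof.
move=> cs mF F0.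
have [c0|c0] := eqVneq c 0.
  have s0 : s != 0 by apply: contra_eq_neq cs => ->; rewrite c0 expr0n /= addr0 eq_sym oner_neq0.
  have s1 : `|s| = 1.
    by apply/eqP; rewrite -sqrp_eq1// real_normK ?num_real// -cs c0 expr0n add0r.
  rewrite tonelli_swap; [|by mfun|by []].
  rewrite [RHS](@leb1_affine (- s) 0) ?oppr_eq0//; last 2 first.
  - exact: (mfun_integral2 (leb1 R) (F := F)).
  - by move=> x; apply: integral_ge0.
  apply: eq_integral => x _; rewrite normrN s1 mul1e.
  rewrite [RHS](@leb1_affine s 0)//; last by mfun.
  by apply: eq_integral => y _; rewrite s1 mul1e c0 !mul0r !addr0 add0r mulNr.
rewrite tonelli_swap; [|by mfun|by []].
transitivity (\int[leb1 R]_y \int[leb1 R]_x (`|c|^-1%:E * F x ((s * x + y) / c)%R))%E.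
  apply: eq_integral => y _.
  rewrite [RHS](@leb1_affine c (- (s * y)))//; last 2 first.
  - by mfun.
  - by move=> x; rewrite mule_ge0// lee_fin invr_ge0.
  apply: eq_integral => x _.
  rewrite muleA -EFinM mulfV ?normr_eq0// mul1e; congr F.
  have -> : s * (c * x - s * y) + y = s * c * x + (1 - s ^+ 2) * y by ring.
  have -> : 1 - s ^+ 2 = c ^+ 2 by lra.
  by field.
rewrite -tonelli_swap; [|by mfun|by move=> x y; rewrite mule_ge0// lee_fin invr_ge0].
apply: eq_integral => x _.
rewrite [RHS](@leb1_affine c^-1 (s * x / c)) ?invr_eq0//; last by mfun.
apply: eq_integral => y _; rewrite normfV; congr (_ * F _ _)%E.
by rewrite mulrDl addrC mulrC.
Qed.

Definition rotz (c s : R) (v : vec3 R) : vec3 R :=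
  vmk (c * vx v - s * vy v) (s * vx v + c * vy v) (vz v).
Definition roty (c s : R) (v : vec3 R) : vec3 R :=
  vmk (c * vx v + s * vz v) (vy v) (c * vz v - s * vx v).

Lemma mfun_rotz c s : measurable_fun setT (rotz c s).
Proof. by rewrite /rotz; mfun. Qed.

Lemma mfun_roty c s : measurable_fun setT (roty c s).
Proof. by rewrite /roty; mfun. Qed.

Section invariance.
Variable F : vec3 R -> \bar R.
Hypotheses (mF : measurable_fun setT F) (F0 : forall v, (0 <= F v)%E).

Lemma leb3_rotz c s : c ^+ 2 + s ^+ 2 = 1 ->
  (\int[leb3 R]_v F (rotz c s v) = \int[leb3 R]_v F v)%E.
Proof.
move=> cs; have mG : measurable_fun setT (fun v => F (rotz c s v)).
  by apply: mfun_comp => //; exact: mfun_rotz.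
rewrite (integral_leb3 mF F0) (integral_leb3 mG (fun v => F0 (rotz c s v))).
apply: eq_integral => z _.
have mz : measurable_fun setT (fun p : R * R => F (vmk p.1 p.2 z)) by mfun.
exact: (plane_rot cs mz (fun x y => F0 (vmk x y z))).
Qed.

Let integral_leb3_yzx (G : vec3 R -> \bar R) : measurable_fun setT G ->
  (forall v, (0 <= G v)%E) ->
  (\int[leb3 R]_v G v = \int[leb1 R]_y \int[leb1 R]_z \int[leb1 R]_x G (vmk x y z))%E.
Proof.
move=> mG G0; rewrite (integral_leb3 mG G0).
transitivity (\int[leb1 R]_z \int[leb1 R]_y \int[leb1 R]_x G (vmk x y z))%E.
  apply: eq_integral => z _.
  by apply: (tonelli_swap (leb1 R) (leb1 R) (F := fun x y => G (vmk x y z))) => //; mfun.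
apply: (tonelli_swap (leb1 R) (leb1 R) (F := fun z y => \int[leb1 R]_x G (vmk x y z)))%E.
  by apply: (mfun_integral2 (leb1 R) (F := fun p x => G (vmk x p.2 p.1))) => //; mfun.
by move=> z y; apply: integral_ge0.
Qed.

Lemma leb3_roty c s : c ^+ 2 + s ^+ 2 = 1 ->
  (\int[leb3 R]_v F (roty c s v) = \int[leb3 R]_v F v)%E.
Proof.
move=> cs; have mG : measurable_fun setT (fun v => F (roty c s v)).
  by apply: mfun_comp => //; exact: mfun_roty.
rewrite (integral_leb3_yzx mF F0) (integral_leb3_yzx mG (fun v => F0 (roty c s v))).
apply: eq_integral => y _.
have my : measurable_fun setT (fun p : R * R => F (vmk p.2 y p.1)) by mfun.
have := plane_rot cs my (fun z x => F0 (vmk x y z)); move=> <-.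
apply: eq_integral => z _; apply: eq_integral => x _.
by rewrite /roty /vmk /vx /vy /vz /= [in RHS]addrC.
Qed.

Lemma leb3_shift w : (\int[leb3 R]_v F (vadd v w) = \int[leb3 R]_v F v)%E.
Proof.
have mG : measurable_fun setT (fun v => F (vadd v w)) by mfun.
rewrite (integral_leb3 mF F0) (integral_leb3 mG (fun v => F0 (vadd v w))).
rewrite -[RHS](@leb1_shift _ (vz w)); last 2 first.
- apply: (mfun_integral2 (leb1 R) (F := fun z x => \int[leb1 R]_y F (vmk x y z))%E).
    by apply: (mfun_integral2 (leb1 R) (F := fun p y => F (vmk p.2 y p.1))) => //; mfun.
  by move=> z x; apply: integral_ge0.
- by move=> z; apply: integral_ge0 => x _; apply: integral_ge0.
apply: eq_integral => z _; rewrite -[RHS](@leb1_shift _ (vx w)); last 2 first.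
- by apply: (mfun_integral2 (leb1 R) (F := fun x y => F (vmk x y (z + vz w)))) => //; mfun.
- by move=> x; apply: integral_ge0.
apply: eq_integral => x _.
have mxz : measurable_fun setT (fun y => F (vmk (x + vx w) y (z + vz w))) by mfun.
exact: (leb1_shift (vy w) mxz (fun y => F0 (vmk _ y _))).
Qed.

Lemma leb3_opp : (\int[leb3 R]_v F (vscale (-1) v) = \int[leb3 R]_v F v)%E.
Proof.
have mG : measurable_fun setT (fun v => F (vscale (-1) v)) by mfun.
rewrite (integral_leb3 mF F0) (integral_leb3 mG (fun v => F0 (vscale (-1) v))).
rewrite -[RHS]leb1_opp; last 2 first.
- apply: (mfun_integral2 (leb1 R) (F := fun z x => \int[leb1 R]_y F (vmk x y z))%E).
    by apply: (mfun_integral2 (leb1 R) (F := fun p y => F (vmk p.2 y p.1))) => //; mfun.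
  by move=> z x; apply: integral_ge0.
- by move=> z; apply: integral_ge0 => x _; apply: integral_ge0.
apply: eq_integral => z _; rewrite -[RHS]leb1_opp; last 2 first.
- by apply: (mfun_integral2 (leb1 R) (F := fun x y => F (vmk x y (- z)))) => //; mfun.
- by move=> x; apply: integral_ge0.
apply: eq_integral => x _; rewrite -[RHS]leb1_opp//; last by mfun.
by apply: eq_integral => y _; rewrite /vscale /vx /vy /vz /= !mulN1r.
Qed.

End invariance.

Lemma vdot_rotz c s v w : c ^+ 2 + s ^+ 2 = 1 -> vdot (rotz c s v) (rotz c s w) = vdot v w.
Proof.
move=> cs; rewrite /vdot /rotz /vmk /vx /vy /vz /=.
transitivity ((c ^+ 2 + s ^+ 2) * (v.1.1 * w.1.1 + v.1.2 * w.1.2) + v.2 * w.2); first by ring.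
by rewrite cs mul1r.
Qed.

Lemma vdot_roty c s v w : c ^+ 2 + s ^+ 2 = 1 -> vdot (roty c s v) (roty c s w) = vdot v w.
Proof.
move=> cs; rewrite /vdot /roty /vmk /vx /vy /vz /=.
transitivity ((c ^+ 2 + s ^+ 2) * (v.1.1 * w.1.1 + v.2 * w.2) + v.1.2 * w.1.2); first by ring.
by rewrite cs mul1r; ring.
Qed.

Definition ez : vec3 R := vmk 0 0 1.

(** Spherical coordinates: [roty] tilts the polar axis to height z and horizontal length q, and
    [rotz] sets the azimuth. For q = 0 the azimuth is undefined and taken to be 0. *)
Lemma unit_rot (e : vec3 R) : vdot e e = 1 -> exists c1 s1 c2 s2,
  [/\ c1 ^+ 2 + s1 ^+ 2 = 1, c2 ^+ 2 + s2 ^+ 2 = 1 & rotz c1 s1 (roty c2 s2 ez) = e].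
Proof.
case: e => -[x y] z; rewrite /vdot /rotz /roty /ez /vmk /vx /vy /vz /= => e1.
pose q := Num.sqrt (x ^+ 2 + y ^+ 2).
have q2 : q ^+ 2 = x ^+ 2 + y ^+ 2 by rewrite sqr_sqrtr// addr_ge0 ?sqr_ge0.
have [q0|q0] := eqVneq q 0.
  have xy : x ^+ 2 + y ^+ 2 = 0 by rewrite -q2 q0 expr0n.
  move/eqP : xy; rewrite paddr_eq0 ?sqr_ge0// !sqrf_eq0 => /andP[/eqP x0 /eqP y0].
  exists 1, 0, z, 0; rewrite x0 y0 in e1 *; split; [by ring| |congr (_, _, _); ring].
  by rewrite -e1; ring.
exists (x / q), (y / q), z, q; split.
- have -> : (x / q) ^+ 2 + (y / q) ^+ 2 = (x ^+ 2 + y ^+ 2) / q ^+ 2 by field.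
  by rewrite -q2 divff// expf_neq0.
- by rewrite q2 -e1; ring.
- by congr (_, _, _); field.
Qed.

Lemma vdot_sph th ph : vdot (sph th ph) (sph th ph) = 1 :> R.
Proof.
rewrite /vdot /sph /vmk /vx /vy /vz /= -!expr2 !exprMn -mulrDr.
by rewrite cos2Dsin2 mulr1 addrC cos2Dsin2.
Qed.

Lemma vnorm_scale (r : R) (s : vec3 R) : 0 <= r -> vdot s s = 1 -> vnorm (vscale r s) = r.
Proof.
move=> r0 s1; rewrite /vnorm.
have -> : vdot (vscale r s) (vscale r s) = r ^+ 2 * vdot s s.
  by rewrite /vdot /vscale /vmk /vx /vy /vz /=; ring.
by rewrite s1 mulr1 sqrtr_sqr ger0_norm.
Qed.

Lemma eq_sphint (F G : vec3 R -> \bar R) : (forall s, vdot s s = 1 -> F s = G s) ->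
  sphint F = sphint G.
Proof.
move=> FG; apply: eq_integral => th _; apply: eq_integral => ph _.
by rewrite FG// vdot_sph.
Qed.

Lemma mfun_sphint d (T : measurableType d) (F : T -> vec3 R -> \bar R) :
  measurable_fun setT (fun p => F p.1 p.2) -> (forall t s, 0 <= F t s)%E ->
  measurable_fun setT (fun t => sphint (F t)).
Proof.
move=> mF F0.
have W0 t th ph : (0 <= (sphW th ph)%:E * F t (sph th ph))%E.
  by rewrite mule_ge0// lee_fin sphW_ge0.
apply: (mfun_integral2 (leb1 R) (F := fun t th => \int[leb1 R]_ph
  ((sphW th ph)%:E * F t (sph th ph)))%E).
  apply: (mfun_integral2 (leb1 R) (F := fun p ph => (sphW p.2 ph)%:E * F p.1 (sph p.2 ph)))%E => //.
  by apply: mfun_mule; [apply: mfunEFin; apply: mfun_sphW|]; mfun.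
by move=> t th; apply: integral_ge0.
Qed.

Lemma sphint_ge0 (F : vec3 R -> \bar R) : (forall s, 0 <= F s)%E -> (0 <= sphint F)%E.
Proof.
move=> F0; apply: integral_ge0 => th _; apply: integral_ge0 => ph _.
by rewrite mule_ge0// lee_fin sphW_ge0.
Qed.

Lemma sphint_swap (F : vec3 R -> vec3 R -> \bar R) :
  measurable_fun setT (fun p => F p.1 p.2) -> (forall t s, 0 <= F t s)%E ->
  (\int[leb3 R]_w sphint (F w) = sphint (fun s => \int[leb3 R]_w F w s))%E.
Proof.
move=> mF F0.
have W0 t th ph : (0 <= (sphW th ph)%:E * F t (sph th ph))%E.
  by rewrite mule_ge0// lee_fin sphW_ge0.
have m3 : measurable_fun setT (fun p : vec3 R * R * R => (sphW p.1.2 p.2)%:E * F p.1.1 (sph p.1.2 p.2))%E.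
  by apply: mfun_mule; [apply: mfunEFin; apply: mfun_sphW|]; mfun.
have m2 : measurable_fun setT (fun p : vec3 R * R =>
    \int[leb1 R]_ph ((sphW p.2 ph)%:E * F p.1 (sph p.2 ph)))%E.
  exact: (mfun_integral2 (leb1 R) (F := fun p ph => (sphW p.2 ph)%:E * F p.1 (sph p.2 ph))%E m3 (fun p _ => W0 p.1 p.2 _)).
have i0 t th : (0 <= \int[leb1 R]_ph ((sphW th ph)%:E * F t (sph th ph)))%E.
  by apply: integral_ge0.
etransitivity.
  exact: (tonelli_swap (sleb3 R) (leb1 R) (F := fun w th => \int[leb1 R]_ph ((sphW th ph)%:E * F w (sph th ph)))%E
    m2 i0).
apply: eq_integral => th _.
have m1 : measurable_fun setT (fun p : vec3 R * R => (sphW th p.2)%:E * F p.1 (sph th p.2))%E.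
  by apply: mfun_mule; [apply: mfunEFin; apply: mfun_sphW|]; mfun.
etransitivity.
  exact: (tonelli_swap (sleb3 R) (leb1 R) (F := fun w ph => (sphW th ph)%:E * F w (sph th ph))%E m1 (fun w ph => W0 w th ph)).
apply: eq_integral => ph _.
have ms : measurable_fun setT (fun w => F w (sph th ph)) by exact: (mfun_sect2 mF).
exact: (integral_mull (leb3 R) (sphW_ge0 th ph) ms (fun w => F0 w _)).
Qed.

Lemma le_sphint (F G : vec3 R -> \bar R) : measurable_fun setT F -> measurable_fun setT G ->
  (forall s, 0 <= F s)%E -> (forall s, 0 <= G s)%E ->
  (forall s, vdot s s = 1 -> (F s <= G s)%E) -> (sphint F <= sphint G)%E.
Proof.
move=> mF mG F0 G0 FG.
have m2 (H : vec3 R -> \bar R) : measurable_fun setT H ->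
    measurable_fun setT (fun p => (sphW p.1 p.2)%:E * H (sph p.1 p.2))%E.
  by move=> mH; apply: mfun_mule; [apply: mfunEFin; apply: mfun_sphW|]; mfun.
have W0 (H : vec3 R -> \bar R) : (forall s, 0 <= H s)%E -> forall th ph, (0 <= (sphW th ph)%:E * H (sph th ph))%E.
  by move=> H0 th ph; rewrite mule_ge0// lee_fin sphW_ge0.
apply: ge0_le_integral => //.
- by move=> th _; apply: integral_ge0 => ph _; exact: W0.
- exact: (mfun_integral2 (leb1 R) (F := fun th ph => (sphW th ph)%:E * F (sph th ph))%E (m2 _ mF) (W0 _ F0)).
- exact: (mfun_integral2 (leb1 R) (F := fun th ph => (sphW th ph)%:E * G (sph th ph))%E (m2 _ mG) (W0 _ G0)).
move=> th _; apply: ge0_le_integral => //.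
- by move=> ph _; exact: W0.
- exact: (mfun_sect1 (F := fun th ph => (sphW th ph)%:E * F (sph th ph))%E (m2 _ mF) th).
- exact: (mfun_sect1 (F := fun th ph => (sphW th ph)%:E * G (sph th ph))%E (m2 _ mG) th).
by move=> ph _; rewrite lee_wpmul2l ?lee_fin ?sphW_ge0// FG// vdot_sph.
Qed.

Lemma sphint_mull (k : R) (F : vec3 R -> \bar R) : 0 <= k -> measurable_fun setT F ->
  (forall s, 0 <= F s)%E -> sphint (fun s => k%:E * F s)%E = (k%:E * sphint F)%E.
Proof.
move=> k0 mF F0.
have W0 th ph : (0 <= (sphW th ph)%:E * F (sph th ph))%E.
  by rewrite mule_ge0// lee_fin sphW_ge0.
have mW : measurable_fun setT (fun p => (sphW p.1 p.2)%:E * F (sph p.1 p.2))%E.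
  by apply: mfun_mule; [apply: mfunEFin; apply: mfun_sphW|]; mfun.
rewrite /sphint -integral_mull//; last 2 first.
- exact: (mfun_integral2 (leb1 R) (F := fun th ph => (sphW th ph)%:E * F (sph th ph)))%E.
- by move=> th; apply: integral_ge0.
apply: eq_integral => th _; rewrite -integral_mull//; last first.
  by apply: mfun_mule; [apply: mfunEFin; apply: mfun_sphW|]; mfun.
by apply: eq_integral => ph _; rewrite muleCA.
Qed.

Section zonal.
Variable k : R -> \bar R.
Hypotheses (mk : measurable_fun setT k) (k0 : forall x, (0 <= k x)%E).

(* The weight |v|^-2 on the unit ball makes the radial integral equal to 1. *)
Let cone (e v : vec3 R) : \bar R :=
  (((0 < vnorm v <= 1)%R%:R / vnorm v ^+ 2)%:E * k (vdot e v / vnorm v))%E.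

Let mfun_cone e : measurable_fun setT (cone e).
Proof. by rewrite /cone; mfun; apply: mfun_invr; mfun. Qed.

Let cone_ge0 e v : (0 <= cone e v)%E.
Proof. by rewrite mule_ge0// lee_fin divr_ge0// sqr_ge0. Qed.

Let integral_cone e : (\int[leb3 R]_v cone e v = sphint (fun s => k (vdot e s)))%E.
Proof.
rewrite (polar_space (mfun_cone e) (cone_ge0 e)); apply: eq_sphint => s s1.
transitivity (\int[leb1 R]_(r in [set r : R | (0 < r <= 1)%R]) k (vdot e s))%E.
  rewrite integral_setb; apply: eq_integral => r _; case: ltP => r0; last by rewrite !mul0e.
  rewrite /cone (vnorm_scale (ltW r0) s1) r0 mul1e muleA -EFinM andTb.
  have -> : r ^+ 2 * ((r <= 1)%R%:R / r ^+ 2) = (r <= 1)%R%:R by field; lra.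
  congr (_ * k _)%E; rewrite /vdot /vscale /vmk /vx /vy /vz /=; field; lra.
have -> : [set r : R | (0 < r <= 1)%R] = `]0, 1]%classic by rewrite set_itvoc.
rewrite integral_cst//.
rewrite -[RHS]mule1; congr (_ * _)%E.
etransitivity; first exact: lebesgue_measure_itv.
by rewrite /= lte_fin ltr01 oppr0 adde0.
Qed.

(** Rotation invariance of the surface measure is not visible in spherical coordinates. It is
    inherited from Lebesgue measure through [cone], whose volume integral is the sphere integral of
    k. *)
Lemma sphint_rot e : vdot e e = 1 -> sphint (fun s => k (vdot e s)) = sphint (fun s => k (vz s)).
Proof.
move=> /unit_rot[c1 [s1 [c2 [s2 [h1 h2 <-]]]]].
rewrite -integral_cone -(leb3_rotz _ _ h1)// -(leb3_roty _ _ h2)//; last first.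
  by apply: mfun_comp => //; exact: mfun_rotz.
transitivity (\int[leb3 R]_v cone ez v)%E.
  by apply: eq_integral => v _; rewrite /cone /vnorm !(vdot_rotz _ _ h1) !(vdot_roty _ _ h2).
by rewrite integral_cone; apply: eq_sphint => s _; rewrite /vdot /ez /vmk /vx /vy /vz/= !mul0r !add0r mul1r.
Qed.

Lemma sphint_zonal e : vdot e e = 1 -> sphint (fun s => k (vdot e s)) =
  ((2 * pi)%:E * \int[leb1 R]_(th in @itv0pi R) ((sin th)%:E * k (cos th)))%E.
Proof.
move=> /sphint_rot ->.
have pi0 := pi_gt0 R.
have -> : @itv0pi R = [set th | 0 <= th <= pi] by rewrite /itv0pi set_itvcc.
rewrite integral_setb -integral_mull//; last 3 first.
- by rewrite mulr_ge0// ltW.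
- by mfun.
- move=> th; have [/sin_ge0_pi h|] := boolP (0 <= th <= pi)%R; last by rewrite mul0e.
  by rewrite mul1e mule_ge0.
apply: eq_integral => th _; rewrite /sphW.
transitivity (\int[leb1 R]_ph ((0 <= ph <= 2 * pi)%R%:R%:E *
    (((0 <= th <= pi)%R%:R * sin th)%:E * k (cos th))))%E.
  apply: eq_integral => ph _; rewrite [RHS]muleA -EFinM; congr (_%:E * _)%E.
  by rewrite [RHS]mulrC; congr (_ * _); rewrite mulrC.
rewrite -integral_setb.
have -> : [set r : R | (0 <= r <= 2 * pi)%R] = `[0, 2 * pi]%classic by rewrite set_itvcc.
rewrite integral_cst//.
rewrite [X in (_ * X)%E](_ : _ = (2 * pi)%:E); last first.
  etransitivity; first exact: lebesgue_measure_itv.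
  by rewrite /= lte_fin mulr_gt0// oppr0 adde0.
by rewrite muleC; congr (_ * _)%E; rewrite EFinM muleA.
Qed.

End zonal.

End rotations.
(** * The collision change of variables *)

Section collision_change_of_variables.
Context (R : realType).
Variables (g : R) (k : R -> \bar R).
Hypotheses (g02 : 0 <= g <= 2) (mk : measurable_fun setT k) (k0 : forall x, (0 <= k x)%E).
Hypothesis k_supp : forall x, x < - 2^-1 -> k x = 0%E.

(** Here t is the cosine of half the angle a between w and sigma: the vector (w + |w| sigma) / 2
    bisects that angle. Thus k(cos a) becomes k(2 t ^ 2 - 1), and cos a >= -1/2 becomes t >= 1/2. *)
Definition half_angle (t : R) : \bar R := ((2^-1 <= t)%R%:R%:E * k (2 * t ^+ 2 - 1)%R)%E.

Lemma mfun_half_angle : measurable_fun setT half_angle.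
Proof. by rewrite /half_angle; mfun. Qed.

Lemma half_angle_ge0 t : (0 <= half_angle t)%E.
Proof. by rewrite mule_ge0. Qed.

Lemma powR_le4 (a b : R) : 0 <= a -> 0 <= b -> a <= 2 * b -> a `^ g <= 4 * b `^ g.
Proof.
move=> a0 b0 ab; have /andP[g0 g2] := g02.
apply: (@le_trans _ _ ((2 * b) `^ g)).
  by apply: ge0_ler_powR; rewrite ?nnegrE ?mulr_ge0.
rewrite powRM//; apply: ler_wpM2r; first exact: powR_ge0.
apply: (@le_trans _ _ (2 `^ 2)); first by apply: ler_powR; rewrite ?ler1n.
by rewrite powR_mulrn//; lra.
Qed.

Lemma vnorm_ge0 (v : vec3 R) : 0 <= vnorm v.
Proof. exact: sqrtr_ge0. Qed.

Lemma vnorm_sqr (v : vec3 R) : vnorm v ^+ 2 = vx v ^+ 2 + vy v ^+ 2 + vz v ^+ 2.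
Proof.
by rewrite /vnorm sqr_sqrtr /vdot -!expr2// !addr_ge0// sqr_ge0.
Qed.

Lemma vnormE (v : vec3 R) (a : R) : 0 <= a -> vdot v v = a ^+ 2 -> vnorm v = a.
Proof. by move=> a0 va; rewrite /vnorm va sqrtr_sqr ger0_norm. Qed.

Definition zmid (w : vec3 R) : vec3 R := vmk (vx w / 2) (vy w / 2) ((vz w + vnorm w) / 2).

(** On a vertical line z = u - q2 / u, where u is the third coordinate of the image vector and n its
    norm. If u / n >= 1/2, the Jacobian 1 + q2 / u ^ 2 = n ^ 2 / u ^ 2 is at most 4, and |w| = n ^ 2
    / u <= 2 n costs another factor 4 in the power; hence 16. The condition x <> 0 makes q2
    positive. *)
Lemma fiber_bound (F : vec3 R -> \bar R) (x y : R) : x != 0 -> measurable_fun setT F ->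
  (forall v, 0 <= F v)%E ->
  (\int[leb1 R]_z ((vnorm (vmk x y z) `^ g)%:E *
      (k (z / vnorm (vmk x y z))%R * F (zmid (vmk x y z)))) <=
   \int[leb1 R]_z (16%:E * ((vnorm (vmk (x / 2) (y / 2) z) `^ g)%:E *
      (half_angle (z / vnorm (vmk (x / 2) (y / 2) z))%R * F (vmk (x / 2) (y / 2) z)))))%E.
Proof.
move=> x0 mF F0.
pose q2 := (x ^+ 2 + y ^+ 2) / 4.
have q20 : 0 < q2.
  by rewrite divr_gt0// ltr_wpDr ?sqr_ge0// lt0r sqr_ge0 sqrf_eq0 x0.
have mzm : measurable_fun setT (fun z => F (zmid (vmk x y z))).
  by rewrite /zmid; mfun.
rewrite (@leb1_hyperbola _ q2)//; last 2 first.
- by apply: mfun_mule; [mfun|apply: mfun_mule; [mfun|exact: mzm]].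
- by move=> z; rewrite mule_ge0// ?mule_ge0// lee_fin powR_ge0.
apply: ge0_le_integral => //.
- move=> z _; apply: mule_ge0 => //; apply: mule_ge0.
    by rewrite lee_fin addr_ge0// divr_ge0 ?sqr_ge0// ltW.
  by rewrite mule_ge0 ?lee_fin ?powR_ge0// mule_ge0.
- apply: mfun_mule; first by mfun.
  apply: mfun_mule; first by mfun; apply: mfun_invr; mfun.
  have m' : measurable_fun setT (fun x0 : R => x0 - q2 / x0) by mfun.
  apply: mfun_mule; first by mfun.
  apply: mfun_mule; first by mfun.
  exact: (mfun_comp mzm m').
- apply: mfun_mule; first by mfun.
  apply: mfun_mule; first by mfun.
  apply: mfun_mule; last by mfun.
  by apply: mfun_comp; [exact: mfun_half_angle|mfun].
move=> u _; case: ltP => u0; last first.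
  by rewrite mul0e mule_ge0// mule_ge0 ?lee_fin ?powR_ge0// mule_ge0// half_angle_ge0.
rewrite mul1e.
have q0 : 0 < q2 / u by rewrite divr_gt0.
have nw : vnorm (vmk x y (u - q2 / u)) = u + q2 / u.
  apply: vnormE; first by rewrite addr_ge0// ltW.
  rewrite /vdot /vmk /vx /vy /vz /=.
  have -> : x * x + y * y = 4 * q2 by rewrite /q2; field.
  by field; lra.
pose n := vnorm (vmk (x / 2) (y / 2) u).
have nu2 : n ^+ 2 = u * (u + q2 / u).
  rewrite vnorm_sqr /vmk /vx /vy /vz /=.
  have -> : (x / 2) ^+ 2 + (y / 2) ^+ 2 = q2 by rewrite /q2; field.
  by field; lra.
have n0 : 0 < n.
  rewrite lt0r vnorm_ge0 andbT; apply/eqP => n0; move: nu2; rewrite n0 expr0n /= => /esym/eqP.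
  by rewrite gt_eqF// mulr_gt0// addr_gt0.
have -> : zmid (vmk x y (u - q2 / u)) = vmk (x / 2) (y / 2) u.
  by rewrite /zmid nw /vmk /vx /vy /vz /=; congr (_, _, _); field; lra.
rewrite nw -/n /half_angle.
have tE : 2 * (u / n) ^+ 2 - 1 = (u - q2 / u) / (u + q2 / u).
  have -> : 2 * (u / n) ^+ 2 = 2 * u ^+ 2 / n ^+ 2 by field; lra.
  by rewrite nu2; field; rewrite !gt_eqF//= ?addr_gt0 ?mulr_gt0//; nra.
rewrite tE.
(* For u / n < 1/2 the cosine 2 (u / n) ^ 2 - 1 is below -1/2, where k vanishes; these are the
   angles at which the Jacobian is not controlled. *)
have [t2|t2] := leP 2^-1 (u / n); last first.
  rewrite k_supp ?mul0e ?mule0//.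
  rewrite -tE; have : (u / n) ^+ 2 < 2^-1 ^+ 2.
    by rewrite ltr_pXn2r// nnegrE ?divr_ge0// ltW.
  by rewrite (_ : 2^-1 ^+ 2 = 4^-1 :> R); [move: (_ ^+ 2) => X; lra|field].
rewrite mul1e !muleA; apply: lee_wpmul2r => //; apply: lee_wpmul2r => //.
rewrite -!EFinM lee_fin.
have n2u : n <= 2 * u by move: t2; rewrite ler_pdivlMr//; lra.
have e1 : 1 + q2 / u ^+ 2 <= 4.
  have -> : 1 + q2 / u ^+ 2 = n ^+ 2 / u ^+ 2 by rewrite nu2; field; lra.
  rewrite ler_pdivrMr ?exprn_gt0//.
  have -> : 4 * u ^+ 2 = (2 * u) ^+ 2 by ring.
  by rewrite ler_pXn2r// nnegrE ltW// mulr_gt0.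
have e2 : (u + q2 / u) `^ g <= 4 * n `^ g.
  apply: powR_le4; [by rewrite addr_ge0// ltW|exact: ltW|].
  have -> : u + q2 / u = n ^+ 2 / u by rewrite nu2; field; lra.
  by rewrite ler_pdivrMr//; nra.
have e3 : 0 <= n `^ g by exact: powR_ge0.
have e4 : 0 <= (u + q2 / u) `^ g by exact: powR_ge0.
apply: (le_trans (ler_wpM2r e4 e1)).
by apply: (le_trans (ler_wpM2l _ e2)) => //; lra.
Qed.

Lemma integral_leb3_xyz (G : vec3 R -> \bar R) : measurable_fun setT G ->
  (forall v, (0 <= G v)%E) ->
  (\int[leb3 R]_v G v = \int[leb1 R]_x \int[leb1 R]_y \int[leb1 R]_z G (vmk x y z))%E.
Proof.
move=> mG G0; rewrite (integral_leb3 mG G0); etransitivity.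
  apply: (tonelli_swap (leb1 R) (leb1 R) (F := fun z x => \int[leb1 R]_y G (vmk x y z)))%E.
    by apply: (mfun_integral2 (leb1 R) (F := fun p y => G (vmk p.2 y p.1))) => //; mfun.
  by move=> z x; apply: integral_ge0.
apply: eq_integral => x _.
have mGx : measurable_fun setT (fun p : R * R => G (vmk x p.2 p.1)) by mfun.
exact: (tonelli_swap (leb1 R) (leb1 R) (F := fun z y => G (vmk x y z)) mGx (fun z y => G0 _)).
Qed.

Lemma integral_leb3_xyz_mull (a : R) (G : vec3 R -> \bar R) : 0 <= a -> measurable_fun setT G ->
  (forall v, (0 <= G v)%E) ->
  (\int[leb1 R]_x \int[leb1 R]_y \int[leb1 R]_z (a%:E * G (vmk x y z)) = a%:E * \int[leb3 R]_v G v)%E.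
Proof.
move=> a0 mG G0.
have maG : measurable_fun setT (fun v => a%:E * G v)%E by apply: mfun_mule; [exact: measurable_cst|exact: mG].
have aG0 v : (0 <= a%:E * G v)%E by rewrite mule_ge0.
exact: (etrans (esym (integral_leb3_xyz (G := fun v => a%:E * G v)%E maG aG0)) (integral_mull (leb3 R) a0 mG G0)).
Qed.

Lemma leb1_half (G : R -> \bar R) : measurable_fun setT G -> (forall x, (0 <= G x)%E) ->
  (\int[leb1 R]_x G (x / 2)%R = 2%:E * \int[leb1 R]_x G x)%E.
Proof.
move=> mG G0; have h : (0 : R) < 2 by [].
have mG2 : measurable_fun setT (fun x : R => G (x / 2)) by mfun.
rewrite (leb1_scale 0 h mG2 (fun x => G0 _)) -integral_mull//.
by apply: eq_integral => x _; congr (_ * G _)%E; field.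
Qed.

Let pre (F : vec3 R -> \bar R) (w : vec3 R) : \bar R :=
  ((vnorm w `^ g)%:E * (k (vz w / vnorm w)%R * F (zmid w)))%E.
Let post (F : vec3 R -> \bar R) (u : vec3 R) : \bar R :=
  ((vnorm u `^ g)%:E * (half_angle (vz u / vnorm u)%R * F u))%E.

(** The factor 64 is 16 from the vertical lines times 4 from undoing the halving of the two
    horizontal coordinates. The plane x = 0 is discarded as a null set. *)
Lemma star_z (F : vec3 R -> \bar R) : measurable_fun setT F -> (forall v, 0 <= F v)%E ->
  (\int[leb3 R]_w pre F w <= 64%:E * \int[leb3 R]_u post F u)%E.
Proof.
move=> mF F0.
have mpre : measurable_fun setT (pre F).
  apply: mfun_mule; first by mfun.
  apply: mfun_mule; first by mfun.
  by apply: mfun_comp => //; rewrite /zmid; mfun.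
have pre0 w : (0 <= pre F w)%E by rewrite mule_ge0 ?lee_fin ?powR_ge0// mule_ge0.
have mpost : measurable_fun setT (post F).
  apply: mfun_mule; first by mfun.
  apply: mfun_mule; last by mfun.
  by apply: mfun_comp; [exact: mfun_half_angle|mfun].
have post0 w : (0 <= post F w)%E.
  by rewrite mule_ge0 ?lee_fin ?powR_ge0// mule_ge0// half_angle_ge0.
pose A (x y : R) := (\int[leb1 R]_z pre F (vmk x y z))%E.
pose B (x y : R) := (\int[leb1 R]_z (16%:E * post F (vmk x y z)))%E.
have mA : measurable_fun setT (fun p => A p.1 p.2).
  by apply: (mfun_integral2 (leb1 R) (F := fun p z => pre F (vmk p.1 p.2 z))) => //; mfun.
have A0 x y : (0 <= A x y)%E by apply: integral_ge0.
have p0 x : (0 <= 16%:E * post F x)%E by rewrite mule_ge0.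
have mB : measurable_fun setT (fun p => B p.1 p.2).
  by apply: (mfun_integral2 (leb1 R) (F := fun p z => 16%:E * post F (vmk p.1 p.2 z))%E) => //; mfun.
have B0 x y : (0 <= B x y)%E by apply: integral_ge0.
have mB2 : measurable_fun setT (fun p : R * R => B (p.1 / 2) (p.2 / 2)).
  have h1 : measurable_fun setT (fun p : R * R => p.1 / 2) by mfun.
  have h2 : measurable_fun setT (fun p : R * R => p.2 / 2) by mfun.
  exact: (mfun_comp2 mB h1 h2).
rewrite (integral_leb3_xyz mpre pre0).
apply: (@le_trans _ _ (\int[leb1 R]_x \int[leb1 R]_y B (x / 2)%R (y / 2)%R)%E).
  have e : (\int[leb1 R]_x \int[leb1 R]_y A x y =
     \int[leb1 R]_x ((x != 0)%R%:R%:E * \int[leb1 R]_y A x y))%E.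
    have mI : measurable_fun setT (fun x => \int[leb1 R]_y A x y)%E.
      exact: (mfun_integral2 (leb1 R) mA A0).
    have I0 x : (0 <= \int[leb1 R]_y A x y)%E by apply: integral_ge0.
    have mn : measurable_fun setT (fun x : R => x != 0).
      apply: (mfun_comp (h := negb) (a := fun x : R => x == 0)) => //.
      exact: measurable_fun_eqr.
    apply: (@leb1_except _ [:: 0]) => //.
    - by apply: mfun_mule => //; apply: mfunEFin; apply: mfun_bool.
    - by move=> x; rewrite mule_ge0.
    - by move=> x; rewrite inE => ->; rewrite mul1e.
  rewrite /A in e; rewrite e; apply: ge0_le_integral => //.
  - by move=> x _; apply: mule_ge0 => //; apply: integral_ge0 => y _; exact: A0.
  - apply: mfun_mule; last exact: (mfun_integral2 (leb1 R) mA A0).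
    apply: mfunEFin; apply: mfun_bool.
    by apply: (mfun_comp (h := negb) (a := fun x : R => x == 0)) => //; exact: measurable_fun_eqr.
  - exact: (mfun_integral2 (leb1 R) (F := fun x y : R => B (x / 2) (y / 2)) mB2 (fun x y => B0 _ _)).
  move=> x _; have [->|x0] := eqVneq x 0.
    by rewrite mul0e; apply: integral_ge0 => y _; exact: B0.
  rewrite mul1e; apply: ge0_le_integral => //.
  - by move=> y _; exact: A0.
  - exact: (mfun_sect1 (F := A) mA x).
  - exact: (mfun_sect1 (F := fun x y : R => B (x / 2) (y / 2)) mB2 x).
  by move=> y _; exact: (fiber_bound y x0 mF F0).
have mBx : measurable_fun setT (fun x => \int[leb1 R]_y B x y)%E.
  exact: (mfun_integral2 (leb1 R) mB B0).
have e1 : (\int[leb1 R]_x \int[leb1 R]_y B (x / 2)%R (y / 2)%R = 4%:E * \int[leb1 R]_x \int[leb1 R]_y B x y)%E.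
  rewrite (_ : 4 = 2 * 2 :> R) ?EFinM -?muleA; last by lra.
  have I0 x : (0 <= \int[leb1 R]_y B x y)%E by apply: integral_ge0.
  rewrite -(leb1_half mBx I0).
  have mh : measurable_fun setT (fun x : R => x / 2) by mfun.
  have mBx2 := mfun_comp mBx mh.
  rewrite -(integral_mull (leb1 R) _ mBx2 (fun x => I0 _))//.
  apply: eq_integral => x _.
  exact: (leb1_half (mfun_sect1 mB (x / 2)) (fun y => B0 _ y)).
rewrite e1 (_ : 64 = 4 * 16 :> R) ?EFinM -?muleA; last by lra.
rewrite le_eqVlt; apply/orP; left; apply/eqP; congr (_ * _)%E.
exact: (integral_leb3_xyz_mull (ler0n R 16) mpost post0).
Qed.

End collision_change_of_variables.
Section collision_gain.
Context (R : realType).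
Variables (g : R) (k : R -> \bar R).
Hypotheses (g02 : 0 <= g <= 2) (mk : measurable_fun setT k) (k0 : forall x, (0 <= k x)%E).
Hypothesis k_supp : forall x, x < - 2^-1 -> k x = 0%E.

(** Both v' - v and v - w' are values of this map, at w - v and at v - w respectively; [zmid] is the
    case where sigma is the z axis. *)
Definition smid (w s : vec3 R) : vec3 R := vscale 2^-1 (vadd w (vscale (vnorm w) s)).

Variable F : vec3 R -> \bar R.
Hypotheses (mF : measurable_fun setT F) (F0 : forall v, (0 <= F v)%E).

Let pre (w s : vec3 R) : \bar R :=
  ((vnorm w `^ g)%:E * (k (vdot w s / vnorm w)%R * F (smid w s)))%E.
Let post (u s : vec3 R) : \bar R :=
  ((vnorm u `^ g)%:E * (half_angle k (vdot u s / vnorm u)%R * F u))%E.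

Let mpre : measurable_fun setT (fun p => pre p.1 p.2).
Proof.
apply: mfun_mule; first by mfun.
apply: mfun_mule; first by mfun.
by apply: mfun_comp => //; rewrite /smid; mfun.
Qed.

Let pre0 w s : (0 <= pre w s)%E.
Proof. by rewrite mule_ge0 ?lee_fin ?powR_ge0// mule_ge0. Qed.

Let mpost : measurable_fun setT (fun p => post p.1 p.2).
Proof.
apply: mfun_mule; first by mfun.
apply: mfun_mule; last by mfun.
by apply: mfun_comp; [exact: mfun_half_angle|mfun].
Qed.

Let post0 w s : (0 <= post w s)%E.
Proof. by rewrite mule_ge0 ?lee_fin ?powR_ge0// mule_ge0// half_angle_ge0. Qed.

Let star_fixed s : vdot s s = 1 ->
  (\int[leb3 R]_w pre w s <= 64%:E * \int[leb3 R]_u post u s)%E.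
Proof.
move=> /unit_rot[c1 [s1 [c2 [s2 [h1 h2 sE]]]]].
have mpre_s : measurable_fun setT (pre^~ s) := mfun_sect2 mpre s.
have mpost_s : measurable_fun setT (post^~ s) := mfun_sect2 mpost s.
pose rot v := rotz c1 s1 (roty c2 s2 v).
have mrot : measurable_fun setT rot by apply: mfun_comp; [exact: mfun_rotz|exact: mfun_roty].
have irot (G : vec3 R -> \bar R) : measurable_fun setT G -> (forall v, (0 <= G v)%E) ->
    (\int[leb3 R]_v G v = \int[leb3 R]_v G (rot v))%E.
  move=> mG G0; rewrite -(leb3_rotz mG G0 h1).
  have mG' : measurable_fun setT (fun v => G (rotz c1 s1 v)).
    by apply: mfun_comp => //; exact: mfun_rotz.
  by rewrite -(leb3_roty mG' (fun v => G0 _) h2).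
have dotE v : vdot (rot v) s = vz v.
  rewrite -sE /rot (vdot_rotz _ _ h1) (vdot_roty _ _ h2).
  by rewrite /vdot /ez /vmk /vx /vy /vz /= !mulr0 !add0r mulr1.
have normE v : vnorm (rot v) = vnorm v.
  by rewrite /vnorm /rot (vdot_rotz _ _ h1) (vdot_roty _ _ h2).
rewrite (irot _ mpre_s (fun w => pre0 w s)) (irot _ mpost_s (fun w => post0 w s)).
have mFr : measurable_fun setT (fun v => F (rot v)) by exact: mfun_comp.
have e1 : (\int[leb3 R]_w pre (rot w) s = \int[leb3 R]_w
    ((vnorm w `^ g)%:E * (k (vz w / vnorm w)%R * F (rot (zmid w)))))%E.
  apply: eq_integral => w _; rewrite /pre dotE normE; congr (_ * (_ * F _))%E.
  rewrite /smid normE -sE /rot /zmid /rotz /roty /ez /vscale /vadd /vmk /vx /vy /vz /=.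
  by congr (_, _, _); field.
have e2 : (\int[leb3 R]_w post (rot w) s = \int[leb3 R]_w
    ((vnorm w `^ g)%:E * (half_angle k (vz w / vnorm w)%R * F (rot w))))%E.
  by apply: eq_integral => w _; rewrite /post dotE normE.
rewrite e1 e2; exact: (star_z g02 mk k0 k_supp mFr (fun v => F0 _)).
Qed.

(** At fixed sigma a rotation brings sigma to the z axis, where [star_z] applies. After the change
    of variables F depends on u alone, and the angular integral separates from it. *)
Lemma star : (\int[leb3 R]_w sphint (fun s => (vnorm w `^ g)%:E *
      (k (vdot w s / vnorm w)%R * F (smid w s))) <=
   64%:E * \int[leb3 R]_u ((vnorm u `^ g)%:E * (F u *
      sphint (fun s => half_angle k (vdot u s / vnorm u)%R))))%E.
Proof.
rewrite -[leLHS]/(\int[leb3 R]_w sphint (pre w))%E.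
rewrite (sphint_swap mpre pre0).
have m1 : measurable_fun setT (fun s => \int[leb3 R]_w pre w s)%E.
  exact: (mfun_integral1 (sleb3 R) mpre pre0).
have m2 : measurable_fun setT (fun s => \int[leb3 R]_w post w s)%E.
  exact: (mfun_integral1 (sleb3 R) mpost post0).
have i2 s : (0 <= \int[leb3 R]_w post w s)%E by apply: integral_ge0.
apply: (@le_trans _ _ (sphint (fun s => 64%:E * \int[leb3 R]_w post w s))%E).
  have m64 : measurable_fun setT (fun s => 64%:E * \int[leb3 R]_w post w s)%E.
    by apply: mfun_mule => //; mfun.
  apply: le_sphint; [exact: m1|exact: m64| | |].
  - by move=> s; apply: integral_ge0.
  - by move=> s; apply: mule_ge0.
  - exact: star_fixed.
rewrite (sphint_mull _ m2 i2)// -(sphint_swap mpost post0).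
rewrite le_eqVlt; apply/orP; left; apply/eqP; congr (_ * _)%E.
apply: eq_integral => u _.
have mh : measurable_fun setT (fun s => half_angle k (vdot u s / vnorm u)).
  by apply: mfun_comp; [exact: mfun_half_angle|mfun].
have [x xE] : exists x : \bar R, x = F u by exists (F u).
rewrite /post -xE.
have x0 : (0 <= x)%E by rewrite xE.
transitivity (sphint (fun s => (vnorm u `^ g)%:E * (half_angle k (vdot u s / vnorm u)%R * x)))%E => //.
have h0 s : (0 <= half_angle k (vdot u s / vnorm u))%E by exact: half_angle_ge0.
rewrite sphint_mull ?powR_ge0//; last 2 first.
- by apply: mfun_mule.
- by move=> s; apply: mule_ge0.
congr (_ * _)%E; rewrite muleC /sphint -ge0_integralZr//; last 2 first.
- apply: (mfun_integral2 (leb1 R) (F := fun th ph => (sphW th ph)%:E * half_angle k (vdot u (sph th ph) / vnorm u)))%E.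
    apply: mfun_mule; first by apply: mfunEFin; apply: mfun_sphW; mfun.
    by apply: mfun_comp; [exact: mfun_half_angle|mfun].
  by move=> th ph; rewrite mule_ge0// lee_fin sphW_ge0.
- move=> th _; apply: integral_ge0 => ph _; rewrite mule_ge0// lee_fin sphW_ge0//.
apply: eq_integral => th _; rewrite -ge0_integralZr//; last 2 first.
- apply: mfun_mule; first by apply: mfunEFin; apply: mfun_sphW; mfun.
  by apply: mfun_comp; [exact: mfun_half_angle|mfun].
- by move=> ph _; rewrite mule_ge0// lee_fin sphW_ge0.
by apply: eq_integral => ph _; rewrite muleA.
Qed.

End collision_gain.

Section half_angle_integral.
Context (R : realType).
Variable k : R -> \bar R.
Hypotheses (mk : measurable_fun setT k) (k0 : forall x, (0 <= k x)%E).

Lemma vdot_normalize (u : vec3 R) : vnorm u != 0 ->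
  vdot (vscale (vnorm u)^-1 u) (vscale (vnorm u)^-1 u) = 1.
Proof.
move=> u0.
have -> : vdot (vscale (vnorm u)^-1 u) (vscale (vnorm u)^-1 u) = (vnorm u)^-1 ^+ 2 * vdot u u.
  by rewrite /vdot /vscale /vmk /vx /vy /vz /=; ring.
have -> : vdot u u = vnorm u ^+ 2 by rewrite vnorm_sqr /vdot -!expr2.
by field.
Qed.

(** With polar angle th around u, the integrand is k(cos 2 th), so th is doubled. The factor 1/2
    comes from dth, and sin th <= 2 sin th cos th = sin 2 th because cos th >= 1/2. *)
Lemma sphint_half_angle u : (sphint (fun s => half_angle k (vdot u s / vnorm u)) <=
   2^-1%:E * ((2 * pi)%:E * \int[leb1 R]_(th in @itv0pi R) ((sin th)%:E * k (cos th))))%E.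
Proof.
have pi0 := pi_gt0 R.
have itvE : @itv0pi R = [set th | 0 <= th <= pi] by rewrite /itv0pi set_itvcc.
have I0 : (0 <= \int[leb1 R]_(th in @itv0pi R) ((sin th)%:E * k (cos th)))%E.
  apply: integral_ge0 => th; rewrite itvE /= => th0; rewrite mule_ge0// lee_fin.
  exact: sin_ge0_pi.
(* For u = 0 the quotient is 0 by the convention on division, below the threshold 1/2 of
   [half_angle]. *)
have [u0|u0] := eqVneq (vnorm u) 0.
  have -> : sphint (fun s => half_angle k (vdot u s / vnorm u)) = 0%E.
    rewrite /sphint integral0_eq// => th _; rewrite integral0_eq// => ph _.
    rewrite /half_angle u0 invr0 mulr0.
    by rewrite (_ : (2^-1 <= 0) = false) ?mul0e ?mule0//; apply/negbTE; rewrite -ltNge; lra.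
  by apply: mule_ge0; rewrite ?lee_fin ?invr_ge0// mule_ge0// lee_fin mulr_ge0// ltW.
have e1 := vdot_normalize u0.
have -> : (fun s => half_angle k (vdot u s / vnorm u)) =
    (fun s => half_angle k (vdot (vscale (vnorm u)^-1 u) s)).
  apply/funext => s; congr half_angle.
  by rewrite /vdot /vscale /vmk /vx /vy /vz /=; ring.
have mh := mfun_half_angle mk; have h0 := half_angle_ge0 k0.
rewrite (sphint_zonal mh h0 e1) muleCA.
apply: lee_wpmul2l; first by rewrite lee_fin mulr_ge0// ltW.
rewrite itvE !integral_setb.
have m1 : measurable_fun setT (fun th : R => (0 <= th <= pi)%R%:R%:E * ((sin th)%:E * k (cos th)))%E by mfun.
have p1 th : (0 <= (0 <= th <= pi)%R%:R%:E * ((sin th)%:E * k (cos th)))%E.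
  have [/sin_ge0_pi h|_] := boolP (0 <= th <= pi)%R; last by rewrite mul0e.
  by rewrite mul1e mule_ge0.
have h2 : (0 : R) < 2 by [].
have ml : measurable_fun setT (fun th : R => 2 * th + 0) by mfun.
have m1' := mfun_comp m1 ml.
rewrite (leb1_scale 0 h2 m1 p1) (integral_mull (leb1 R) (ltW h2) m1' (fun x => p1 _)).
rewrite muleA -EFinM mulVf ?gt_eqF// mul1e.
apply: ge0_le_integral => //.
- move=> th _; have [/sin_ge0_pi h|_] := boolP (0 <= th <= pi)%R; last by rewrite mul0e.
  by rewrite mul1e mule_ge0.
- by apply: mfun_mule; [mfun|apply: mfun_mule; [mfun|apply: mfun_comp; [exact: mh|mfun]]].
move=> th _; rewrite addr0.
have [/andP[t0 tpi]|_] := boolP (0 <= th <= pi)%R; last by rewrite mul0e p1.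
rewrite mul1e /half_angle.
have [c2|_] := leP 2^-1 (cos th); last by rewrite mul0e mule0 p1.
have t2 : 0 <= 2 * th <= pi.
  rewrite mulr_ge0//=; rewrite leNgt; apply/negP => h.
  suff : cos th < 0 by lra.
  rewrite -(subrK (pi / 2) th) cosDpihalf oppr_lt0; apply: sin_gt0_pi.
  by apply/andP; split; lra.
rewrite t2 !mul1e.
have -> : 2 * cos th ^+ 2 - 1 = cos (2 * th).
  by rewrite !mulr_natl cos_mulr2n.
rewrite lee_wpmul2r// lee_fin.
have -> : sin (2 * th) = 2 * (sin th * cos th) by rewrite !mulr_natl sin_mulr2n mulrC.
have s0 : 0 <= sin th by apply: sin_ge0_pi; rewrite t0.
by nra.
Qed.

End half_angle_integral.
(** * Upper bounds for the collision operator *)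

Section collision_bounds.
Context (R : realType).

Lemma leb3_reflect (v : vec3 R) (F : vec3 R -> \bar R) : measurable_fun setT F ->
  (forall v, (0 <= F v)%E) -> (\int[leb3 R]_x F (vsub v x) = \int[leb3 R]_x F x)%E.
Proof.
move=> mF F0; rewrite -(leb3_shift mF F0 v).
have mG : measurable_fun setT (fun x => F (vadd x v)) by mfun.
rewrite -(leb3_opp mG (fun x => F0 _)).
apply: eq_integral => x _; congr F.
by rewrite /vsub /vadd /vscale /vmk /vx /vy /vz /=; congr (_, _, _); ring.
Qed.

(** With a the first coordinate of v, the removed hyperplane contains the point w = v, at which the
    direction of v - w is undefined. *)
Lemma leb3_except (a : R) (F : vec3 R -> \bar R) : measurable_fun setT F ->
  (forall v, (0 <= F v)%E) ->
  (\int[leb3 R]_x F x = \int[leb3 R]_x ((vx x != a)%R%:R%:E * F x))%E.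
Proof.
move=> mF F0.
have mn : measurable_fun setT (fun x : R => x != a).
  apply: (mfun_comp (h := negb) (a := fun x : R => x == a)) => //.
  exact: measurable_fun_eqr.
have mG : measurable_fun setT (fun x : vec3 R => (vx x != a)%R%:R%:E * F x)%E.
  apply: mfun_mule => //; apply: mfunEFin; apply: mfun_bool.
  by apply: (mfun_comp mn); mfun.
have G0 x : (0 <= (vx x != a)%R%:R%:E * F x)%E by rewrite mule_ge0.
rewrite (integral_leb3 mF F0) (integral_leb3 mG G0); apply: eq_integral => z _.
have I0 x : (0 <= \int[leb1 R]_y F (vmk x y z))%E by apply: integral_ge0.
have mFz : measurable_fun setT (fun p : R * R => F (vmk p.1 p.2 z)) by mfun.
have mI : measurable_fun setT (fun x => \int[leb1 R]_y F (vmk x y z))%E.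
  exact: (mfun_integral2 (leb1 R) (F := fun x y => F (vmk x y z)) mFz (fun x y => F0 _)).
transitivity (\int[leb1 R]_x ((x != a)%R%:R%:E * \int[leb1 R]_y F (vmk x y z)))%E.
  apply: (@leb1_except _ [:: a]) => //.
  - by apply: mfun_mule => //; apply: mfunEFin; apply: mfun_bool.
  - by move=> x; rewrite mule_ge0.
  - by move=> x; rewrite inE => ->; rewrite mul1e.
apply: eq_integral => x _.
have mFy : measurable_fun setT (fun y => F (vmk x y z)) by mfun.
by rewrite -(integral_mull (leb1 R) (ler0n R (x != a)) mFy (fun y => F0 _)).
Qed.

Lemma mfun_coll (Psi : vec3 R -> vec3 R -> \bar R) :
  measurable_fun setT (fun p => Psi p.1 p.2) ->
  measurable_fun setT (fun p : vec3 R * R * R => Psi p.1.1 (sph p.1.2 p.2)).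
Proof. by move=> mP; mfun. Qed.

Lemma coll_integral (Psi : vec3 R -> vec3 R -> \bar R) :
  measurable_fun setT (fun p => Psi p.1 p.2) -> (forall w s, (0 <= Psi w s)%E) ->
  (\int[product_measure1 (product_measure1 (leb3 R) (leb1 R)) (leb1 R)]_(z in @coll_dom R)
     ((sin z.1.2)%:E * Psi z.1.1 (sph z.1.2 z.2)) = \int[leb3 R]_w sphint (Psi w))%E.
Proof.
move=> mP P0.
pose G (w : vec3 R) (th ph : R) : \bar R := ((sphW th ph)%:E * Psi w (sph th ph))%E.
have mG : measurable_fun setT (fun p : vec3 R * R * R => G p.1.1 p.1.2 p.2).
  apply: mfun_mule; first by apply: mfunEFin; apply: mfun_sphW; mfun.
  exact: mfun_coll.
have G0 w th ph : (0 <= G w th ph)%E by rewrite mule_ge0// lee_fin sphW_ge0.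
transitivity (\int[product_measure1 (product_measure1 (leb3 R) (leb1 R)) (leb1 R)]_z
    G z.1.1 z.1.2 z.2)%E.
  rewrite integral_mkcond; apply: eq_integral => -[[w th] ph] _; rewrite patchE /G /sphW /=.
  have [zc|zc] := boolP (((w, th), ph) \in @coll_dom R).
    by have /= [h1 h2] := set_mem zc; rewrite h1 h2 !mulr1.
  have : ~~ ((0 <= th <= pi) && (0 <= ph <= 2 * pi)).
    apply/negP => /andP[h1 h2]; move/negP: zc; apply; exact/mem_set.
  by rewrite negb_and => /orP[/negbTE ->|/negbTE ->]; rewrite !(mulr0, mul0r, mul0e).
have mG' : measurable_fun setT (fun p : (vec3 R * R) * R => G p.1.1 p.1.2 p.2) by exact: mG.
etransitivity.
  exact: (tonelli_prod (sfprod (sleb3 R) (leb1 R)) (leb1 R) (F := fun p ph => G p.1 p.2 ph) mG' (fun p ph => G0 _ _ _)).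
have m2 : measurable_fun setT (fun p : vec3 R * R => \int[leb1 R]_ph G p.1 p.2 ph)%E.
  exact: (mfun_integral2 (leb1 R) (F := fun p ph => G p.1 p.2 ph) mG' (fun p ph => G0 _ _ _)).
have i0 w th : (0 <= \int[leb1 R]_ph G w th ph)%E by apply: integral_ge0.
exact: (tonelli_prod (sleb3 R) (leb1 R) (F := fun w th => \int[leb1 R]_ph G w th ph)%E m2 i0).
Qed.

Lemma powR_le_sqr (g a : R) : 0 <= g <= 2 -> 0 <= a -> a `^ g <= 1 + a ^+ 2.
Proof.
move=> /andP[g0 g2] a0; have [a1|a1] := leP a 1.
  apply: (@le_trans _ _ (1 `^ g)); first by apply: ge0_ler_powR; rewrite ?nnegrE.
  by rewrite powR1 lerDl sqr_ge0.
apply: (@le_trans _ _ (a `^ 2)); first by apply: ler_powR => //; exact: ltW.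
by rewrite powR_mulrn// lerDr.
Qed.

Lemma vnorm_sub_sqr (v w : vec3 R) : vnorm (vsub v w) ^+ 2 <= 2 * vnorm v ^+ 2 + 2 * vnorm w ^+ 2.
Proof.
rewrite !vnorm_sqr; case: v => -[a b] c; case: w => -[x y] z.
rewrite /vsub /vmk /vx /vy /vz /=.
have h (p q : R) : (p - q) ^+ 2 <= 2 * p ^+ 2 + 2 * q ^+ 2.
  by have := sqr_ge0 (p + q); nra.
have := h a x; have := h b y; have := h c z; lra.
Qed.

Lemma powR_sub_le (g : R) (v w : vec3 R) : 0 <= g <= 2 ->
  vnorm (vsub v w) `^ g <= 2 * (1 + vnorm v ^+ 2) * (1 + vnorm w ^+ 2).
Proof.
move=> g02; apply: (le_trans (powR_le_sqr g02 (vnorm_ge0 _))).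
have := vnorm_sub_sqr v w.
have := sqr_ge0 (vnorm v); have := sqr_ge0 (vnorm w); have := mulr_ge0 (sqr_ge0 (vnorm v)) (sqr_ge0 (vnorm w)).
move: (_ ^+ 2) (vnorm v ^+ 2) (vnorm w ^+ 2) => A B C; nra.
Qed.

Section moment.
Variables (g : R) (h : vec3 R -> R) (E : R).
Hypotheses (g02 : 0 <= g <= 2) (mh : measurable_fun setT h) (h0 : forall v, 0 <= h v).
Hypothesis hE : norm12 h = E%:E.

Let E0 : 0 <= E.
Proof. by rewrite -lee_fin -hE; apply: integral_ge0 => v _; rewrite lee_fin mulr_ge0// addr_ge0// sqr_ge0. Qed.

Lemma moment_bound v : (\int[leb3 R]_w (vnorm (vsub v w) `^ g * h w)%:E <=
  (2 * (1 + vnorm v ^+ 2) * E)%:E)%E.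
Proof.
have c0 : 0 <= 2 * (1 + vnorm v ^+ 2) by rewrite mulr_ge0// addr_ge0// sqr_ge0.
have m1 : measurable_fun setT (fun w => (`|h w| * (1 + vnorm w ^+ 2))%:E) by mfun.
have p1 w : (0 <= (`|h w| * (1 + vnorm w ^+ 2))%:E)%E.
  by rewrite lee_fin mulr_ge0// addr_ge0// sqr_ge0.
rewrite EFinM -hE /norm12 -(integral_mull (leb3 R) c0 m1 p1).
apply: ge0_le_integral => //.
- by move=> w _; rewrite lee_fin mulr_ge0// powR_ge0.
- by mfun.
- by apply: mfun_mule => //; mfun.
move=> w _; rewrite -EFinM lee_fin ger0_norm// [h w * _]mulrC mulrA.
by apply: ler_wpM2r => //; exact: powR_sub_le.
Qed.

End moment.

End collision_bounds.
Lemma eq_leW d (T : porderType d) (x y : T) : x = y -> (x <= y)%O.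
Proof. by move=> ->. Qed.

Section kernel_bounds.
Context (R : realType).

Lemma sphintD (F G : vec3 R -> \bar R) : measurable_fun setT F -> measurable_fun setT G ->
  (forall s, 0 <= F s)%E -> (forall s, 0 <= G s)%E ->
  sphint (fun s => F s + G s)%E = (sphint F + sphint G)%E.
Proof.
move=> mF mG F0 G0.
have m2 (H : vec3 R -> \bar R) : measurable_fun setT H ->
    measurable_fun setT (fun p => (sphW p.1 p.2)%:E * H (sph p.1 p.2))%E.
  by move=> mH; apply: mfun_mule; [apply: mfunEFin; apply: mfun_sphW|]; mfun.
have W0 (H : vec3 R -> \bar R) : (forall s, 0 <= H s)%E ->
    forall th ph, (0 <= (sphW th ph)%:E * H (sph th ph))%E.
  by move=> H0 th ph; rewrite mule_ge0// lee_fin sphW_ge0.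
have i0 (H : vec3 R -> \bar R) : (forall s, 0 <= H s)%E ->
    forall th, (0 <= \int[leb1 R]_ph ((sphW th ph)%:E * H (sph th ph)))%E.
  by move=> H0 th; apply: integral_ge0 => ph _; exact: W0.
rewrite /sphint -ge0_integralD//; last 4 first.
- by move=> th _; exact: i0.
- exact: (mfun_integral2 (leb1 R) (F := fun th ph => (sphW th ph)%:E * F (sph th ph))%E (m2 _ mF) (W0 _ F0)).
- by move=> th _; exact: i0.
- exact: (mfun_integral2 (leb1 R) (F := fun th ph => (sphW th ph)%:E * G (sph th ph))%E (m2 _ mG) (W0 _ G0)).
apply: eq_integral => th _; rewrite -ge0_integralD//; last 4 first.
- by move=> ph _; exact: W0.
- exact: (mfun_sect1 (F := fun th ph => (sphW th ph)%:E * F (sph th ph))%E (m2 _ mF) th).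
- by move=> ph _; exact: W0.
- exact: (mfun_sect1 (F := fun th ph => (sphW th ph)%:E * G (sph th ph))%E (m2 _ mG) th).
by apply: eq_integral => ph _; rewrite ge0_muleDr.
Qed.

Lemma costhetaE (v vs s : vec3 R) :
  costheta v vs s = vdot (vsub v vs) s / vnorm (vsub v vs).
Proof. by rewrite /costheta /vdot /vscale /vmk /vx /vy /vz /=; ring. Qed.

Lemma vpost_sE (v vs s : vec3 R) : vpost_s v vs s = vsub v (smid (vsub v vs) s).
Proof.
rewrite /vpost_s /smid; move: (vnorm _) => n.
by rewrite /vsub /vadd /vscale /vmk /vx /vy /vz /=; congr (_, _, _); field.
Qed.

Lemma vnorm_subC (v w : vec3 R) : vnorm (vsub v w) = vnorm (vsub w v).
Proof. by rewrite /vnorm /vdot /vsub /vmk /vx /vy /vz /=; congr Num.sqrt; ring. Qed.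

Lemma vpostE (v vs s : vec3 R) : vpost v vs s = vadd v (smid (vsub vs v) s).
Proof.
rewrite /vpost /smid (vnorm_subC vs v); move: (vnorm _) => n.
by rewrite /vsub /vadd /vscale /vmk /vx /vy /vz /=; congr (_, _, _); field.
Qed.

Lemma costheta_opp (v vs s : vec3 R) :
  vdot (vsub vs v) s / vnorm (vsub vs v) = - costheta v vs s.
Proof.
rewrite costhetaE (vnorm_subC vs v) -mulNr; congr (_ / _).
by rewrite /vdot /vsub /vmk /vx /vy /vz /=; ring.
Qed.

Lemma mfun_smid d (T : measurableType d) (w s : T -> vec3 R) : measurable_fun setT w ->
  measurable_fun setT s -> measurable_fun setT (fun x => smid (w x) (s x)).
Proof. by move=> mw ms; rewrite /smid; mfun. Qed.

Lemma mfun_vpost (v : vec3 R) : measurable_fun setT (fun p : vec3 R * vec3 R => vpost v p.1 p.2).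
Proof. by rewrite /vpost; mfun. Qed.

Lemma mfun_vpost_s (v : vec3 R) : measurable_fun setT (fun p : vec3 R * vec3 R => vpost_s v p.1 p.2).
Proof. by rewrite /vpost_s; mfun. Qed.

Lemma mfun_costheta (v : vec3 R) : measurable_fun setT (fun p : vec3 R * vec3 R => costheta v p.1 p.2).
Proof. by rewrite /costheta; mfun. Qed.

(** * Almost no collision with |cos theta| <= 1/2 leads into a null set *)

Section null_sets.
Variable Z : set (vec3 R).
Hypotheses (mZ : measurable Z) (Z0 : leb3 R Z = 0%E).

Lemma integral_null (F : vec3 R -> \bar R) : measurable_fun setT F ->
  (\int[leb3 R]_x (F x * (\1_Z x)%:E) = 0)%E.
Proof.
move=> mF.
have -> : (\int[leb3 R]_x (F x * (\1_Z x)%:E) = \int[leb3 R]_(x in Z) F x)%E.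
  rewrite [RHS]integral_mkcond; apply: eq_integral => x _; rewrite patchE indicE.
  by case: (x \in Z); rewrite ?mule1 ?mule0.
have mFZ : measurable_fun Z F by exact: measurable_funTS.
exact: (@null_set_integral _ _ R (leb3 R) Z F mZ mFZ Z0).
Qed.

Let k0 (x : R) : \bar R := ((- 2^-1 <= x)%R%:R)%:E.

(** [star] with exponent 0 bounds the left side by an integral of the indicator of Z at T u against
    a weight in u. Writing the weight as P (T u) by means of the left inverse T' allows the
    measure-preserving T to be removed, and an integral over Z remains. *)
Let post_null (T : vec3 R -> vec3 R) : measurable_fun setT T ->
  (forall F : vec3 R -> \bar R, measurable_fun setT F -> (forall v, (0 <= F v)%E) ->
    (\int[leb3 R]_u F (T u) = \int[leb3 R]_u F u)%E) ->
  (forall u, T (T u) = u) \/ (exists2 T' : vec3 R -> vec3 R, measurable_fun setT T' & forall u, T' (T u) = u) ->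
  (\int[leb3 R]_w sphint (fun s => k0 (vdot w s / vnorm w) * (\1_Z (T (smid w s)))%:E) = 0)%E.
Proof.
move=> mT iT TK.
have [T' mT' T'K] : exists2 T' : vec3 R -> vec3 R, measurable_fun setT T' & forall u, T' (T u) = u.
  by case: TK => // TK; exists T.
have mk0 : measurable_fun setT k0 by rewrite /k0; mfun.
have k00 x : (0 <= k0 x)%E by rewrite lee_fin.
have k0s x : x < - 2^-1 -> k0 x = 0%E by rewrite /k0 ltNge => /negbTE ->.
have mZ1 : measurable_fun setT (\1_Z : vec3 R -> R) by exact: measurable_indic.
pose F u : \bar R := (\1_Z (T u))%:E.
have mF : measurable_fun setT F by rewrite /F; mfun.
have F0 v : (0 <= F v)%E by rewrite lee_fin.
have g0 : 0 <= (0 : R) <= 2 by rewrite lexx/= ler0n.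
have := star g0 mk0 k00 k0s mF F0.
pose X u := sphint (fun s => half_angle k0 (vdot u s / vnorm u)).
have mX : measurable_fun setT X.
  apply: (mfun_sphint (F := fun u s => half_angle k0 (vdot u s / vnorm u))).
    by apply: mfun_comp; [exact: mfun_half_angle|mfun].
  by move=> u s; exact: half_angle_ge0.
have X0 u : (0 <= X u)%E by apply: sphint_ge0 => s; exact: half_angle_ge0.
pose P u := ((vnorm (T' u) `^ 0)%:E * X (T' u))%E.
have mP : measurable_fun setT P.
  by apply: mfun_mule; [mfun|exact: mfun_comp].
have -> : (\int[leb3 R]_u ((vnorm u `^ 0)%:E * (F u * X u)) =
    \int[leb3 R]_u (P (T u) * (\1_Z (T u))%:E))%E.
  by apply: eq_integral => u _; rewrite /P T'K /F -muleA; congr (_ * _)%E; rewrite muleC.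
rewrite (iT (fun x => P x * (\1_Z x)%:E)%E); last 2 first.
- by apply: mfun_mule => //; mfun.
- by move=> x; rewrite /P mule_ge0// mule_ge0// lee_fin powR_ge0.
rewrite integral_null// mule0 => h.
have -> : (\int[leb3 R]_w sphint (fun s => k0 (vdot w s / vnorm w) * (\1_Z (T (smid w s)))%:E) =
    \int[leb3 R]_w sphint (fun s => (vnorm w `^ 0)%:E *
      (k0 (vdot w s / vnorm w)%R * F (smid w s))))%E.
  by apply: eq_integral => w _; apply: eq_sphint => s _; rewrite powRr0 mul1e.
apply/le_anti/andP; split; first exact: h.
apply: integral_ge0 => w _; apply: sphint_ge0 => s.
by rewrite mule_ge0 ?lee_fin ?powR_ge0// mule_ge0.
Qed.

Let mI v (P : vec3 R -> vec3 R -> vec3 R) : measurable_fun setT (fun p => P p.1 p.2) ->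
  measurable_fun setT (fun p => (`|costheta v p.1 p.2| <= 2^-1)%R%:R%:E * (\1_Z (P p.1 p.2))%:E : \bar R)%E.
Proof.
move=> mP; have mZ1 : measurable_fun setT (\1_Z : vec3 R -> R) by exact: measurable_indic.
have mc := mfun_costheta v.
by apply: mfun_mule; [mfun|apply: mfunEFin; apply: mfun_comp].
Qed.

Lemma vpost_s_null v : (\int[leb3 R]_vs sphint (fun s =>
  (`|costheta v vs s| <= 2^-1)%R%:R%:E * (\1_Z (vpost_s v vs s))%:E) = 0)%E.
Proof.
have mZ1 : measurable_fun setT (\1_Z : vec3 R -> R) by exact: measurable_indic.
have mT : measurable_fun setT (vsub v) by mfun.
have h := post_null mT (fun F mF F0 => leb3_reflect v mF F0).
have mG : measurable_fun setT (fun w => sphint (fun s =>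
    k0 (vdot w s / vnorm w) * (\1_Z (vsub v (smid w s)))%:E))%E.
  apply: (mfun_sphint (F := fun w s => k0 (vdot w s / vnorm w) * (\1_Z (vsub v (smid w s)))%:E)%E); last first.
    by move=> w s; rewrite mule_ge0// lee_fin.
  apply: mfun_mule; first by rewrite /k0; mfun.
  apply: mfunEFin; apply: (mfun_comp mZ1); apply: (mfun_comp mT).
  by apply: mfun_smid; mfun.
have G0 w : (0 <= sphint (fun s =>
    k0 (vdot w s / vnorm w) * (\1_Z (vsub v (smid w s)))%:E))%E.
  by apply: sphint_ge0 => s; rewrite mule_ge0// lee_fin.
apply/eqP; rewrite eq_le; apply/andP; split; last first.
  by apply: integral_ge0 => w _; apply: sphint_ge0 => s; rewrite mule_ge0// lee_fin.
have TK : (forall u, vsub v (vsub v u) = u) \/ exists2 T' : vec3 R -> vec3 R,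
    measurable_fun setT T' & forall u, T' (vsub v u) = u.
  by left=> u; rewrite /vsub /vmk /vx /vy /vz /=; case: u => -[a b] c /=; congr (_, _, _); ring.
apply: le_trans (eq_leW (etrans (leb3_reflect v mG G0) (h TK))).
have mc : measurable_fun setT (fun p => (`|costheta v p.1 p.2| <= 2^-1)%R%:R%:E * (\1_Z (vpost_s v p.1 p.2))%:E : \bar R)%E.
  exact: (mI v (P := vpost_s v) (mfun_vpost_s v)).
apply: ge0_le_integral; first exact: measurableT.
- by move=> w _; apply: sphint_ge0 => s; rewrite mule_ge0// lee_fin.
- apply: (mfun_sphint (F := fun vs s => (`|costheta v vs s| <= 2^-1)%R%:R%:E * (\1_Z (vpost_s v vs s))%:E)%E mc) => w s.
  by rewrite mule_ge0// lee_fin.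
- by apply: (mfun_comp mG).
move=> vs _; apply: le_sphint.
- exact: (mfun_sect1 (F := fun vs s => (`|costheta v vs s| <= 2^-1)%R%:R%:E * (\1_Z (vpost_s v vs s))%:E)%E mc).
- apply: mfun_mule; first by rewrite /k0; mfun.
  apply: mfunEFin; apply: (mfun_comp mZ1); apply: (mfun_comp mT).
  by apply: mfun_smid; mfun.
- by move=> s; rewrite mule_ge0// lee_fin.
- by move=> s; rewrite mule_ge0// lee_fin.
move=> s _; rewrite vpost_sE costhetaE; apply: lee_wpmul2r => //.
rewrite /k0 lee_fin ler_nat.
by case: (leP `|_| _) => //; rewrite ler_norml => /andP[-> _].
Qed.

Lemma vpost_null v : (\int[leb3 R]_vs sphint (fun s =>
  (`|costheta v vs s| <= 2^-1)%R%:R%:E * (\1_Z (vpost v vs s))%:E) = 0)%E.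
Proof.
have mZ1 : measurable_fun setT (\1_Z : vec3 R -> R) by exact: measurable_indic.
have mT : measurable_fun setT (vadd v) by mfun.
have vaddC (a b : vec3 R) : vadd a b = vadd b a.
  by rewrite /vadd /vmk; congr (_, _, _); rewrite addrC.
have iT F (mF : measurable_fun setT F) (F0 : forall u : vec3 R, (0 <= F u)%E) :
    (\int[leb3 R]_u F (vadd v u) = \int[leb3 R]_u F u)%E.
  by rewrite -(leb3_shift mF F0 v); apply: eq_integral => u _; rewrite vaddC.
have h := post_null mT iT.
have mG : measurable_fun setT (fun w => sphint (fun s =>
    k0 (vdot w s / vnorm w) * (\1_Z (vadd v (smid w s)))%:E))%E.
  apply: (mfun_sphint (F := fun w s => k0 (vdot w s / vnorm w) * (\1_Z (vadd v (smid w s)))%:E)%E); last first.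
    by move=> w s; rewrite mule_ge0// lee_fin.
  apply: mfun_mule; first by rewrite /k0; mfun.
  apply: mfunEFin; apply: (mfun_comp mZ1); apply: (mfun_comp mT).
  by apply: mfun_smid; mfun.
have G0 w : (0 <= sphint (fun s =>
    k0 (vdot w s / vnorm w) * (\1_Z (vadd v (smid w s)))%:E))%E.
  by apply: sphint_ge0 => s; rewrite mule_ge0// lee_fin.
apply/eqP; rewrite eq_le; apply/andP; split; last first.
  by apply: integral_ge0 => w _; apply: sphint_ge0 => s; rewrite mule_ge0// lee_fin.
have TK : (forall u, vadd v (vadd v u) = u) \/ exists2 T' : vec3 R -> vec3 R,
    measurable_fun setT T' & forall u, T' (vadd v u) = u.
  right; exists (vadd (vscale (-1) v)); first by mfun.
  by move=> u; rewrite /vadd /vscale /vmk /vx /vy /vz /=; case: u => -[a b] c /=; congr (_, _, _); ring.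
apply: le_trans (eq_leW (etrans (leb3_shift mG G0 (vscale (-1) v)) (h TK))).
have mc : measurable_fun setT (fun p => (`|costheta v p.1 p.2| <= 2^-1)%R%:R%:E * (\1_Z (vpost v p.1 p.2))%:E : \bar R)%E.
  exact: (mI v (P := vpost v) (mfun_vpost v)).
apply: ge0_le_integral; first exact: measurableT.
- by move=> w _; apply: sphint_ge0 => s; rewrite mule_ge0// lee_fin.
- apply: (mfun_sphint (F := fun vs s => (`|costheta v vs s| <= 2^-1)%R%:R%:E * (\1_Z (vpost v vs s))%:E)%E mc) => w s.
  by rewrite mule_ge0// lee_fin.
- by apply: (mfun_comp mG); mfun.
have e vs : vadd vs (vscale (-1) v) = vsub vs v.
  by rewrite /vadd /vsub /vscale /vmk /vx /vy /vz /=; congr (_, _, _); ring.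
move=> vs _; rewrite e; apply: le_sphint.
- exact: (mfun_sect1 (F := fun vs s => (`|costheta v vs s| <= 2^-1)%R%:R%:E * (\1_Z (vpost v vs s))%:E)%E mc).
- apply: mfun_mule; first by rewrite /k0; mfun.
  apply: mfunEFin; apply: (mfun_comp mZ1); apply: (mfun_comp mT).
  by apply: mfun_smid; mfun.
- by move=> s; rewrite mule_ge0// lee_fin.
- by move=> s; rewrite mule_ge0// lee_fin.
move=> s _; rewrite vpostE costheta_opp; apply: lee_wpmul2r => //.
rewrite /k0 lee_fin ler_nat lerN2.
by case: (leP `|_| _) => //; rewrite ler_norml => /andP[_ ->].
Qed.

End null_sets.

Section kernel.
Variables (g : R) (b : R -> R) (CB : R).
Hypotheses (g02 : 0 <= g <= 2) (mb : measurable_fun setT b) (b0 : forall x, 0 <= b x).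
Hypothesis b_even : forall x, b (- x) = b x.
Hypothesis bCB : ((2 * pi)%:E * \int[leb1 R]_(th in @itv0pi R) ((sin th)%:E * (b (cos th))%:E) = CB%:E)%E.

Let CB0 : 0 <= CB.
Proof.
rewrite -lee_fin -bCB; apply: mule_ge0; first by rewrite lee_fin mulr_ge0// ltW// pi_gt0.
apply: integral_ge0 => th; rewrite /itv0pi/= in_itv/= => th0.
by apply: mule_ge0; rewrite lee_fin// sin_ge0_pi.
Qed.

(** Half of the kernel, on which the map from w to w' is nonsingular; the other half is reached by
    evaluating at - cos theta and using the map to v'. *)
Let kp (x : R) : \bar R := ((0 <= x)%R%:R * b x)%:E.

Let mkp : measurable_fun setT kp.
Proof. by rewrite /kp; mfun. Qed.

Let kp0 x : (0 <= kp x)%E.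
Proof. by rewrite lee_fin mulr_ge0. Qed.

Let star_kernel (F : vec3 R -> \bar R) : measurable_fun setT F -> (forall v, (0 <= F v)%E) ->
  (\int[leb3 R]_w sphint (fun s => (vnorm w `^ g)%:E *
      (kp (vdot w s / vnorm w)%R * F (smid w s))) <=
   (32 * CB)%:E * \int[leb3 R]_u ((vnorm u `^ g)%:E * F u))%E.
Proof.
move=> mF F0.
have kps x : x < - 2^-1 -> kp x = 0%E.
  by move=> x0; rewrite /kp (_ : (0 <= x) = false) ?mul0r//; apply/negbTE; rewrite -ltNge; lra.
apply: (le_trans (star g02 mkp kp0 kps mF F0)).
have e1 : 32 * CB = 64 * (2^-1 * CB) by field.
have mu1 : measurable_fun setT (fun u => (vnorm u `^ g)%:E * F u)%E by mfun.
have pu1 u : (0 <= (vnorm u `^ g)%:E * F u)%E by rewrite mule_ge0// lee_fin powR_ge0.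
have c2 : 0 <= 2^-1 * CB by rewrite mulr_ge0.
rewrite e1 EFinM -muleA; apply: lee_wpmul2l => //.
rewrite -(integral_mull (leb3 R) c2 mu1 pu1).
have mX : measurable_fun setT (fun u => sphint (fun s => half_angle kp (vdot u s / vnorm u))).
  apply: (mfun_sphint (F := fun u s => half_angle kp (vdot u s / vnorm u))).
    by apply: mfun_comp; [exact: mfun_half_angle|mfun].
  by move=> u s; exact: half_angle_ge0.
have X0 u : (0 <= sphint (fun s => half_angle kp (vdot u s / vnorm u)))%E.
  by apply: sphint_ge0 => s; exact: half_angle_ge0.
apply: ge0_le_integral => //.
- by move=> u _; rewrite mule_ge0 ?lee_fin ?powR_ge0// mule_ge0.
- by apply: mfun_mule; [mfun|apply: mfun_mule].
- by apply: mfun_mule; mfun.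
move=> u _; rewrite muleA [leRHS]muleC; apply: lee_wpmul2l => //.
apply: (le_trans (sphint_half_angle mkp kp0 u)).
rewrite [(2^-1 * CB)%:E]EFinM; apply: lee_wpmul2l; first by rewrite lee_fin invr_ge0.
rewrite -bCB; apply: lee_wpmul2l; first by rewrite lee_fin mulr_ge0// ltW// pi_gt0.
have itvE : @itv0pi R = [set th | 0 <= th <= pi] by rewrite /itv0pi set_itvcc.
apply: ge0_le_integral.
- by rewrite /itv0pi; exact: measurable_itv.
- by move=> th; rewrite itvE /= => /sin_ge0_pi ?; rewrite mule_ge0.
- by apply: measurable_funTS; mfun.
- by apply: measurable_funTS; mfun.
move=> th; rewrite itvE /= => /sin_ge0_pi s0; apply: lee_wpmul2l => //.
by rewrite lee_fin; case: (0 <= cos th); rewrite ?mul1r ?mul0r.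
Qed.

Lemma kern_ge0 v vs s : 0 <= kernB g b v vs s.
Proof. by rewrite mulr_ge0// powR_ge0. Qed.

Variables (h : vec3 R -> R) (E : R).
Hypotheses (mh : measurable_fun setT h) (h01 : forall v, 0 <= h v <= 1).
Hypothesis hE : norm12 h = E%:E.

Let h0 v : 0 <= h v. Proof. by case/andP: (h01 v). Qed.

Lemma gain_bound v : (\int[leb3 R]_vs sphint (fun s =>
    (kernB g b v vs s * (h (vpost v vs s) * h (vpost_s v vs s)))%:E) <=
  (128 * CB * (1 + vnorm v ^+ 2) * E)%:E)%E.
Proof.
have mI : measurable_fun setT (fun w => (vnorm (vsub v w) `^ g * h w)%:E) by mfun.
have I0 w : (0 <= (vnorm (vsub v w) `^ g * h w)%:E)%E by rewrite lee_fin mulr_ge0// powR_ge0.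
have c32 : (0 <= (32 * CB)%:E)%E by rewrite lee_fin mulr_ge0.
pose F1 u : \bar R := (h (vsub v u))%:E.
pose F2 u : \bar R := (h (vadd v u))%:E.
have mF1 : measurable_fun setT F1 by rewrite /F1; mfun.
have mF2 : measurable_fun setT F2 by rewrite /F2; mfun.
have F10 u : (0 <= F1 u)%E by rewrite lee_fin.
have F20 u : (0 <= F2 u)%E by rewrite lee_fin.
pose H (F : vec3 R -> \bar R) w s := ((vnorm w `^ g)%:E * (kp (vdot w s / vnorm w)%R * F (smid w s)))%E.
have H0 F : (forall u, (0 <= F u)%E) -> forall w s, (0 <= H F w s)%E.
  by move=> F0 w s; rewrite mule_ge0 ?lee_fin ?powR_ge0// mule_ge0.
have mH F : measurable_fun setT F -> measurable_fun setT (fun p => H F p.1 p.2).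
  move=> mF; apply: mfun_mule; first by mfun.
  apply: mfun_mule; first by mfun.
  by apply: (mfun_comp mF); apply: mfun_smid; mfun.
pose G F w := sphint (H F w).
have G0 F : (forall u, (0 <= F u)%E) -> forall w, (0 <= G F w)%E.
  by move=> F0 w; apply: sphint_ge0; exact: H0.
have mG F : measurable_fun setT F -> (forall u, (0 <= F u)%E) -> measurable_fun setT (G F).
  by move=> mF F0; apply: (mfun_sphint (F := H F)); [exact: mH|exact: H0].
have ms1 : measurable_fun setT (fun vs => vsub v vs) by mfun.
have ms2 : measurable_fun setT (fun vs => vsub vs v) by mfun.
apply: (@le_trans _ _ (\int[leb3 R]_vs (G F1 (vsub v vs) + G F2 (vsub vs v)))%E).
  apply: ge0_le_integral => //.
  - by move=> vs _; apply: sphint_ge0 => s; rewrite lee_fin; apply: mulr_ge0; [exact: kern_ge0|exact: mulr_ge0].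
  - apply: (mfun_sphint (F := fun vs s => (kernB g b v vs s * (h (vpost v vs s) * h (vpost_s v vs s)))%:E)).
      have mp := mfun_vpost v; have mq := mfun_vpost_s v; have mc := mfun_costheta v.
      by rewrite /kernB; mfun.
    by move=> vs s; rewrite lee_fin; apply: mulr_ge0; [exact: kern_ge0|exact: mulr_ge0].
  - apply: mfun_adde; first exact: (mfun_comp (mG _ mF1 F10) ms1).
    exact: (mfun_comp (mG _ mF2 F20) ms2).
  move=> vs _.
  rewrite /G -(sphintD (mfun_sect1 (mH _ mF1) _) (mfun_sect1 (mH _ mF2) _) (H0 _ F10 _) (H0 _ F20 _)).
  apply: le_sphint.
  - by rewrite /kernB /costheta /vpost /vpost_s; mfun.
  - apply: mfun_adde; first exact: (mfun_sect1 (mH _ mF1) _).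
    exact: (mfun_sect1 (mH _ mF2) _).
  - by move=> s; rewrite lee_fin; apply: mulr_ge0; [exact: kern_ge0|exact: mulr_ge0].
  - by move=> s; rewrite adde_ge0// H0.
  move=> s _; rewrite /H /kp /F1 /F2 -vpost_sE -vpostE -(costhetaE v vs) (costheta_opp v vs) b_even.
  rewrite (vnorm_subC vs v) -!EFinM -EFinD lee_fin /kernB oppr_ge0.
  have /andP[p0 p1] := h01 (vpost v vs s); have /andP[q0 q1] := h01 (vpost_s v vs s).
  have n0 := powR_ge0 (vnorm (vsub v vs)) g; have bb := b0 (costheta v vs s).
  rewrite -mulrDr -mulrA; apply: ler_wpM2l => //.
  rewrite -!mulrA; case: (leP 0 (costheta v vs s)) => c0.
    rewrite mul1r; apply: (@le_trans _ _ (b (costheta v vs s) * h (vpost_s v vs s))).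
      by apply: ler_wpM2l => //; rewrite ler_piMl.
    by rewrite lerDl !mulr_ge0.
  rewrite mul0r add0r (ltW c0) mul1r; apply: ler_wpM2l => //; by rewrite ler_piMr.
have m1 := mfun_comp (mG _ mF1 F10) ms1; have m2 := mfun_comp (mG _ mF2 F20) ms2.
rewrite (@ge0_integralD _ _ R (leb3 R) setT measurableT _ _ (fun vs _ => G0 _ F10 (vsub v vs)) m1
  (fun vs _ => G0 _ F20 (vsub vs v)) m2).
have a1 := leb3_reflect v (mG _ mF1 F10) (G0 _ F10).
have a2 : (\int[leb3 R]_vs G F2 (vsub vs v) = \int[leb3 R]_w G F2 w)%E.
  apply: etrans (leb3_shift (mG _ mF2 F20) (G0 _ F20) (vscale (-1) v)).
  apply: eq_integral => w _; congr (G F2 _).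
  by rewrite /vadd /vsub /vscale /vmk /vx /vy /vz /=; congr (_, _, _); ring.
have b1 := le_trans (eq_leW a1) (star_kernel mF1 F10).
have b2 := le_trans (eq_leW a2) (star_kernel mF2 F20).
apply: (le_trans (leeD b1 b2)).
have e1 : (\int[leb3 R]_u ((vnorm u `^ g)%:E * F1 u) =
    \int[leb3 R]_w (vnorm (vsub v w) `^ g * h w)%:E)%E.
  apply: (etrans _ (leb3_reflect v mI I0)); apply: eq_integral => u _; rewrite /F1 -EFinM.
  congr (vnorm _ `^ g * _)%:E; case: u => -[x y] z.
  by rewrite /vsub /vmk /vx /vy /vz /=; congr (_, _, _); ring.
have e2 : (\int[leb3 R]_u ((vnorm u `^ g)%:E * F2 u) =
    \int[leb3 R]_w (vnorm (vsub v w) `^ g * h w)%:E)%E.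
  apply: (etrans _ (leb3_shift mI I0 v)); apply: eq_integral => u _; rewrite /F2 -EFinM.
  rewrite (vnorm_subC v); congr (vnorm _ `^ g * h _)%:E; case: u => -[x y] z.
    by rewrite /vsub /vadd /vmk /vx /vy /vz /=; congr (_, _, _); ring.
  by rewrite /vsub /vadd /vmk /vx /vy /vz /=; congr (_, _, _); ring.
have M1 := le_trans (eq_leW e1) (moment_bound g02 mh h0 hE v).
have M2 := le_trans (eq_leW e2) (moment_bound g02 mh h0 hE v).
apply: (le_trans (leeD (lee_wpmul2l c32 M1) (lee_wpmul2l c32 M2))).
by rewrite -!EFinM -EFinD lee_fin; apply: eq_leW; ring.
Qed.

(** The velocity w does not depend on sigma, so the kernel is integrated over the sphere first and
    yields CB |v - w|^g. The resulting constant 2 CB is weakened to that of [gain_bound], so that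
    one bound serves both operators. *)
Lemma loss_bound v : (\int[leb3 R]_vs sphint (fun s => (kernB g b v vs s * h vs)%:E) <=
  (128 * CB * (1 + vnorm v ^+ 2) * E)%:E)%E.
Proof.
have mE : measurable_fun setT (fun p => (kernB g b v p.1 p.2 * h p.1)%:E).
  by have mc := mfun_costheta v; rewrite /kernB; mfun.
have E0 vs s : (0 <= (kernB g b v vs s * h vs)%:E)%E.
  by rewrite lee_fin; apply: mulr_ge0; first exact: kern_ge0.
have mS : measurable_fun setT (fun vs => sphint (fun s => (kernB g b v vs s * h vs)%:E)).
  exact: (mfun_sphint (F := fun vs s => (kernB g b v vs s * h vs)%:E) mE E0).
have S0 vs : (0 <= sphint (fun s => (kernB g b v vs s * h vs)%:E))%E by apply: sphint_ge0.
apply: (le_trans (eq_leW (leb3_except (vx v) mS S0))).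
have mI : measurable_fun setT (fun w => (vnorm (vsub v w) `^ g * h w)%:E) by mfun.
have I0 w : (0 <= (vnorm (vsub v w) `^ g * h w)%:E)%E by rewrite lee_fin mulr_ge0// powR_ge0.
apply: (@le_trans _ _ (CB%:E * \int[leb3 R]_w (vnorm (vsub v w) `^ g * h w)%:E)%E); last first.
  have M := moment_bound g02 mh h0 hE v.
  have c0 : (0 <= CB%:E)%E by rewrite lee_fin.
  apply: (le_trans (lee_wpmul2l c0 M)); rewrite -EFinM lee_fin.
  have Ege : 0 <= E.
    by rewrite -lee_fin -hE; apply: integral_ge0 => w _; rewrite lee_fin mulr_ge0// addr_ge0// sqr_ge0.
  have : 0 <= CB * (1 + vnorm v ^+ 2) * E by rewrite !mulr_ge0// addr_ge0// sqr_ge0.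
  nra.
apply: (le_trans _ (eq_leW (integral_mull (leb3 R) CB0 mI I0))).
have mn : measurable_fun setT (fun x : vec3 R => vx x != vx v).
  apply: (mfun_comp (h := negb) (a := fun x : vec3 R => vx x == vx v)) => //.
  by apply: measurable_fun_eqr; mfun.
apply: ge0_le_integral => //.
- by move=> w _; rewrite mule_ge0.
- by apply: mfun_mule => //; apply: mfunEFin; apply: mfun_bool.
- by apply: mfun_mule => //; mfun.
move=> w _; have [_|wv] := eqVneq (vx w) (vx v); first by rewrite mul0e mule_ge0// lee_fin.
rewrite mul1e.
have n0 : vnorm (vsub v w) != 0.
  rewrite -sqrf_eq0 vnorm_sqr /vsub /vmk /vx /vy /vz /= gt_eqF// -addrA ltr_wpDr//.
    by rewrite addr_ge0// sqr_ge0.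
  by rewrite lt0r sqr_ge0 sqrf_eq0 subr_eq0 eq_sym wv.
have mb' : measurable_fun setT (fun x : R => (b x)%:E) by mfun.
have b0' x : (0 <= (b x)%:E)%E by rewrite lee_fin.
have Z := sphint_zonal mb' b0' (vdot_normalize n0).
have c0 : 0 <= vnorm (vsub v w) `^ g * h w by rewrite mulr_ge0// powR_ge0.
have ms : measurable_fun setT (fun s => (b (vdot (vscale (vnorm (vsub v w))^-1 (vsub v w)) s))%:E).
  by mfun.
have := sphint_mull c0 ms (fun s => b0' _); rewrite Z bCB muleC => <-.
rewrite le_eqVlt; apply/orP; left; apply/eqP; apply: eq_sphint => s _.
by rewrite -EFinM /kernB /costheta mulrAC.
Qed.

End kernel.

End kernel_bounds.
(** * Lower bound for the gain term *)

Section gain_lower_bound.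
Context (R : realType).

Lemma sin_le_id (x : R) : 0 <= x -> sin x <= x.
Proof.
move=> x0; have [|c _] := @MVT_segment R (@sin R) (@cos R) 0 x x0.
  by apply: continuous_subspaceT; exact: continuous_sin.
by rewrite sin0 !subr0 => ->; rewrite ler_piMl// cos_le1.
Qed.

(** In the polar angle around e the band contains pi/2 <= th <= pi/2 + eta, where sin th >= 1/2
    because eta <= 1/4. Its area is thus at least 2 pi times eta / 2. *)
Lemma sphint_cap (e : vec3 R) (eta : R) : vdot e e = 1 -> 0 < eta <= 4^-1 ->
  ((pi * eta)%:E <= sphint (fun s => (`|vdot e s| <= eta)%R%:R%:E))%E.
Proof.
move=> e1 /andP[eta0 eta4].
have pi2 := pi_ge2 R.
pose k (x : R) : \bar R := ((`|x| <= eta)%R%:R)%:E.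
have mk : measurable_fun setT k by rewrite /k; mfun.
have k0 x : (0 <= k x)%E by rewrite lee_fin.
rewrite -[leRHS]/(sphint (fun s => k (vdot e s))) (sphint_zonal mk k0 e1).
have -> : pi * eta = 2 * pi * (2^-1 * eta) by field.
rewrite [leLHS]EFinM; apply: lee_wpmul2l; first by rewrite lee_fin mulr_ge0// ltW// pi_gt0.
pose J : set R := `[pi / 2, pi / 2 + eta]%classic.
have sub : J `<=` @itv0pi R.
  rewrite /J /itv0pi => t /=; rewrite !in_itv/= => /andP[t1 t2].
  by apply/andP; split; lra.
have mitv : measurable (J) by exact: measurable_itv.
have mf : measurable_fun setT (fun th => (sin th)%:E * k (cos th))%E by mfun.
have s0 th : @itv0pi R th -> (0 <= (sin th)%:E * k (cos th))%E.
  by rewrite /itv0pi /= in_itv/= => /sin_ge0_pi ?; rewrite mule_ge0.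
apply: (@le_trans _ _ (\int[leb1 R]_(th in J) ((sin th)%:E * k (cos th)))%E); last first.
  apply: ge0_subset_integral => //; last exact: measurable_funTS.
  by rewrite /itv0pi; exact: measurable_itv.
apply: (@le_trans _ _ (\int[leb1 R]_(th in J) (2^-1)%:E)%E).
  rewrite integral_cst// EFinM; apply: lee_wpmul2l; first by rewrite lee_fin invr_ge0.
  apply: eq_leW; apply/esym; etransitivity; first exact: lebesgue_measure_itv.
  by rewrite /= lte_fin ltrDl eta0 -EFinD addrAC subrr add0r.
apply: ge0_le_integral; first exact: mitv.
- by move=> th _; rewrite lee_fin invr_ge0.
- exact: measurable_cst.
- exact: measurable_funTS.
move=> th; rewrite /J /= in_itv/= => /andP[t1 t2].
pose x := th - pi / 2; have x0 : 0 <= x by rewrite subr_ge0.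
have thE : th = x + pi / 2 by rewrite subrK.
have xe : x <= eta by rewrite /x; lra.
have sx := sin_le_id x0.
have sx0 : 0 <= sin x by apply: sin_ge0_pi; apply/andP; split => //; rewrite /x; lra.
have cx0 : 0 <= cos x by apply: cos_ge0_pihalf; apply/andP; split; rewrite /x; lra.
have cx : 2^-1 <= cos x by have := cos2Dsin2 x; nra.
rewrite thE /k sinDpihalf cosDpihalf normrN ger0_norm// (le_trans sx xe) mule1.
by rewrite lee_fin.
Qed.

Lemma vdot_cauchy (a b : vec3 R) : `|vdot a b| <= vnorm a * vnorm b.
Proof.
rewrite -[leRHS]ger0_norm ?mulr_ge0 ?vnorm_ge0//.
rewrite -ler_sqr ?nnegrE// !real_normK ?num_real// exprMn !vnorm_sqr /vdot.
case: a => -[a1 a2] a3; case: b => -[b1 b2] b3; rewrite /vx /vy /vz /=.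
have := sqr_ge0 (a1 * b2 - a2 * b1); have := sqr_ge0 (a1 * b3 - a3 * b1).
have := sqr_ge0 (a2 * b3 - a3 * b2).
by rewrite -subr_ge0 => h1 h2 h3; lra.
Qed.

Lemma vnorm_unit (s : vec3 R) : vdot s s = 1 -> vnorm s = 1.
Proof. by move=> s1; rewrite /vnorm s1 sqrtr1. Qed.

(* With x = v - c and y = v_* - c, both post-collisional velocities have squared distance
   (|x|^2 + |y|^2) / 2 to the centre c, up to |x - y| (x + y).sigma / 2; so sigma nearly
   orthogonal to x + y brings v', v'_* into a ball whose radius is smaller by a factor sqrt 2. *)
Lemma collision_geometry (delta N : R) (v vs s c : vec3 R) : 0 < delta -> 1 <= N ->
  vdot s s = 1 -> delta <= vnorm (vsub v c) ->
  vnorm (vsub v c) ^+ 2 <= delta ^+ 2 * (2 * N + 1) / 2 ->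
  vnorm (vsub vs c) ^+ 2 <= 3 * delta ^+ 2 / 400 ->
  `|vdot (vadd (vsub v c) (vsub vs c)) s| <= (4 * N)^-1 * vnorm (vadd (vsub v c) (vsub vs c)) ->
  [/\ delta / 2 <= vnorm (vsub v vs), `|costheta v vs s| <= 2^-1,
      vnorm (vsub (vpost v vs s) c) ^+ 2 <= delta ^+ 2 * (N + 1) / 2 &
      vnorm (vsub (vpost_s v vs s) c) ^+ 2 <= delta ^+ 2 * (N + 1) / 2].
Proof.
move=> d0 N1 s1 dX X2 Y2 cap.
set x := vsub v c in dX X2 cap *; set y := vsub vs c in Y2 cap *.
pose X := vnorm x; pose Y := vnorm y; pose W := vnorm (vsub v vs); pose P := vnorm (vadd x y).
have X0 : 0 <= X by exact: vnorm_ge0.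
have Y0 : 0 <= Y by exact: vnorm_ge0.
have W0 : 0 <= W by exact: vnorm_ge0.
have P0 : 0 <= P by exact: vnorm_ge0.
pose d := vdot x y.
have /ler_normlP[d1 d2] : `|d| <= X * Y by exact: vdot_cauchy.
have W2 : W ^+ 2 = X ^+ 2 + Y ^+ 2 - 2 * d.
  by rewrite /W /X /Y !vnorm_sqr /d /vdot /x /y /vsub /vmk /vx /vy /vz /=; ring.
have P2 : P ^+ 2 = X ^+ 2 + Y ^+ 2 + 2 * d.
  by rewrite /P /X /Y !vnorm_sqr /d /vdot /vadd /vmk /vx /vy /vz /=; ring.
have PXY : P <= X + Y.
  by rewrite -ler_sqr ?nnegrE ?addr_ge0// P2 sqrrD; lra.
(* The constant 11 is exactly what (X + Y) / 4 + 2 Y <= (X - Y) / 2 requires when X >= delta; that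
   inequality gives |cos theta| <= 1/2 below. *)
have Yd : 11 * Y <= delta.
  rewrite -ler_sqr ?nnegrE ?(ltW d0)//; last by rewrite mulr_ge0.
  by rewrite exprMn; move: Y2; rewrite -/Y; have := sqr_ge0 delta; lra.
have dX' : delta <= X by [].
have WXY : X - Y <= W.
  by rewrite -ler_sqr ?nnegrE ?subr_ge0//; [rewrite W2 sqrrB; lra|lra].
have Wd : delta / 2 <= W by lra.
have Wgt0 : 0 < W by lra.
pose q := vdot (vadd x y) s.
have N4 : (4 * N)^-1 <= 4^-1 by rewrite lef_pV2 ?posrE; lra.
have N40 : 0 < (4 * N)^-1 by rewrite invr_gt0; lra.
have /ler_normlP[q1 q2] : `|q| <= (4 * N)^-1 * P by exact: cap.
have hPW : (4 * N)^-1 * P <= 4^-1 * P by exact: ler_wpM2r.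
have /ler_normlP[ys1 ys2] : `|vdot y s| <= Y.
  by have := vdot_cauchy y s; rewrite (vnorm_unit s1) mulr1.
have NN : (4 * N)^-1 * N = 4^-1 by field; lra.
(* Here W P <= X ^ 2 + Y ^ 2 <= delta ^ 2 (N + 203/400), with 203/400 = 1/2 + 3/400. The left side
   is then at most delta ^ 2 / 2 times N + 203/400 + 1/4 + 203/1600, which is below N + 1. *)
have main : (X ^+ 2 + Y ^+ 2) / 2 + W * ((4 * N)^-1 * P) / 2 <= delta ^+ 2 * (N + 1) / 2.
  have WP : W * P <= X ^+ 2 + Y ^+ 2 by have := sqr_ge0 (W - P); nra.
  have -> : W * ((4 * N)^-1 * P) / 2 = (4 * N)^-1 * (W * P) / 2 by ring.
  have h1 : (4 * N)^-1 * (W * P) <= (4 * N)^-1 * (X ^+ 2 + Y ^+ 2) by rewrite ler_pM2l.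
  have h2 : X ^+ 2 + Y ^+ 2 <= delta ^+ 2 * (N + 203 / 400) by rewrite /X /Y; lra.
  have h3 : (4 * N)^-1 * (X ^+ 2 + Y ^+ 2) <= (4 * N)^-1 * (delta ^+ 2 * (N + 203 / 400)) by rewrite ler_pM2l.
  have h4 : (4 * N)^-1 * (delta ^+ 2 * (N + 203 / 400)) =
      delta ^+ 2 * (4^-1 + 203 / 400 * (4 * N)^-1).
    by rewrite -NN; ring.
  have h5 : delta ^+ 2 * (203 / 400 * (4 * N)^-1) <= delta ^+ 2 * (203 / 400 * 4^-1).
    by apply: ler_wpM2l; [exact: sqr_ge0|lra].
  by have := sqr_ge0 delta; lra.
have postE (w : R) : vnorm (vsub (vadd (vscale 2^-1 (vadd v vs)) (vscale (w / 2) s)) c) ^+ 2 =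
    (P ^+ 2 + w ^+ 2 * vdot s s) / 4 + w * q / 2.
  rewrite /P /q !vnorm_sqr /x /y.
  by rewrite /vdot /vadd /vsub /vscale /vmk /vx /vy /vz /=; field.
have post_sE (w : R) : vnorm (vsub (vsub (vscale 2^-1 (vadd v vs)) (vscale (w / 2) s)) c) ^+ 2 =
    (P ^+ 2 + w ^+ 2 * vdot s s) / 4 - w * q / 2.
  rewrite /P /q !vnorm_sqr /x /y.
  by rewrite /vdot /vadd /vsub /vscale /vmk /vx /vy /vz /=; field.
split=> //.
- rewrite costhetaE normrM normfV (ger0_norm W0) ler_pdivrMr// -/W.
  have -> : vdot (vsub v vs) s = q - 2 * vdot y s.
    by rewrite /q /vdot /x /y /vadd /vsub /vmk /vx /vy /vz /=; ring.
  by rewrite ler_norml; apply/andP; split; lra.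
- rewrite /vpost -/W postE s1 mulr1 P2 W2.
  have : W * q <= W * ((4 * N)^-1 * P) by rewrite ler_pM2l.
  lra.
- rewrite /vpost_s -/W post_sE s1 mulr1 P2 W2.
  have : W * - q <= W * ((4 * N)^-1 * P) by rewrite ler_pM2l.
  lra.
Qed.

(** A cube, since its volume is a product of interval lengths. Half-side delta / 20 places it in the
    ball of squared radius 3 delta ^ 2 / 400 required by [collision_geometry]. *)
Definition near_cube (c : vec3 R) (rho : R) (v : vec3 R) : bool :=
  [&& `|vx v - vx c| <= rho, `|vy v - vy c| <= rho & `|vz v - vz c| <= rho].

Lemma near_cube_norm c rho v : near_cube c rho v -> vnorm (vsub v c) ^+ 2 <= 3 * rho ^+ 2.
Proof.
move=> /and3P[h1 h2 h3]; rewrite vnorm_sqr /vsub /vmk /vx /vy /vz /=.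
have sq (a : R) : `|a| <= rho -> a ^+ 2 <= rho ^+ 2.
  move=> ar; rewrite -real_normK ?num_real// ler_sqr ?nnegrE//.
  exact: le_trans ar.
by have := sq _ h1; have := sq _ h2; have := sq _ h3; rewrite /vx /vy /vz; lra.
Qed.

Lemma mfun_near_cube c rho : measurable_fun setT (near_cube c rho).
Proof. by rewrite /near_cube; mfun. Qed.

Lemma leb1_interval (a rho : R) : 0 < rho ->
  (\int[leb1 R]_x ((`|x - a| <= rho)%R%:R)%:E = (2 * rho)%:E)%E.
Proof.
move=> r0.
transitivity (\int[leb1 R]_(x in [set x : R | (`|x - a| <= rho)%R]) 1)%E.
  by rewrite integral_setb; apply: eq_integral => x _; rewrite mule1.
have -> : [set x : R | (`|x - a| <= rho)%R] = `[a - rho, a + rho]%classic.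
  apply/seteqP; split => x /=; rewrite in_itv/= ler_norml => /andP[h1 h2].
    by apply/andP; split; lra.
  by apply/andP; split; lra.
rewrite integral_cst// mul1e; etransitivity; first exact: lebesgue_measure_itv.
rewrite /= lte_fin; case: ltP => h; last by exfalso; lra.
by rewrite -EFinD; congr EFin; ring.
Qed.

Lemma leb1_interval_mull (k a rho : R) : 0 < rho -> 0 <= k ->
  (\int[leb1 R]_x (k%:E * ((`|x - a| <= rho)%R%:R)%:E) = (k * (2 * rho))%:E)%E.
Proof.
move=> r0 k0.
have m1 : measurable_fun setT (fun x : R => ((`|x - a| <= rho)%R%:R)%:E : \bar R) by mfun.
have p1 (x : R) : (0 <= ((`|x - a| <= rho)%R%:R)%:E :> \bar R)%E by rewrite lee_fin.
apply: (etrans (integral_mull (leb1 R) k0 m1 p1)); rewrite EFinM; congr (_ * _)%E.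
exact: leb1_interval.
Qed.

Lemma near_cube_volume c rho : 0 < rho ->
  (\int[leb3 R]_v ((near_cube c rho v)%:R)%:E = ((2 * rho) ^+ 3)%:E)%E.
Proof.
move=> r0.
have mN : measurable_fun setT (fun v => ((near_cube c rho v)%:R)%:E : \bar R).
  by apply: mfunEFin; apply: mfun_bool; exact: mfun_near_cube.
have N0 v : (0 <= ((near_cube c rho v)%:R)%:E :> \bar R)%E by rewrite lee_fin.
apply: (etrans (integral_leb3 mN N0)).
have r2 : 0 <= 2 * rho by rewrite mulr_ge0// ltW.
transitivity (\int[leb1 R]_z ((2 * rho * (2 * rho))%:E * ((`|z - vz c| <= rho)%R%:R)%:E))%E.
  apply: eq_integral => z _.
  transitivity (\int[leb1 R]_x ((2 * rho * (`|z - vz c| <= rho)%R%:R)%:E * ((`|x - vx c| <= rho)%R%:R)%:E))%E.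
    apply: eq_integral => x _.
    transitivity (\int[leb1 R]_y (((`|x - vx c| <= rho)%R%:R * (`|z - vz c| <= rho)%R%:R)%:E *
        ((`|y - vy c| <= rho)%R%:R)%:E))%E.
      apply: eq_integral => y _; rewrite -EFinM; congr EFin.
      rewrite /near_cube /vmk /vx /vy /vz /=.
      by case: (_ <= _); case: (_ <= _); case: (_ <= _); rewrite /= ?(mulr0, mulr1, mul0r, mul1r).
    apply: (etrans (leb1_interval_mull _ r0 _)); first by rewrite mulr_ge0.
    by rewrite -EFinM; congr EFin; ring.
  apply: (etrans (leb1_interval_mull _ r0 _)); first by rewrite mulr_ge0.
  by rewrite -EFinM; congr EFin; ring.
apply: (etrans (leb1_interval_mull _ r0 _)); first by rewrite mulr_ge0.
by congr EFin; ring.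
Qed.

(** The bound is uniform in g: the power is at least 1 if a >= 1, and at least a ^ 2 otherwise. *)
Lemma powR_ge_min (g delta a : R) : 0 <= g <= 2 -> 0 < delta -> delta / 2 <= a ->
  Num.min 1 (delta ^+ 2 / 4) <= a `^ g.
Proof.
move=> /andP[g0 g2] d0 da; have a0 : 0 < a by lra.
have [a1|a1] := leP 1 a.
  by rewrite ge_min -[X in X <= _](powRr0 a) ler_powR.
rewrite ge_min; apply/orP; right.
apply: (@le_trans _ _ (a `^ 2)); last by apply: ger_powR => //; rewrite a0 ltW.
rewrite powR_mulrn; last exact: ltW.
by nra.
Qed.

End gain_lower_bound.
Section gain_lower.
Context (R : realType).

Lemma coll_add (F G : vec3 R -> vec3 R -> \bar R) :
  measurable_fun setT (fun p => F p.1 p.2) -> measurable_fun setT (fun p => G p.1 p.2) ->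
  (forall v s, (0 <= F v s)%E) -> (forall v s, (0 <= G v s)%E) ->
  (\int[leb3 R]_v sphint (fun s => F v s + G v s)%E =
   \int[leb3 R]_v sphint (F v) + \int[leb3 R]_v sphint (G v))%E.
Proof.
move=> mF mG F0 G0.
have p1 v : setT v -> (0 <= sphint (F v))%E by move=> _; exact: sphint_ge0.
have p2 v : setT v -> (0 <= sphint (G v))%E by move=> _; exact: sphint_ge0.
apply: etrans (@ge0_integralD _ _ R (leb3 R) setT measurableT _ _ p1 (mfun_sphint mF F0)
  p2 (mfun_sphint mG G0)).
apply: eq_integral => v _.
exact: (sphintD (mfun_sect1 mF v) (mfun_sect1 mG v) (F0 v) (G0 v)).
Qed.

Lemma coll_mull (k : R) (F : vec3 R -> vec3 R -> \bar R) : 0 <= k ->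
  measurable_fun setT (fun p => F p.1 p.2) -> (forall v s, (0 <= F v s)%E) ->
  (\int[leb3 R]_v sphint (fun s => k%:E * F v s)%E = k%:E * \int[leb3 R]_v sphint (F v))%E.
Proof.
move=> k0 mF F0.
have p1 v : (0 <= sphint (F v))%E by exact: sphint_ge0.
apply: etrans (integral_mull (leb3 R) k0 (mfun_sphint mF F0) p1).
by apply: eq_integral => v _; exact: (sphint_mull k0 (mfun_sect1 mF v) (F0 v)).
Qed.

Lemma le_coll (F G : vec3 R -> vec3 R -> \bar R) :
  measurable_fun setT (fun p => F p.1 p.2) -> measurable_fun setT (fun p => G p.1 p.2) ->
  (forall v s, (0 <= F v s)%E) -> (forall v s, (0 <= G v s)%E) ->
  (forall v s, vdot s s = 1 -> (F v s <= G v s)%E) ->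
  (\int[leb3 R]_v sphint (F v) <= \int[leb3 R]_v sphint (G v))%E.
Proof.
move=> mF mG F0 G0 FG.
apply: ge0_le_integral; first exact: measurableT.
- by move=> v _; exact: sphint_ge0.
- exact: mfun_sphint.
- exact: mfun_sphint.
move=> v _; apply: le_sphint; [exact: (mfun_sect1 mF)|exact: (mfun_sect1 mG)|exact: F0|exact: G0|].
by move=> s; exact: FG.
Qed.

Variables (g : R) (b : R -> R) (cb delta : R) (c : vec3 R).
Hypotheses (g02 : 0 <= g <= 2) (mb : measurable_fun setT b) (b0 : forall x, 0 <= b x).
Hypotheses (cb0 : 0 < cb) (bcb : forall x, `|x| <= 2^-1 -> cb <= b x) (d0 : 0 < delta).

(** The product of a lower bound for the kernel, the area pi / (4 N) of the band of admissible sigma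
    without its factor 1 / N, and the volume of a cube of side delta / 10. *)
Definition gain_const : R :=
  Num.min 1 (delta ^+ 2 / 4) * cb * (pi / 4) * (delta / 10) ^+ 3.

Lemma min_sqr_gt0 : 0 < Num.min 1 (delta ^+ 2 / 4).
Proof. by rewrite lt_min ltr01 divr_gt0// exprn_gt0. Qed.

Lemma gain_const_gt0 : 0 < gain_const.
Proof. by rewrite !mulr_gt0 ?min_sqr_gt0 ?invr_gt0 ?pi_gt0// ?exprn_gt0// divr_gt0. Qed.

Variables (Z : set (vec3 R)) (h : vec3 R -> R) (N a a0 : R).
Hypotheses (mZ : measurable Z) (Z0 : leb3 R Z = 0%E).
Hypotheses (mh : measurable_fun setT h) (h01 : forall v, 0 <= h v <= 1).
Hypotheses (N1 : 1 <= N) (ha : 0 <= a) (ha0 : 0 <= a0).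
Hypothesis h_ball : forall u, ~ Z u -> vnorm (vsub u c) ^+ 2 <= delta ^+ 2 * (N + 1) / 2 -> a <= h u.
Hypothesis h_core : forall u, ~ Z u -> vnorm (vsub u c) <= delta -> a0 <= 1 - h u.

(** For w in the cube and sigma in the band, the integrand is at least M by the pointwise bounds on
    h at v', w' and w. These bounds may fail if one of the three lies in Z. The comparison is
    therefore with the integrand plus M times the indicators [n1], [n2], [n3] of these events, and
    the added terms integrate to 0. *)
Lemma gain_lower v : delta <= vnorm (vsub v c) ->
  vnorm (vsub v c) ^+ 2 <= delta ^+ 2 * (2 * N + 1) / 2 ->
  ((gain_const * N^-1 * a ^+ 2 * a0)%:E <=
   \int[leb3 R]_vs sphint (fun s =>
     (kernB g b v vs s * (h (vpost v vs s) * h (vpost_s v vs s) * (1 - h vs)))%:E))%E.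
Proof.
move=> vd vN; have N1_ : 1 <= N := N1; have d0_ : 0 < delta := d0.
pose m := Num.min 1 (delta ^+ 2 / 4); have m0 : 0 < m by exact: min_sqr_gt0.
pose M : R := m * cb * (a * a * a0).
have M0 : 0 <= M by rewrite mulr_ge0 ?mulr_ge0// ltW.
pose eta := (4 * N)^-1.
have eta0 : 0 < eta by rewrite /eta invr_gt0; lra.
have eta4 : eta <= 4^-1 by rewrite /eta lef_pV2 ?posrE; lra.
pose e vs := vadd (vsub v c) (vsub vs c).
have me : measurable_fun setT e by rewrite /e; mfun.
have mN : measurable_fun setT (near_cube c (delta / 20)) by exact: mfun_near_cube.
pose L vs s : \bar R := (M%:E * ((near_cube c (delta / 20) vs)%:R * (`|vdot (e vs) s| <= eta * vnorm (e vs))%R%:R)%:E)%E.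
pose D vs s : \bar R := (kernB g b v vs s * (h (vpost v vs s) * h (vpost_s v vs s) * (1 - h vs)))%:E.
pose n1 vs s : \bar R := ((`|costheta v vs s| <= 2^-1)%R%:R%:E * (\1_Z (vpost v vs s))%:E)%E.
pose n2 vs s : \bar R := ((`|costheta v vs s| <= 2^-1)%R%:R%:E * (\1_Z (vpost_s v vs s))%:E)%E.
pose n3 vs (s : vec3 R) : \bar R := ((\1_Z vs : R)%:E * 1)%E.
have mZ1 : measurable_fun setT (\1_Z : vec3 R -> R) by exact: measurable_indic.
have mN1 : measurable_fun setT (fun p : vec3 R * vec3 R => near_cube c (delta / 20) p.1).
  by apply: (mfun_comp mN); mfun.
have mcap : measurable_fun setT (fun p : vec3 R * vec3 R =>
    `|vdot (e p.1) p.2| <= eta * vnorm (e p.1)) by rewrite /e; mfun.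
have mL : measurable_fun setT (fun p => L p.1 p.2).
  apply: mfun_mule; first exact: measurable_cst.
  exact: (mfunEFin (mfun_mulr (mfun_bool (R := R) mN1) (mfun_bool (R := R) mcap))).
have mp := mfun_vpost v; have mq := mfun_vpost_s v; have mc := mfun_costheta v.
have mD : measurable_fun setT (fun p => D p.1 p.2) by rewrite /D /kernB; mfun.
have mn1 : measurable_fun setT (fun p => n1 p.1 p.2).
  by apply: mfun_mule; [mfun|exact: mfunEFin (mfun_comp mZ1 mp)].
have mn2 : measurable_fun setT (fun p => n2 p.1 p.2).
  by apply: mfun_mule; [mfun|exact: mfunEFin (mfun_comp mZ1 mq)].
have mn3 : measurable_fun setT (fun p => n3 p.1 p.2) by rewrite /n3; mfun.
have L0 vs s : (0 <= L vs s)%E by rewrite mule_ge0 ?lee_fin// mulr_ge0.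
have k0 vs s : 0 <= kernB g b v vs s by rewrite mulr_ge0// powR_ge0.
have hh u : 0 <= h u by case/andP: (h01 u).
have hh1 u : 0 <= 1 - h u by rewrite subr_ge0; case/andP: (h01 u).
have D0 vs s : (0 <= D vs s)%E.
  by rewrite lee_fin; apply: mulr_ge0; [exact: k0|rewrite mulr_ge0// mulr_ge0].
have n10 vs s : (0 <= n1 vs s)%E by rewrite mule_ge0 ?lee_fin.
have n20 vs s : (0 <= n2 vs s)%E by rewrite mule_ge0 ?lee_fin.
have n30 vs s : (0 <= n3 vs s)%E by rewrite mule_ge0 ?lee_fin.
pose n vs s := (n1 vs s + (n2 vs s + n3 vs s))%E.
have mn23 : measurable_fun setT (fun p => n2 p.1 p.2 + n3 p.1 p.2)%E by exact: mfun_adde.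
have mn : measurable_fun setT (fun p => n p.1 p.2) by exact: mfun_adde.
have n230 vs s : (0 <= n2 vs s + n3 vs s)%E by exact: adde_ge0.
have n0 vs s : (0 <= n vs s)%E by exact: adde_ge0.
have i1 : (\int[leb3 R]_vs sphint (n1 vs) = 0)%E := vpost_null mZ Z0 v.
have i2 : (\int[leb3 R]_vs sphint (n2 vs) = 0)%E := vpost_s_null mZ Z0 v.
have i3 : (\int[leb3 R]_vs sphint (n3 vs) = 0)%E.
  transitivity (\int[leb3 R]_vs (sphint (fun=> 1%E) * (\1_Z vs)%:E))%E.
    apply: eq_integral => vs _; rewrite [RHS]muleC.
    by apply: (sphint_mull (F := fun=> 1%E)) => //; exact: measurable_cst.
  exact: (integral_null mZ Z0 (measurable_cst _)).
have add_eq (x y z t : \bar R) : x = z -> y = t -> (x + y = z + t)%E by move=> -> ->.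
have i23 : (\int[leb3 R]_vs sphint (fun s => n2 vs s + n3 vs s)%E = 0)%E.
  exact: (etrans (coll_add mn2 mn3 n20 n30) (etrans (add_eq _ _ _ _ i2 i3) (adde0 _))).
have In : (\int[leb3 R]_vs sphint (n vs) = 0)%E.
  exact: (etrans (coll_add mn1 mn23 n10 n230) (etrans (add_eq _ _ _ _ i1 i23) (adde0 _))).
have mMn : measurable_fun setT (fun p => M%:E * n p.1 p.2)%E by apply: mfun_mule => //; exact: measurable_cst.
have Mn0 vs s : (0 <= M%:E * n vs s)%E by rewrite mule_ge0 ?lee_fin.
have upper : (\int[leb3 R]_vs sphint (L vs) <= \int[leb3 R]_vs sphint (D vs))%E.
  apply: (@le_trans _ _ (\int[leb3 R]_vs sphint (fun s => D vs s + M%:E * n vs s)%E)%E); last first.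
    have zM := etrans (coll_mull M0 mn n0) (etrans (congr1 (mule M%:E) In) (mule0 _)).
    exact: (eq_leW (etrans (coll_add mD mMn D0 Mn0) (etrans (add_eq _ _ _ _ erefl zM) (adde0 _)))).
  apply: le_coll => //.
  - exact: mfun_adde.
  - by move=> vs s; rewrite adde_ge0.
  move=> vs s s1; rewrite /L.
  have [cube|_] := boolP (near_cube c (delta / 20) vs); last first.
    by rewrite mul0r mule0 adde_ge0.
  have [cap|_] := boolP (`|vdot (e vs) s| <= eta * vnorm (e vs)); last first.
    by rewrite mulr0 mule0 adde_ge0.
  rewrite mulr1 mule1.
  have y2 : vnorm (vsub vs c) ^+ 2 <= 3 * delta ^+ 2 / 400.
    by apply: le_trans (near_cube_norm cube) _; rewrite expr_div_n; lra.
  have [w1 w2 w3 w4] := collision_geometry d0 N1 s1 vd vN y2 cap.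
  have yd : vnorm (vsub vs c) <= delta.
    rewrite -ler_sqr ?nnegrE ?vnorm_ge0 ?(ltW d0)//.
    by have := sqr_ge0 delta; lra.
  have [z1|z1] := pselect (Z (vpost v vs s)).
    apply: (@le_trans _ _ (M%:E * n vs s)%E); last by rewrite leeDr.
    rewrite -[leLHS]mule1; apply: lee_wpmul2l; first by rewrite lee_fin.
    apply: (@le_trans _ _ (n1 vs s)); last by rewrite leeDl.
    by rewrite /n1 w2 indicE (mem_set z1) mule1.
  have [z2|z2] := pselect (Z (vpost_s v vs s)).
    apply: (@le_trans _ _ (M%:E * n vs s)%E); last by rewrite leeDr.
    rewrite -[leLHS]mule1; apply: lee_wpmul2l; first by rewrite lee_fin.
    apply: (@le_trans _ _ (n2 vs s + n3 vs s)%E); last by rewrite leeDr.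
    apply: (@le_trans _ _ (n2 vs s)); last by rewrite leeDl.
    by rewrite /n2 w2 indicE (mem_set z2) mule1.
  have [z3|z3] := pselect (Z vs).
    apply: (@le_trans _ _ (M%:E * n vs s)%E); last by rewrite leeDr.
    rewrite -[leLHS]mule1; apply: lee_wpmul2l; first by rewrite lee_fin.
    apply: (@le_trans _ _ (n2 vs s + n3 vs s)%E); last by rewrite leeDr.
    apply: (@le_trans _ _ (n3 vs s)); last by rewrite leeDr.
    by rewrite /n3 indicE (mem_set z3) mule1.
  apply: (@le_trans _ _ (D vs s)); last by rewrite leeDl.
  rewrite /D lee_fin /M; apply: ler_pM.
  - by rewrite mulr_ge0// ltW.
  - by rewrite !mulr_ge0.
  - apply: ler_pM; [exact: ltW|exact: ltW|exact: powR_ge_min|exact: bcb].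
  - apply: ler_pM; [exact: mulr_ge0|exact: ha0| |exact: h_core].
    by apply: ler_pM => //; apply: h_ball.
apply: le_trans upper.
have -> : gain_const * N^-1 * a ^+ 2 * a0 = M * (pi * eta) * (2 * (delta / 20)) ^+ 3.
  by rewrite /gain_const /M -/m /eta; field; lra.
have dd : 0 < delta / 20 by rewrite divr_gt0.
have c0 : 0 <= M * (pi * eta) by rewrite mulr_ge0// mulr_ge0 ?pi_ge0// ltW.
have mcube : measurable_fun setT (fun vs => ((near_cube c (delta / 20) vs)%:R)%:E : \bar R).
  by apply: mfunEFin; exact: mfun_bool.
have cube0 vs : (0 <= ((near_cube c (delta / 20) vs)%:R)%:E :> \bar R)%E by rewrite lee_fin.
rewrite EFinM -(near_cube_volume c dd).
apply: (le_trans (eq_leW (esym (integral_mull (leb3 R) c0 mcube cube0)))).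
apply: ge0_le_integral; first exact: measurableT.
- by move=> vs _; rewrite mule_ge0 ?lee_fin.
- by apply: mfun_mule => //; exact: measurable_cst.
- exact: (mfun_sphint mL L0).
move=> vs _; have [cube|_] := boolP (near_cube c (delta / 20) vs); last first.
  by rewrite mule0 sphint_ge0.
have y2 : vnorm (vsub vs c) ^+ 2 <= 3 * delta ^+ 2 / 400.
  by apply: le_trans (near_cube_norm cube) _; rewrite expr_div_n; lra.
(* A vanishing sum would give |v - c| = |w - c|, against |v - c| >= delta and w in the small cube.
   Hence the band of directions has an axis. *)
have e0 : vnorm (e vs) != 0.
  apply/eqP => en.
  have : vnorm (vsub v c) ^+ 2 = vnorm (vsub vs c) ^+ 2.
    have := vnorm_sqr (e vs); rewrite en expr0n /= => /esym/eqP.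
    rewrite !paddr_eq0 ?addr_ge0 ?sqr_ge0// !sqrf_eq0 /e /vadd /vmk /vx /vy /vz /= => /andP[/andP[/eqP e1 /eqP e2] /eqP e3].
    rewrite !vnorm_sqr; move: e1 e2 e3; rewrite /vsub /vmk /vx /vy /vz /= => e1 e2 e3.
    have sq (A B : R) : A + B = 0 -> A ^+ 2 = B ^+ 2.
      by move/eqP; rewrite addr_eq0 => /eqP ->; rewrite sqrrN.
    by congr (_ + _ + _); exact: sq.
  have : delta ^+ 2 <= vnorm (vsub v c) ^+ 2 by rewrite ler_sqr ?nnegrE ?vnorm_ge0 ?(ltW d0).
  have : 0 < delta ^+ 2 by rewrite exprn_gt0.
  lra.
have capb := sphint_cap (vdot_normalize e0).
have eta04 : 0 < eta <= 4^-1 by rewrite eta0 eta4.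
have h1 := capb _ eta04.
have me1 : measurable_fun setT (fun s => (`|vdot (vscale (vnorm (e vs))^-1 (e vs)) s| <= eta)%R%:R%:E : \bar R) by mfun.
have me0 s : (0 <= (`|vdot (vscale (vnorm (e vs))^-1 (e vs)) s| <= eta)%R%:R%:E :> \bar R)%E by rewrite lee_fin.
rewrite mule1 EFinM.
have MM : (0 <= M%:E)%E by rewrite lee_fin.
apply: (le_trans (lee_wpmul2l MM h1)).
rewrite -(sphint_mull M0 me1 me0); apply: eq_leW; apply: eq_sphint => s s1.
rewrite /L cube mul1r; congr (_ * (nat_of_bool _)%:R%:E)%E.
have -> : vdot (vscale (vnorm (e vs))^-1 (e vs)) s = vdot (e vs) s / vnorm (e vs).
  by rewrite /vdot /vscale /vmk /vx /vy /vz /=; ring.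
have ep : 0 < vnorm (e vs) by rewrite lt0r e0 vnorm_ge0.
by rewrite normrM normfV (ger0_norm (ltW ep)) ler_pdivrMr.
Qed.

End gain_lower.
(** * Growth along trajectories *)

Section growth.
Context (R : realType).
Implicit Types (phi q : R -> R).

(* The only consequence of phi' = q that is used. *)
Definition growth phi q := forall s t c : R, 0 <= s -> s <= t ->
  (forall tau, s <= tau <= t -> c <= q tau) -> phi s + c * (t - s) <= phi t.

(** Let u be the supremum of the times at which phi is at least M; after u the slope is at least c.
    If there is no such time, the slope is at least c on all of [s, t]. The bound - K excludes
    downward jumps, which gives phi u >= M at the supremum itself. *)
Lemma growth_barrier phi q (K M c s t : R) : growth phi q ->
  (forall tau, 0 <= tau -> - K <= q tau) -> 0 <= K -> 0 <= s -> s <= t ->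
  (forall tau, s <= tau <= t -> phi tau < M -> c <= q tau) ->
  Num.min (phi s + c * (t - s)) (M + Num.min 0 c * (t - s)) <= phi t.
Proof.
move=> G qK K0 s0 st qc.
pose S := [set tau | s <= tau <= t /\ M <= phi tau].
have [[tau0 Stau0]|noS] := pselect (S !=set0); last first.
  rewrite ge_min; apply/orP; left; apply: G => // tau stau; apply: qc => //.
  by rewrite ltNge; apply/negP => h; apply: noS; exists tau.
have hS : has_sup S by split; [exists tau0|exists t => x [/andP[]]].
have ubS := sup_upper_bound hS.
pose u := sup S.
have su : s <= u by have [/andP[h _] _] := Stau0; apply: (le_trans h); exact: ubS.
have ut : u <= t by apply: ge_sup; [exists tau0|move=> x [/andP[]]].
have phiu : M <= phi u.
  apply/ler_addgt0Pr => e e0.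
  have e1 : 0 < e / (K + 1) by rewrite divr_gt0//; lra.
  have [x [/andP[sx xt] Mx] xu] := sup_adherent e1 hS.
  have xu' : x <= u by apply: ubS; split => //; rewrite sx xt.
  have := G x u (- K) (le_trans s0 sx) xu'.
  have h tau : x <= tau <= u -> - K <= q tau.
    by move=> /andP[h1 _]; apply: qK; apply: le_trans h1; apply: le_trans sx.
  move=> /(_ h) hG.
  have : K * (u - x) <= e.
    apply: (@le_trans _ _ (K * (e / (K + 1)))); first by apply: ler_wpM2l => //; rewrite /u; lra.
    by rewrite mulrA ler_pdivrMr; [nra|lra].
  lra.
rewrite ge_min; apply/orP; right.
have mn0 : Num.min 0 c <= 0 by rewrite ge_min lexx.
have mnc : Num.min 0 c <= c by rewrite ge_min lexx orbT.
suff : M + c * (t - u) <= phi t.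
  have : Num.min 0 c * (t - s) <= c * (t - u).
    apply: (@le_trans _ _ (Num.min 0 c * (t - u))); last by apply: ler_wpM2r => //; lra.
    by apply: ler_wnM2l => //; lra.
  lra.
move: ut; rewrite le_eqVlt => /predU1P[<-|ut]; first by rewrite subrr mulr0 addr0.
apply/ler_addgt0Pr => e e0.
(* The inequality phi < M is known only strictly after u, so the slope c is used from u + d on;
   passing over [u, u + d] costs at most (K + |c|) d <= e. *)
pose d := Num.min (t - u) (e / (K + `|c| + 1)).
have den : 0 < K + `|c| + 1 by have := normr_ge0 c; lra.
have dpos : 0 < d by rewrite lt_min subr_gt0 ut divr_gt0.
have dt : d <= t - u by rewrite ge_min lexx.
have de : d * (K + `|c| + 1) <= e by rewrite -ler_pdivlMr// ge_min lexx orbT.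
have u0 : 0 <= u by exact: le_trans su.
have h1 : phi u + - K * (u + d - u) <= phi (u + d).
  by apply: G => //; [lra|move=> tau /andP[h _]; apply: qK; lra].
have h2 : phi (u + d) + c * (t - (u + d)) <= phi t.
  apply: G; [lra|lra|move=> tau /andP[t1 t2]].
  have stau : s <= tau <= t by apply/andP; split; lra.
  apply: qc => //; rewrite ltNge; apply/negP => h.
  by have := ubS tau (conj stau h); rewrite -/u; lra.
have : c * d <= `|c| * d by apply: ler_wpM2r; [exact: ltW|exact: ler_norm].
nra.
Qed.

(** A half-life in place of an exponential: below the level phi s the slope is at least - K phi s,
    so at most half of phi s is lost within time 1 / (2 K). *)
Lemma growth_decay phi q (K s t : R) : growth phi q -> 0 < K ->
  (forall tau, 0 <= tau -> 0 <= phi tau <= 1) ->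
  (forall tau, 0 <= tau -> - (K * phi tau) <= q tau) ->
  0 <= s -> s <= t -> K * (t - s) <= 2^-1 -> phi s / 2 <= phi t.
Proof.
move=> G K0 phi01 qK s0 st Kst.
have /andP[p0 p1] := phi01 s s0.
have qK' tau : 0 <= tau -> - K <= q tau.
  by move=> tau0; have := qK _ tau0; have /andP[] := phi01 tau tau0; nra.
have qc tau : s <= tau <= t -> phi tau < phi s -> - (K * phi s) <= q tau.
  move=> /andP[t1 t2] h; have t0 : 0 <= tau by lra.
  by have := qK _ t0; nra.
have := growth_barrier G qK' (ltW K0) s0 st qc.
have -> : Num.min 0 (- (K * phi s)) = - (K * phi s).
  by apply/min_idPr; rewrite oppr_le0 mulr_ge0// ltW.
rewrite minxx; apply: le_trans.
have : phi s * (K * (t - s)) <= phi s * 2^-1 by exact: ler_wpM2l.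
nra.
Qed.

Lemma growth_decay_iter phi q (K : R) (n : nat) (t : R) : growth phi q -> 0 < K ->
  (forall tau, 0 <= tau -> 0 <= phi tau <= 1) ->
  (forall tau, 0 <= tau -> - (K * phi tau) <= q tau) ->
  0 <= t -> K * t <= n%:R / 2 -> phi 0 / 2 ^+ n <= phi t.
Proof.
move=> G K0 phi01 qK; elim: n t => [|n IH] t t0 Kt.
  have -> : t = 0 by apply/eqP; rewrite eq_le t0 andbT; nra.
  by rewrite expr0 divr1.
have /andP[p0 _] := phi01 0 (lexx 0).
have [t2|t2] := leP (K * t) 2^-1.
  have := growth_decay G K0 phi01 qK (lexx 0) t0; rewrite subr0 => /(_ t2).
  apply: le_trans; apply: ler_wpM2l => //; rewrite lef_pV2 ?posrE ?exprn_gt0//.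
  by rewrite exprS ler_peMr// exprn_ege1// ler1n.
(* One half-life before t, which leaves n half-lives for the induction hypothesis. *)
pose s := t - (2 * K)^-1.
have KK : K * (2 * K)^-1 = 2^-1 by field; lra.
have s0 : 0 <= s.
  by rewrite -(pmulr_rge0 _ K0) /s mulrBr KK; lra.
have Ks : K * s <= n%:R / 2 by rewrite /s mulrBr KK; move: Kt; rewrite -addn1 natrD; lra.
have st : s <= t by rewrite /s gerBl invr_ge0 mulr_ge0 ?ltW.
have h := growth_decay G K0 phi01 qK s0 st.
apply: le_trans (h _); last by rewrite /s opprB addrC subrK KK.
by rewrite exprSr invfM mulrA ler_pM2r//; exact: IH.
Qed.

(** The barrier is the level al / (4 K). Below it al phi <= K phi <= al / 4, so the slope is at
    least al - al / 4 - al / 4 = al / 2. *)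
Lemma growth_gain phi q (K al s t : R) : growth phi q -> 0 < K -> 0 <= al -> al <= K ->
  (forall tau, 0 <= tau -> 0 <= phi tau <= 1) ->
  (forall tau, 0 <= tau -> - (K * phi tau) <= q tau) ->
  0 <= s -> s <= t ->
  (forall tau, s <= tau <= t -> al * (1 - phi tau) - K * phi tau <= q tau) ->
  al * Num.min ((t - s) / 2) (4 * K)^-1 <= phi t.
Proof.
move=> G K0 al0 alK phi01 qK s0 st qal.
have /andP[p0 p1] := phi01 s s0.
have qK' tau : 0 <= tau -> - K <= q tau.
  by move=> tau0; have := qK _ tau0; have /andP[] := phi01 tau tau0; nra.
have KK : K * (4 * K)^-1 = 4^-1 by field; lra.
have qc tau : s <= tau <= t -> phi tau < al * (4 * K)^-1 -> al / 2 <= q tau.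
  move=> tst h; have /andP[t1 t2] := tst; have t0 : 0 <= tau by lra.
  have /andP[x0 x1] := phi01 tau t0.
  have := qal _ tst.
  have h1 : K * phi tau <= al * 4^-1 by rewrite -KK mulrCA ler_pM2l// ltW.
  have h2 : al * phi tau <= K * phi tau by exact: ler_wpM2r.
  lra.
have := growth_barrier G qK' (ltW K0) s0 st qc.
have -> : Num.min 0 (al / 2) = 0 by apply/min_idPl; rewrite divr_ge0.
rewrite mul0r addr0; apply: le_trans.
rewrite le_min; apply/andP; split.
  apply: (@le_trans _ _ (al * ((t - s) / 2))).
    by apply: ler_wpM2l => //; rewrite ge_min lexx.
  lra.
by apply: ler_wpM2l => //; rewrite ge_min lexx orbT.
Qed.

End growth.

(** * Growth inequalities from an integral equation with bounded measurable right-hand side *)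

Section growth_of_integral.
Context (R : realType).
Variables (phi q : R -> R) (phi0 K : R).
Hypothesis phiE : forall t : R, 0 <= t -> phi t = phi0 + Rintegral (leb1 R) `[0, t] q.
Hypothesis mq : forall t : R, 0 <= t -> measurable_fun (`[0, t]%classic : set R) q.
Hypothesis qK : forall tau : R, 0 <= tau -> `|q tau| <= K.

Let iq t : 0 <= t -> (leb1 R).-integrable `[0, t]%classic (EFin \o q).
Proof.
move=> t0; apply: measurable_bounded_integrable => //.
- have e : leb1 R `[0, t]%classic = (if 0%:E < t%:E then t%:E - 0%:E else 0)%E.
    by etransitivity; first exact: lebesgue_measure_itv.
  by apply: le_lt_trans (eq_leW e) _; case: ifP => _; rewrite ltry.
- exact: mq.
exists K; split; first exact: num_real.
move=> y Ky x; rewrite /= in_itv/= => /andP[x0 _].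
by apply: le_trans (ltW Ky); exact: qK.
Qed.

Let increment s t : 0 <= s -> s <= t ->
  phi t = phi s + Rintegral (leb1 R) `]s, t] q /\
  (leb1 R).-integrable `]s, t]%classic (EFin \o q).
Proof.
move=> s0 st; have t0 : 0 <= t := le_trans s0 st.
split.
  rewrite (phiE t0) (phiE s0) -addrA; congr (_ + _); apply/esym.
  have := @Rintegral_itvB R q (BLeft 0) (BRight t) s (iq t0).
  rewrite !bnd_simp => /(_ s0 st) <-.
  by rewrite addrC subrK.
apply: integrableS (iq t0) => // x /=; rewrite !in_itv/= => /andP[h1 h2].
by rewrite h2 andbT (le_trans s0)// ltW.
Qed.

Let cst_integral (c s t : R) : s <= t -> Rintegral (leb1 R) `]s, t] (fun=> c) = c * (t - s) /\
  (leb1 R).-integrable `]s, t]%classic (EFin \o (fun=> c)).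
Proof.
move=> st.
have muE : leb1 R `]s, t]%classic = (t - s)%:E.
  etransitivity; first exact: lebesgue_measure_itv.
  rewrite /= lte_fin; case: ltP => h; first by rewrite EFinD.
  by have -> : t = s; [apply/eqP; rewrite eq_le h|rewrite subrr].
split.
  by apply: (etrans (Rintegral_cst _ _ _)); [exact: measurable_itv|congr (_ * _); exact: (congr1 fine muE)].
apply: measurable_bounded_integrable => //; first by apply: le_lt_trans (eq_leW muE) _; rewrite ltry.
by exists `|c|; split; [exact: num_real|move=> y cy x _; exact: ltW].
Qed.

Lemma growth_integral : growth phi q.
Proof.
move=> s t c s0 st qc; have [-> iqs] := increment s0 st.
have [<- ic] := cst_integral c st.
rewrite lerD2l; apply: le_Rintegral => // x; rewrite /= in_itv/= => /andP[h1 h2].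
by apply: qc; rewrite h2 ltW.
Qed.

Lemma growth_integral_compl : growth (fun t => 1 - phi t) (fun t => - q t).
Proof.
move=> s t c s0 st qc; have [-> iqs] := increment s0 st.
have [e ic] := cst_integral (- c) st.
suff : Rintegral (leb1 R) `]s, t] q <= - c * (t - s) by lra.
rewrite -e; apply: le_Rintegral => // x; rewrite /= in_itv/= => /andP[h1 h2].
by rewrite lerNr; apply: qc; rewrite h2 ltW.
Qed.

End growth_of_integral.

(** * Gain and loss *)

Section kernel_extension.
Context (R : realType).

Lemma costheta_bound (v vs s : vec3 R) : vdot s s = 1 -> -1 <= costheta v vs s <= 1.
Proof.
move=> s1; rewrite -ler_norml costhetaE normrM normfV (ger0_norm (vnorm_ge0 _)).
have n0 : 0 <= vnorm (vsub v vs) by exact: vnorm_ge0.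
(* For coinciding velocities the cosine is 0 by the convention on division. *)
have [->|nz] := eqVneq (vnorm (vsub v vs)) 0; first by rewrite invr0 mulr0.
rewrite ler_pdivrMr ?mul1r; last by rewrite lt0r nz.
by have := vdot_cauchy (vsub v vs) s; rewrite (vnorm_unit s1) mulr1.
Qed.

Variable b : R -> R.
Hypothesis mb : measurable_fun (@itvm11 R) b.
Hypothesis b0 : forall x : R, -1 <= x <= 1 -> 0 <= b x.
Hypothesis b_sym : forall th : R, 0 <= th <= pi -> b (cos (pi - th)) = b (cos th).

(** The assumptions on b concern [-1, 1] only. The extension by 0 is measurable, nonnegative and
    even on the whole line, and agrees with b at every value of [costheta] for unit sigma. *)
Definition kext : R -> R := b \_ (@itvm11 R).

Lemma mem_itvm11 (x : R) : (x \in @itvm11 R) = (-1 <= x <= 1).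
Proof. by rewrite /itvm11 mem_setE in_itv. Qed.

Lemma kextE x : -1 <= x <= 1 -> kext x = b x.
Proof. by rewrite /kext patchE mem_itvm11 => ->. Qed.

Lemma mfun_kext : measurable_fun setT kext.
Proof. by apply/(measurable_restrictT _ _).1 => //; rewrite /itvm11; exact: measurable_itv. Qed.

Lemma kext_ge0 x : 0 <= kext x.
Proof. by rewrite /kext patchE mem_itvm11; case: ifP => // /b0. Qed.

Lemma kext_even x : kext (- x) = kext x.
Proof.
rewrite /kext !patchE !mem_itvm11 lerN2 lerNl andbC; case: ifPn => // x1.
have x1' : x \in `[(-1), 1] by rewrite in_itv.
have /andP[h1 h2] := x1.
have c : 0 <= acos x <= pi by rewrite acos_ge0// acos_lepi.
have := b_sym c; rewrite acosK// => <-; congr b.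
by rewrite addrC cosDpi cosN acosK.
Qed.

Lemma kernB_kext g v vs s : vdot s s = 1 -> kernB g b v vs s = kernB g kext v vs s.
Proof. by move=> s1; rewrite /kernB kextE// costheta_bound. Qed.

Lemma kext_Cb : Cb_ext b = ((2 * pi)%:E * \int[leb1 R]_(th in @itv0pi R) ((sin th)%:E * (kext (cos th))%:E))%E.
Proof.
rewrite /Cb_ext; congr (_ * _)%E; apply: eq_integral => th _.
by rewrite kextE ?cos_geN1 ?cos_le1// muleC -EFinM mulrC.
Qed.

End kernel_extension.

Section QFD_split.
Context (R : realType).
Variables (g : R) (b : R -> R) (CB : R).
Hypotheses (g02 : 0 <= g <= 2) (mb : measurable_fun setT b) (b0 : forall x, 0 <= b x).
Hypothesis b_even : forall x, b (- x) = b x.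
Hypothesis bCB : ((2 * pi)%:E * \int[leb1 R]_(th in @itv0pi R) ((sin th)%:E * (b (cos th))%:E) = CB%:E)%E.

(** The integrand of A[h]. For h = 1 - f it is the coefficient of f(v) in the loss term. *)
Definition gain_kern (h : vec3 R -> R) (v vs s : vec3 R) : R :=
  kernB g b v vs s * (h (vpost v vs s) * h (vpost_s v vs s) * (1 - h vs)).

Definition gain (h : vec3 R -> R) (v : vec3 R) : \bar R :=
  (\int[leb3 R]_vs sphint (fun s => (gain_kern h v vs s)%:E))%E.

Let mu5 := product_measure1 (product_measure1 (leb3 R) (leb1 R)) (leb1 R).

Lemma measurable_coll_dom : measurable (@coll_dom R).
Proof.
have -> : @coll_dom R = [set z : vec3 R * R * R | [&& 0 <= z.1.2 <= pi & 0 <= z.2 <= 2 * pi]].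
  by apply/seteqP; split => z /=; rewrite /coll_dom /= => /andP.
by apply: measurable_setb; mfun.
Qed.

Variables (h : vec3 R -> R) (E : R).
Hypotheses (mh : measurable_fun setT h) (h01 : forall v, 0 <= h v <= 1).
Hypothesis hE : norm12 h = E%:E.

Let h' v := 1 - h v.
Let mh' : measurable_fun setT h'. Proof. by rewrite /h'; mfun. Qed.
Let h'01 v : 0 <= h' v <= 1.
Proof. by have /andP[p q] := h01 v; rewrite /h'; apply/andP; split; lra. Qed.

Lemma mfun_gain_kern (k : vec3 R -> R) v : measurable_fun setT k ->
  measurable_fun setT (fun p => (gain_kern k v p.1 p.2)%:E).
Proof.
move=> mk; have mp := mfun_vpost v; have mq := mfun_vpost_s v; have mc := mfun_costheta v.
by rewrite /gain_kern /kernB; mfun.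
Qed.

Lemma gain_kern_ge0 (k : vec3 R -> R) : (forall v, 0 <= k v <= 1) -> forall v vs s,
  0 <= gain_kern k v vs s.
Proof.
move=> k01 v vs s; have k0 u : 0 <= k u by case/andP: (k01 u).
apply: mulr_ge0; first exact: kern_ge0.
by rewrite mulr_ge0 ?mulr_ge0// subr_ge0; case/andP: (k01 vs).
Qed.

Lemma gain_le v : (gain h v <= (128 * CB * (1 + vnorm v ^+ 2) * E)%:E)%E.
Proof.
have h0 u : 0 <= h u by case/andP: (h01 u).
apply: le_trans (gain_bound g02 mb b0 b_even bCB mh h01 hE v).
have mB : measurable_fun setT (fun p => (kernB g b v p.1 p.2 * (h (vpost v p.1 p.2) * h (vpost_s v p.1 p.2)))%:E).
  have mp := mfun_vpost v; have mq := mfun_vpost_s v; have mc := mfun_costheta v.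
  by rewrite /kernB; mfun.
have B0 vs s : (0 <= (kernB g b v vs s * (h (vpost v vs s) * h (vpost_s v vs s)))%:E)%E.
  by rewrite lee_fin; apply: mulr_ge0; [exact: kern_ge0|exact: mulr_ge0].
have G0 vs s : (0 <= (gain_kern h v vs s)%:E)%E by rewrite lee_fin gain_kern_ge0.
have mG := mfun_gain_kern v mh.
apply: ge0_le_integral; first exact: measurableT.
- by move=> vs _; exact: sphint_ge0.
- exact: (mfun_sphint (F := fun vs s => (gain_kern h v vs s)%:E) mG G0).
- exact: (mfun_sphint (F := fun vs s => (kernB g b v vs s * (h (vpost v vs s) * h (vpost_s v vs s)))%:E) mB B0).
move=> vs _; apply: le_sphint => //.
- exact: (mfun_sect1 (F := fun vs s => (gain_kern h v vs s)%:E) mG vs).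
- exact: (mfun_sect1 (F := fun vs s => (kernB g b v vs s * (h (vpost v vs s) * h (vpost_s v vs s)))%:E) mB vs).
move=> s _; rewrite lee_fin; apply: ler_wpM2l; first exact: kern_ge0.
have /andP[_ p1] := h01 vs; have := h0 vs.
by move=> ?; rewrite ler_piMr ?mulr_ge0// gerBl.
Qed.

(** The norm of 1 - h is infinite, so [gain_bound] is out of reach. The last factor 1 - (1 - h(w)) =
    h(w) supplies the decay, and the other two are at most 1. *)
Lemma gain_compl_le v : (gain h' v <= (128 * CB * (1 + vnorm v ^+ 2) * E)%:E)%E.
Proof.
have h0 u : 0 <= h u by case/andP: (h01 u).
have B := loss_bound g02 mb b0 bCB mh h01 hE v.
apply: (le_trans _ B).
have mB : measurable_fun setT (fun p => (kernB g b v p.1 p.2 * h p.1)%:E).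
  by have mc := mfun_costheta v; rewrite /kernB; mfun.
have B0 vs s : (0 <= (kernB g b v vs s * h vs)%:E)%E.
  by rewrite lee_fin; apply: mulr_ge0 => //; exact: kern_ge0.
have G0 vs s : (0 <= (gain_kern h' v vs s)%:E)%E by rewrite lee_fin gain_kern_ge0.
have mG := mfun_gain_kern v mh'.
apply: ge0_le_integral; first exact: measurableT.
- by move=> vs _; exact: sphint_ge0.
- exact: (mfun_sphint (F := fun vs s => (gain_kern h' v vs s)%:E) mG G0).
- exact: (mfun_sphint (F := fun vs s => (kernB g b v vs s * h vs)%:E) mB B0).
move=> vs _; apply: le_sphint => //.
- exact: (mfun_sect1 (F := fun vs s => (gain_kern h' v vs s)%:E) mG vs).
- exact: (mfun_sect1 (F := fun vs s => (kernB g b v vs s * h vs)%:E) mB vs).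
move=> s _; rewrite lee_fin; apply: ler_wpM2l; first exact: kern_ge0.
have /andP[p0 p1] := h'01 (vpost v vs s); have /andP[q0 q1] := h'01 (vpost_s v vs s).
rewrite (_ : 1 - h' vs = h vs); last by rewrite /h'; ring.
by rewrite ler_piMl// mulr_ile1.
Qed.

Let coll_integrable (Psi : vec3 R -> vec3 R -> R) :
  measurable_fun setT (fun p => (Psi p.1 p.2)%:E) -> (forall v s, 0 <= Psi v s) ->
  (\int[leb3 R]_vs sphint (fun s => (Psi vs s)%:E) < +oo)%E ->
  mu5.-integrable (@coll_dom R) (EFin \o (fun z => sin z.1.2 * Psi z.1.1 (sph z.1.2 z.2))) /\
  Rintegral mu5 (@coll_dom R) (fun z => sin z.1.2 * Psi z.1.1 (sph z.1.2 z.2)) =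
    fine (\int[leb3 R]_vs sphint (fun s => (Psi vs s)%:E))%E.
Proof.
move=> mP P0 fin.
have P0' v s : (0 <= (Psi v s)%:E)%E by rewrite lee_fin.
have e := coll_integral (Psi := fun v s => (Psi v s)%:E) mP P0'.
split; last by rewrite /Rintegral -e.
apply/integrableP; split.
  apply/measurable_EFinP; apply: measurable_funTS.
  apply: mfun_mulr; first by mfun.
  by apply/measurable_EFinP; exact: (mfun_coll (Psi := fun v s => (Psi v s)%:E) mP).
apply: le_lt_trans fin; rewrite -e; apply: eq_leW; apply: eq_integral => z /set_mem[z1 z2].
by rewrite /= ger0_norm// mulr_ge0// sin_ge0_pi.
Qed.

Lemma QFD_splitE (f : R -> vec3 R -> R) tau v : f tau = h ->
  QFD g b f tau v = (1 - h v) * fine (gain h v) - h v * fine (gain h' v).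
Proof.
move=> fh.
(* Gain and loss may be integrated separately because each is integrable by its upper bound. *)
have i1 := coll_integrable (mfun_gain_kern v mh) (gain_kern_ge0 h01 v) (le_lt_trans (gain_le v) (ltry _)).
have i2 := coll_integrable (mfun_gain_kern v mh') (gain_kern_ge0 h'01 v) (le_lt_trans (gain_compl_le v) (ltry _)).
have /(_ measurable_coll_dom) z1 := fun mD => integrableZl mD (1 - h v) i1.1.
have /(_ measurable_coll_dom) z2 := fun mD => integrableZl mD (h v) i2.1.
have /(_ measurable_coll_dom) e1 := fun mD =>
  etrans (RintegralZl (1 - h v) mD i1.1) (congr1 (fun x => (1 - h v) * x) i1.2).
have /(_ measurable_coll_dom) e2 := fun mD =>
  etrans (RintegralZl (h v) mD i2.1) (congr1 (fun x => h v * x) i2.2).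
have /(_ measurable_coll_dom) e3 := fun mD => RintegralB mD z1 z2.
apply: etrans (etrans e3 (congr2 (fun x y : R => x - y) e1 e2)).
apply: eq_Rintegral => z _.
rewrite /QFD_integrand fh /gain_kern /h'; ring.
Qed.

End QFD_split.

(** * Measurability of the collision operator in time *)

Section QFD_in_time.
Context (R : realType).
Variables (g : R) (b : R -> R) (f : R -> vec3 R -> R).

Let mu5 := sfprod (sfprod (sleb3 R) (leb1 R)) (leb1 R).

Lemma measurable_time_coll_dom (t : R) : measurable (@time_coll_dom R t).
Proof.
have -> : @time_coll_dom R t =
    [set p : R * vec3 R * R * R | [&& 0 <= p.1.1.1 <= t, 0 <= p.1.2 <= pi & 0 <= p.2 <= 2 * pi]].
  apply/seteqP; split => p; rewrite /time_coll_dom /=; first by case=> -> [-> ->].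
  by case/and3P => -> -> ->.
by apply: measurable_setb; mfun.
Qed.

Let emb (x : R) (y : vec3 R * R * R) : R * vec3 R * R * R := (((x, y.1.1), y.1.2), y.2).

Let mfun_pos_integral (G : R * vec3 R * R * R -> \bar R) : measurable_fun setT G ->
  (forall p, 0 <= G p)%E ->
  measurable_fun setT (fun x => \int[mu5]_y G (emb x y))%E.
Proof.
move=> mG G0.
have mE : measurable_fun setT (fun p => G (emb p.1 p.2)).
  by apply: (mfun_comp mG); rewrite /emb; mfun.
exact: (mfun_integral2 mu5 (F := fun x y => G (emb x y)) mE (fun x y => G0 _)).
Qed.

(** Joint measurability is part of the integrability required of a solution. The positive and
    negative parts are integrated over the collision variables separately, as Tonelli concerns
    nonnegative functions; [emb] isolates time as the first factor. *)
Lemma mfun_QFD_time (t : R) (v : vec3 R) :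
  measurable_fun (@time_coll_dom R t) (fun p => (QFD_time_integrand g b f v p)%:E) ->
  measurable_fun (`[0, t]%classic : set R) (fun tau => QFD g b f tau v).
Proof.
move=> mF.
pose G := (fun p => (QFD_time_integrand g b f v p)%:E) \_ (@time_coll_dom R t).
have mG : measurable_fun setT G.
  exact: (measurable_restrictT _ (measurable_time_coll_dom t)).1 mF.
have mP := mfun_pos_integral (measurable_funepos mG) (@funepos_ge0 _ _ G).
have mN := mfun_pos_integral (measurable_funeneg mG) (@funeneg_ge0 _ _ G).
pose H x := fine (\int[mu5]_y G^\+ (emb x y) - \int[mu5]_y G^\- (emb x y))%E.
have mH : measurable_fun setT H.
  by apply: (mfun_comp (fine_measurable measurableT)); exact: emeasurable_funB mP mN.
apply: (eq_measurable_fun H); last exact: measurable_funTS mH.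
move=> tau /set_mem; rewrite /= in_itv/= => taut.
rewrite /H /QFD /Rintegral; congr fine; apply/esym.
rewrite integral_mkcond.
have Gz z : ((EFin \o QFD_integrand g b f tau v) \_ (@coll_dom R)) z = G (emb tau z).
  rewrite /G !patchE /QFD_time_integrand /emb /=.
  have -> : (((tau, z.1.1), z.1.2, z.2) \in @time_coll_dom R t) = (z \in @coll_dom R).
    by apply/idP/idP => /set_mem h; apply/mem_set; [case: h|split].
  by case: z => -[].
by rewrite integralE; congr (_ - _)%E; apply: eq_integral => z _; rewrite ?funeposE ?funenegE Gz.
Qed.

End QFD_in_time.
(** * Spreading of positivity *)

Lemma gain_loss_ge (R : realDomainType) (y A A' al K : R) : 0 <= y <= 1 -> al <= A -> A' <= K ->
  al * (1 - y) - K * y <= (1 - y) * A - y * A'.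
Proof. by move=> /andP[y0 y1] hA hA'; nra. Qed.

Lemma norm_gain_loss (R : realDomainType) (y A A' K : R) : 0 <= y <= 1 -> 0 <= A <= K -> 0 <= A' <= K ->
  `|(1 - y) * A - y * A'| <= K.
Proof.
move=> /andP[y0 y1] /andP[A0 AK] /andP[B0 BK].
have h1 : 0 <= 1 - y by rewrite subr_ge0.
have h2 := ler_wpM2l h1 AK; have h3 := mulr_ge0 h1 A0.
have h4 := ler_wpM2l y0 BK; have h5 := mulr_ge0 y0 B0.
have K0 := le_trans A0 AK; have h6 := mulr_ge0 y0 K0; have h7 := mulr_ge0 h1 K0.
by rewrite ler_norml; apply/andP; split; lra.
Qed.

Section spread_sequence.
Context (R : realType).
Variables (q a0 : R).
Hypotheses (q0 : 0 < q) (q1 : q <= 1) (a00 : 0 < a0) (a01 : a0 <= 1).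

(** The solution of a_(n+1) = q 4^-n a_n ^ 2 with a_0 = a0, found by noting that q a_n / 4^(n+1) is
    squared at each step. *)
Definition spread_seq n : R := q^-1 * 4 ^+ n.+1 * (q * a0 / 4) ^+ (2 ^ n).

Lemma spread_seq0 : spread_seq 0 = a0.
Proof. by rewrite /spread_seq expn0 !expr1; field; rewrite gt_eqF. Qed.

Lemma spread_seqS n : spread_seq n.+1 = q * (4 ^+ n)^-1 * spread_seq n ^+ 2.
Proof.
rewrite /spread_seq expnS mulnC exprM !exprS expr0.
have n4 : (4 : R) ^+ n != 0 by rewrite expf_neq0// pnatr_eq0.
by field; rewrite n4 gt_eqF.
Qed.

Lemma spread_seq_bounds n : 0 <= spread_seq n <= a0.
Proof.
elim: n => [|n /andP[h0 h1]]; first by rewrite spread_seq0 lexx ltW.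
rewrite spread_seqS; have n4 : 0 <= ((4 : R) ^+ n)^-1 <= 1.
  by rewrite invr_ge0 exprn_ge0//= invf_le1 ?exprn_gt0// exprn_ege1// ler1n.
have /andP[n40 n41] := n4.
have qn : q * (4 ^+ n)^-1 <= 1 by rewrite mulr_ile1// ltW.
have qn0 : 0 <= q * (4 ^+ n)^-1 by rewrite mulr_ge0// ltW.
rewrite mulr_ge0 ?exprn_ge0//=.
apply: (@le_trans _ _ (spread_seq n ^+ 2)); first by rewrite ler_piMl// exprn_ge0.
have := a01; have := a00; nra.
Qed.

Lemma spread_seq_ge n : (q * a0 / 4) ^+ (2 ^ n) <= spread_seq n.
Proof.
have x0 : 0 <= q * a0 / 4 by rewrite divr_ge0// mulr_ge0 ?(ltW q0) ?(ltW a00).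
rewrite /spread_seq; apply: ler_peMl; first exact: exprn_ge0.
have iq : 1 <= q^-1 by rewrite invf_ge1.
have h4 : 1 <= 4 ^+ n.+1 :> R by rewrite exprn_ege1// ler1n.
by apply: le_trans iq _; rewrite ler_peMr// invr_ge0 ltW.
Qed.

End spread_sequence.

Section spreading.
Context (R : realType).
Variables (g : R) (b : R -> R) (cb delta : R) (c : vec3 R).
Hypotheses (g02 : 0 <= g <= 2) (mb : measurable_fun setT b) (b0 : forall x, 0 <= b x).
Hypotheses (cb0 : 0 < cb) (bcb : forall x, `|x| <= 2^-1 -> cb <= b x) (d0 : 0 < delta).
Variables (Z : set (vec3 R)) (h : R -> vec3 R -> R) (K : vec3 R -> R).
Hypotheses (mZ : measurable Z) (Z0 : leb3 R Z = 0%E).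
Hypotheses (mh : forall t : R, 0 <= t -> measurable_fun setT (h t)).
Hypotheses (h01 : forall (t : R) v, 0 <= t -> 0 <= h t v <= 1).
Hypothesis gainK : forall (t : R) v, 0 <= t -> (gain g b (h t) v <= (K v)%:E)%E.
Hypothesis lossK : forall (t : R) v, 0 <= t -> (gain g b (fun u => (1 - h t u)%R) v <= (K v)%:E)%E.

Let q v t := (1 - h t v) * fine (gain g b (h t) v) - h t v * fine (gain g b (fun u => 1 - h t u) v).

Hypothesis growth_h : forall v, ~ Z v -> growth (h^~ v) (q v).

Lemma gain_ge0 (k : vec3 R -> R) v : (forall u, 0 <= k u <= 1) -> (0 <= gain g b k v)%E.
Proof.
move=> k01; apply: integral_ge0 => vs _; apply: sphint_ge0 => s.
by rewrite lee_fin gain_kern_ge0.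
Qed.

Lemma fine_bound (x : \bar R) (k : R) : (0 <= x)%E -> (x <= k%:E)%E -> 0 <= fine x <= k.
Proof.
move=> x0 xk; have xf : x \is a fin_num by rewrite ge0_fin_numE// (le_lt_trans xk) ?ltry.
by rewrite -!lee_fin fineK// x0 xk.
Qed.

Let qK v t : 0 <= t -> - (K v * h t v) <= q v t.
Proof.
move=> t0; have /andP[p0 p1] := h01 v t0.
have c01 u : 0 <= 1 - h t u <= 1 by have /andP[r0 r1] := h01 u t0; apply/andP; split; lra.
have /andP[A0 _] := fine_bound (gain_ge0 v (fun u => h01 u t0)) (gainK v t0).
have /andP[_ A1] := fine_bound (gain_ge0 v c01) (lossK v t0).
by have := gain_loss_ge (h01 v t0) A0 A1; rewrite mul0r sub0r.
Qed.

(** On the core the loss rate is at most Kd, so a time T amounts to at most n half-lives. *)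
Lemma core_lower (eps Kd T : R) (n : nat) : 0 < Kd -> 
  (forall v, vnorm (vsub v c) <= delta -> K v <= Kd) ->
  (forall v, ~ Z v -> vnorm (vsub v c) <= delta -> eps <= h 0 v) -> Kd * T <= n%:R / 2 ->
  forall t v, 0 <= t <= T -> ~ Z v -> vnorm (vsub v c) <= delta -> eps / 2 ^+ n <= h t v.
Proof.
move=> Kd0 KKd eps0 KdT t v /andP[t0 tT] Zv vc.
have Kt : Kd * t <= n%:R / 2 by apply: le_trans KdT; rewrite ler_pM2l.
apply: le_trans (growth_decay_iter (growth_h Zv) Kd0 (fun s s0 => h01 v s0) _ t0 Kt).
  by rewrite ler_pM2r ?invr_gt0 ?exprn_gt0//; exact: eps0.
move=> s s0; apply: le_trans (qK v s0); rewrite lerN2; apply: ler_wpM2r; last exact: KKd.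
by case/andP: (h01 v s0).
Qed.

Variables (T a0 : R).
Hypotheses (a00 : 0 <= a0).
Hypothesis core_compl : forall (t : R) v, 0 <= t <= T -> ~ Z v -> vnorm (vsub v c) <= delta -> a0 <= 1 - h t v.

(** From time s on the gain is bounded below by [gain_lower] and the loss rate above by KN;
    [growth_gain] turns this into a lower bound for h after the waiting time d. *)
Lemma spread_step (N a s d KN : R) : 1 <= N -> 0 <= a -> 0 <= s -> 0 <= d -> 0 < KN ->
  (forall v, vnorm (vsub v c) ^+ 2 <= delta ^+ 2 * (2 * N + 1) / 2 -> K v <= KN) ->
  (forall t v, s <= t <= T -> ~ Z v ->
    vnorm (vsub v c) ^+ 2 <= delta ^+ 2 * (N + 1) / 2 -> a <= h t v) ->
  forall t v, s + d <= t <= T -> ~ Z v -> delta <= vnorm (vsub v c) ->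
    vnorm (vsub v c) ^+ 2 <= delta ^+ 2 * (2 * N + 1) / 2 ->
    gain_const cb delta * N^-1 * a ^+ 2 * a0 * Num.min (d / 2) (4 * KN)^-1 <= h t v.
Proof.
move=> N1 a_ge0 s0 d_ge0 KN0 KKN ha t v /andP[st tT] Zv dv vN.
have al0 : 0 <= gain_const cb delta * N^-1 * a ^+ 2 * a0.
  have N0 : 0 <= N := le_trans ler01 N1.
  have k0 := ltW (gain_const_gt0 cb0 d0).
  have iN0 : 0 <= N^-1 by rewrite invr_ge0.
  have a2 : 0 <= a ^+ 2 by exact: exprn_ge0.
  by apply: mulr_ge0 a00; apply: mulr_ge0 a2; exact: mulr_ge0.
have gl tau : s <= tau <= T -> ((gain_const cb delta * N^-1 * a ^+ 2 * a0)%:E <= gain g b (h tau) v)%E.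
  move=> stau; have /andP[stau1 stau2] := stau.
  have tau0 : 0 <= tau := le_trans s0 stau1.
  apply: (gain_lower (c := c) g02 mb b0 cb0 bcb d0 mZ Z0 (mh tau0) (fun u => h01 u tau0) N1 a_ge0 a00) => //.
    by move=> u Zu hu; exact: (ha tau u stau Zu hu).
  by move=> u Zu hu; apply: (core_compl _ Zu hu); rewrite tau0.
(* [growth_gain] is started at t - d and not at s, so that the bound is the same for all later t. *)
have td : t - (t - d) = d by ring.
have sT : s <= T by lra.
suff : gain_const cb delta * N^-1 * a ^+ 2 * a0 * Num.min ((t - (t - d)) / 2) (4 * KN)^-1 <= h t v by rewrite td.
apply: (growth_gain (growth_h Zv) KN0 al0 _ (fun s s0 => h01 v s0)).
- apply: le_trans (KKN v vN); rewrite -lee_fin; apply: le_trans (gainK v s0); apply: gl.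
  by rewrite lexx.
- move=> tau tau0; apply: le_trans (qK v tau0); rewrite lerN2; apply: ler_wpM2r; last exact: KKN.
  by case/andP: (h01 v tau0).
- lra.
- lra.
move=> tau /andP[t1 t2]; have tau0 : 0 <= tau by lra.
have /andP[p0 p1] := h01 v tau0.
have c01 u : 0 <= 1 - h tau u <= 1 by have /andP[r0 r1] := h01 u tau0; apply/andP; split; lra.
have /andP[_ A1] := fine_bound (gain_ge0 v c01) (lossK v tau0).
have A0 : gain_const cb delta * N^-1 * a ^+ 2 * a0 <= fine (gain g b (h tau) v).
  rewrite -lee_fin fineK; first by apply: gl; apply/andP; split; lra.
  rewrite ge0_fin_numE ?(le_lt_trans (gainK v tau0)) ?ltry//.
  by apply: gain_ge0 => u; exact: h01.
exact: gain_loss_ge (h01 v tau0) A0 (le_trans A1 (KKN v vN)).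
Qed.

Variable K1 : R.
Hypotheses (T1 : 1 <= T) (K10 : 0 < K1) (a0_gt0 : 0 < a0) (a01 : a0 <= 1).
Hypothesis K_ball : forall n v, vnorm (vsub v c) ^+ 2 <= delta ^+ 2 * (2 * 2 ^+ n + 1) / 2 ->
  K v <= 2 ^+ n * K1.
Hypothesis core_h : forall (t : R) v, 0 <= t <= T -> ~ Z v -> vnorm (vsub v c) <= delta -> a0 <= h t v.

(** The constant q of the recursion. At step n the waiting time is 2^-n / (2 T) and the loss rate
    2^n K1, so the minimum in [spread_step] scales like 2^-n; the factor 1 / N = 2^-n completes
    4^-n. The cap at 1 keeps the sequence below a0. *)
Let rate := Num.min 1 (gain_const cb delta * a0 * Num.min (4 * T)^-1 (4 * K1)^-1).

Let rate_gt0 : 0 < rate.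
Proof.
have T_ := T1; have K_ := K10.
have m0 : 0 < Num.min (4 * T)^-1 (4 * K1)^-1.
  by rewrite lt_min !invr_gt0; apply/andP; split; lra.
by rewrite lt_min ltr01 (mulr_gt0 (mulr_gt0 (gain_const_gt0 cb0 d0) a0_gt0) m0).
Qed.

Let rate_le1 : rate <= 1. Proof. by rewrite ge_min lexx. Qed.

(** The step from n to n + 1 takes the time 2^-(n+1) / T. All steps together take less than 1 / T,
    so every radius has been reached by time T^-1. In the core, which [spread_step] leaves out, h >=
    a0 and the sequence stays below a0. *)
Lemma spread n t v : (1 - (2 ^+ n)^-1) / T <= t <= T -> ~ Z v ->
  vnorm (vsub v c) ^+ 2 <= delta ^+ 2 * (2 ^+ n + 1) / 2 -> spread_seq rate a0 n <= h t v.
Proof.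
have T_ : 1 <= T := T1; have T0 : 0 < T by lra.
have d_ : 0 < delta := d0.
elim: n t v => [|n IH] t v.
  rewrite expr0 invr1 subrr mul0r => tT Zv vc; rewrite spread_seq0//; apply: core_h => //.
  rewrite -(@ler_pXn2r _ 2) ?nnegrE ?vnorm_ge0 ?(ltW d_)//; apply: (le_trans vc).
  lra.
move=> tT Zv; rewrite (exprS 2 n) => vc; have /andP[t1 t2] := tT.
have p0 : 0 < (2 ^+ n : R) by exact: exprn_gt0.
have p1 : 1 <= (2 ^+ n : R) by rewrite exprn_ege1// ler1n.
pose s := (1 - (2 ^+ n)^-1) / T; pose d := (2 * 2 ^+ n * T)^-1.
have s0 : 0 <= s by rewrite divr_ge0 ?subr_ge0 ?invf_le1// ltW.
have dd0 : 0 <= d by rewrite invr_ge0 !mulr_ge0// ltW.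
have sd : s + d = (1 - (2 * 2 ^+ n)^-1) / T by rewrite /s /d; field; rewrite !gt_eqF.
have [/ltW vd|dv] := ltP (vnorm (vsub v c)) delta.
  have /andP[_ hh] := spread_seq_bounds rate_gt0 rate_le1 a0_gt0 a01 n.+1.
  apply: le_trans hh _; apply: core_h => //; rewrite t2 andbT.
  by apply: le_trans t1; rewrite (exprS 2 n) -sd addr_ge0.
have KN0 : 0 < 2 ^+ n * K1 by rewrite mulr_gt0.
have /andP[an0 _] := spread_seq_bounds rate_gt0 rate_le1 a0_gt0 a01 n.
have hs := spread_step p1 an0 s0 dd0 KN0 (K_ball (n := n)) IH.
apply: le_trans (hs t v _ Zv dv vc); last by rewrite sd -(exprS 2 n) t1.
rewrite spread_seqS//.
have -> : Num.min (d / 2) (4 * (2 ^+ n * K1))^-1 = (2 ^+ n)^-1 * Num.min (4 * T)^-1 (4 * K1)^-1.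
  rewrite /d minr_pMr ?invr_ge0 ?ltW//; congr Num.min; field; rewrite !gt_eqF//.
have -> : (4 ^+ n)^-1 = (2 ^+ n)^-1 * (2 ^+ n)^-1 :> R.
  by rewrite -invfM -exprMn; congr (_ ^+ n)^-1; lra.
have rb : rate <= gain_const cb delta * a0 * Num.min (4 * T)^-1 (4 * K1)^-1 by rewrite ge_min lexx orbT.
have e0 : 0 <= (2 ^+ n)^-1 * (2 ^+ n)^-1 * spread_seq rate a0 n ^+ 2.
  by rewrite mulr_ge0 ?exprn_ge0// mulr_ge0// invr_ge0 ltW.
by have := ler_wpM2r e0 rb; congr (_ <= _); ring.
Qed.

(** For the least n whose ball contains v, 2^n is at most a quadratic in |v|, since v lies outside
    the preceding ball. The base is below 1, so its power 2^n is bounded below by a Gaussian. *)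
Lemma spread_gaussian (r0 : R) : vnorm c <= r0 -> forall t v, T^-1 <= t <= T -> ~ Z v ->
  expR (ln (rate * a0 / 4) * (1 + 8 * r0 ^+ 2 / delta ^+ 2 + 8 / delta ^+ 2 * vnorm v ^+ 2)) <= h t v.
Proof.
move=> cr0 t v /andP[tT1 tT] Zv.
have T0 : 0 < T := lt_le_trans ltr01 T1; have d2 : 0 < delta ^+ 2 by exact: exprn_gt0.
pose w := vnorm (vsub v c) ^+ 2; pose P n := w <= delta ^+ 2 * (2 ^+ n + 1) / 2.
have w_le : w <= 2 * vnorm v ^+ 2 + 2 * r0 ^+ 2.
  have h1 := vnorm_sub_sqr v c.
  have r00 : 0 <= r0 := le_trans (vnorm_ge0 c) cr0.
  have h2 : vnorm c ^+ 2 <= r0 ^+ 2 by rewrite ler_pXn2r ?nnegrE ?vnorm_ge0.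
  by rewrite /w; lra.
have exP : exists n, P n.
  pose y := 2 * w / delta ^+ 2; have w0 : 0 <= w by exact: sqr_ge0.
  have y0 : 0 <= y by apply: divr_ge0; [lra|exact: ltW].
  exists (Num.truncn y).+1; rewrite /P.
  have yn : y <= 2 ^+ (Num.truncn y).+1.
    apply: le_trans (ltW (truncnS_gt y)) _.
    by rewrite -natrX ler_nat ltnW// ltn_expl.
  have wE : w = delta ^+ 2 * y / 2 by rewrite /y; field; rewrite gt_eqF.
  by rewrite wE; have := ler_wpM2l (ltW d2) yn; lra.
have [n Pn nmin] := ex_minnP exP.
have nA : 2 ^+ n <= 1 + 8 * r0 ^+ 2 / delta ^+ 2 + 8 / delta ^+ 2 * vnorm v ^+ 2.
  case: n Pn nmin => [|n] Pn nmin.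
    have e1 : 0 <= 8 * r0 ^+ 2 / delta ^+ 2.
      by apply: divr_ge0; [rewrite mulr_ge0 ?sqr_ge0|exact: ltW].
    have e2 : 0 <= 8 / delta ^+ 2 * vnorm v ^+ 2.
      by apply: mulr_ge0; [apply: divr_ge0; [|exact: ltW]|exact: sqr_ge0].
    by rewrite expr0; lra.
  have : ~~ P n by apply/negP => /nmin; rewrite ltnn.
  (* Outside ball n one has 2^(n+1) < 4 |v - c| ^ 2 / delta ^ 2, and |v - c| ^ 2 <= 2 |v| ^ 2 + 2 r0
     ^ 2; this is the origin of the coefficients 8. *)
  rewrite /P -ltNge => hn.
  have -> : 1 + 8 * r0 ^+ 2 / delta ^+ 2 + 8 / delta ^+ 2 * vnorm v ^+ 2 =
    (delta ^+ 2 + 8 * r0 ^+ 2 + 8 * vnorm v ^+ 2) / delta ^+ 2 by field; rewrite gt_eqF.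
  by rewrite ler_pdivlMr// exprS; lra.
have x0 : 0 < rate * a0 / 4 by rewrite divr_gt0 ?mulr_gt0.
have tn : (1 - (2 ^+ n)^-1) / T <= t <= T.
  rewrite tT andbT; apply: le_trans tT1; rewrite ler_pdivrMr// (mulVf (lt0r_neq0 T0)).
  by rewrite gerBl invr_ge0 exprn_ge0.
apply: le_trans (spread tn Zv Pn); apply: le_trans (spread_seq_ge rate_gt0 rate_le1 a0_gt0 n).
rewrite -[leRHS](lnK (exprn_gt0 _ x0)) ler_expR lnXn// -[leRHS]mulr_natr natrX.
rewrite ler_wnM2l// ln_le0// -(ler_pM2r (ltr0n _ 4)) divfK// mul1r.
have := rate_le1; have := a01; have := a0_gt0; have := rate_gt0; nra.
Qed.

End spreading.

(** * Conserved norm and growth inequalities for a solution *)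

Section solution.
Context (R : realType).

Lemma cos_pi4_ge : 2^-1 <= cos (pi / 4) :> R.
Proof.
have p0 : 0 < pi :> R := pi_gt0 R.
have c0 : 0 < cos (pi / 4) :> R by apply: cos_gt0_pihalf; apply/andP; split; lra.
have := cos_mulr2n (pi / 4 : R); have -> : (pi / 4) *+ 2 = pi / 2 :> R by rewrite mulr2n; lra.
by rewrite cos_pihalf; nra.
Qed.

(** A cosine in [-1/2, 1/2] belongs to an angle between pi/3 and 2 pi/3, inside the interval of
    (H2). The comparison 1/2 <= cos (pi / 4) suffices for this, by monotonicity of the cosine. *)
Lemma kext_lower (b : R -> R) cb :
  (forall th : R, pi / 4 <= th <= 3 * pi / 4 -> cb < b (cos th)) ->
  forall x, `|x| <= 2^-1 -> cb <= kext b x.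
Proof.
move=> H2 x; rewrite ler_norml => /andP[x1 x2].
have c4 := cos_pi4_ge; have p0 : 0 < pi :> R := pi_gt0 R.
have xx : -1 <= x <= 1 by apply/andP; split; lra.
have xx' : x \in `[(-1), 1] by rewrite in_itv.
have a0 := acos_ge0 xx; have ap := acos_lepi xx.
rewrite kextE// -(acosK xx'); apply/ltW/H2; apply/andP; split; rewrite leNgt; apply/negP => h.
  have : cos (pi / 4) < cos (acos x).
    by rewrite ltr_cos// in_itv/=; apply/andP; split; lra.
  by rewrite acosK//; lra.
have : cos (acos x) < cos (pi - pi / 4).
  by rewrite ltr_cos ?in_itv/=; [lra|apply/andP; split; lra|apply/andP; split; lra].
by rewrite acosK// addrC cosDpi cosN; lra.
Qed.

(** Mass and energy are conserved, so this identity makes [norm12] constant along a solution and the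
    bounds on gain and loss uniform in time. *)
Lemma norm12_moments (h : vec3 R -> R) : inL12 h -> (forall v, 0 <= h v) ->
  norm12 h = (Rintegral (leb3 R) setT h + Rintegral (leb3 R) setT (fun v => vnorm v ^+ 2 * h v))%:E.
Proof.
move=> [mh hfin] h0.
have h10 v : (0 <= (h v)%:E)%E by rewrite lee_fin.
have h20 v : (0 <= (vnorm v ^+ 2 * h v)%:E)%E by rewrite lee_fin mulr_ge0// sqr_ge0.
have m1 : measurable_fun setT (fun v => (h v)%:E) by mfun.
have m2 : measurable_fun setT (fun v => (vnorm v ^+ 2 * h v)%:E) by mfun.
have e : norm12 h = (\int[leb3 R]_v (h v)%:E + \int[leb3 R]_v (vnorm v ^+ 2 * h v)%:E)%E.
  apply: etrans (@ge0_integralD _ _ R (leb3 R) setT measurableT _ _ (fun v _ => h10 v) m1 (fun v _ => h20 v) m2).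
  apply: eq_integral => v _; rewrite -EFinD; congr EFin.
  by rewrite ger0_norm//; ring.
have i1 : (0 <= \int[leb3 R]_v (h v)%:E)%E by apply: integral_ge0 => v _.
have i2 : (0 <= \int[leb3 R]_v (vnorm v ^+ 2 * h v)%:E)%E by apply: integral_ge0 => v _.
have f1 : (\int[leb3 R]_v (h v)%:E)%E \is a fin_num.
  by rewrite ge0_fin_numE//; apply: le_lt_trans hfin; apply: le_trans (eq_leW (esym e)); exact: leeDl.
have f2 : (\int[leb3 R]_v (vnorm v ^+ 2 * h v)%:E)%E \is a fin_num.
  by rewrite ge0_fin_numE//; apply: le_lt_trans hfin; apply: le_trans (eq_leW (esym e)); exact: leeDr.
by rewrite EFinD /Rintegral !fineK.
Qed.

Lemma growth_eq (phi q q' : R -> R) : (forall t, 0 <= t -> q t = q' t) -> growth phi q -> growth phi q'.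
Proof.
move=> e G s t c s0 st qc; apply: G => // tau tst; rewrite e; first exact: qc.
by have /andP[h _] := tst; exact: le_trans h.
Qed.

Variables (g : R) (b : R -> R) (f0 : vec3 R -> R) (f : R -> vec3 R -> R).
Hypotheses (g02 : 0 <= g <= 2) (mb : measurable_fun (@itvm11 R) b).
Hypothesis b0 : forall x : R, -1 <= x <= 1 -> 0 <= b x.
Hypothesis b_sym : forall th : R, 0 <= th <= pi -> b (cos (pi - th)) = b (cos th).
Hypothesis b_fin : (0 < Cb_ext b < +oo)%E.
Hypotheses (f0L : inL12 f0) (f001 : forall v, 0 <= f0 v <= 1).
Hypothesis sol : BFD_solution g b f0 f.

Let CB := fine (Cb_ext b).
Let E := fine (norm12 f0).
Let k := kext b.

(** The summand 1 makes the bound positive, as its reciprocal enters the growth estimates. *)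
Definition collision_bound (CB E : R) (v : vec3 R) := (128 * CB * E + 1) * (1 + vnorm v ^+ 2).

Let kCB : ((2 * pi)%:E * \int[leb1 R]_(th in @itv0pi R) ((sin th)%:E * (k (cos th))%:E) = CB%:E)%E.
Proof.
rewrite -kext_Cb fineK// ge0_fin_numE; first by case/andP: b_fin.
by case/andP: b_fin => /ltW.
Qed.

Let f01 (t : R) v : 0 <= t -> 0 <= f t v <= 1.
Proof. by move=> t0; have [_ [_ [h _]]] := sol; exact: h. Qed.

Let mf (t : R) : 0 <= t -> measurable_fun setT (f t).
Proof. by move=> t0; have [h _] := sol; case: (h t t0). Qed.

Let fE (t : R) : 0 <= t -> norm12 (f t) = E%:E.
Proof.
move=> t0; have [fL [_ [_ [_ cons]]]] := sol.
have [c1 [_ [_ [_ c2]]]] := cons t t0.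
have f0_ge v : 0 <= f0 v by case/andP: (f001 v).
have ft_ge v : 0 <= f t v by case/andP: (f01 v t0).
rewrite (norm12_moments (fL t t0) ft_ge) c1 c2 -(norm12_moments f0L f0_ge) /E.
by rewrite (norm12_moments f0L f0_ge).
Qed.

Let le_collision_bound v : 128 * CB * (1 + vnorm v ^+ 2) * E <= collision_bound CB E v.
Proof.
have v0 : 0 <= 1 + vnorm v ^+ 2 by rewrite addr_ge0// sqr_ge0.
suff aux (x y u : R) : 0 <= u -> 128 * x * u * y <= (128 * x * y + 1) * u by exact: aux.
by move=> u0; nra.
Qed.

Lemma gain_collision_bound (t : R) v : 0 <= t -> (gain g k (f t) v <= (collision_bound CB E v)%:E)%E.
Proof.
move=> t0.
apply: le_trans (gain_le g02 (mfun_kext mb) (kext_ge0 b0) (kext_even b_sym) kCB (mf t0) (fun u => f01 u t0) (fE t0) v) _.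
by rewrite lee_fin.
Qed.

Lemma loss_collision_bound (t : R) v : 0 <= t ->
  (gain g k (fun u => (1 - f t u)%R) v <= (collision_bound CB E v)%:E)%E.
Proof.
move=> t0.
apply: le_trans (gain_compl_le g02 (mfun_kext mb) (kext_ge0 b0) kCB (mf t0) (fun u => f01 u t0) (fE t0) v) _.
by rewrite lee_fin.
Qed.

Let QFDE (t : R) v : 0 <= t -> QFD g b f t v =
  (1 - f t v) * fine (gain g k (f t) v) - f t v * fine (gain g k (fun u => 1 - f t u) v).
Proof.
move=> t0.
apply: etrans (QFD_splitE g02 (mfun_kext mb) (kext_ge0 b0) (kext_even b_sym) kCB (mf t0) (fun u => f01 u t0) (fE t0) v (erefl (f t))).
by apply: eq_Rintegral => z _; rewrite /QFD_integrand (kernB_kext _ _ _ _ (vdot_sph _ _)).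
Qed.

(** The exceptional set is enlarged to a measurable null set. Both growth inequalities come from one
    integral equation: passing from f to 1 - f reverses the sign and exchanges gain and loss. *)
Lemma solution_growth : exists Z : set (vec3 R), [/\ measurable Z, leb3 R Z = 0%E &
  forall v, ~ Z v -> [/\ f 0 v = f0 v,
    growth (f^~ v) (fun t => (1 - f t v) * fine (gain g k (f t) v) -
       f t v * fine (gain g k (fun u => (1 - f t u)%R) v)) &
    growth (fun t => 1 - f t v) (fun t => (1 - (1 - f t v)) * fine (gain g k (fun u => (1 - f t u)%R) v) -
       (1 - f t v) * fine (gain g k (fun u => (1 - (1 - f t u))%R) v))]].
Proof.
have [_ [_ [_ [[Z0 [[Z [mZ Zn Z0Z]] mild]] _]]]] := sol.
exists Z; split=> // v Zv.
have mildv t : 0 <= t -> _ := fun t0 => mild t v t0 (contra_not (Z0Z v) Zv).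
have phiE t : 0 <= t -> f t v = f0 v + Rintegral (leb1 R) `[0, t] (fun tau => QFD g b f tau v).
  by move=> t0; case: (mildv t t0).
have mq t : 0 <= t -> measurable_fun (`[0, t]%classic : set R) (fun tau => QFD g b f tau v).
  by move=> t0; have [ii _] := mildv t t0; exact: mfun_QFD_time (measurable_int _ ii).
have qK t : 0 <= t -> `|QFD g b f t v| <= collision_bound CB E v.
  move=> t0; rewrite (QFDE v t0).
  have c01 u : 0 <= 1 - f t u <= 1 by have /andP[p0 p1] := f01 u t0; apply/andP; split; lra.
  have k0 := kext_ge0 b0.
  have A := fine_bound (gain_ge0 g k0 v (fun u => f01 u t0)) (gain_collision_bound v t0).
  have B := fine_bound (gain_ge0 g k0 v c01) (loss_collision_bound v t0).
  exact: norm_gain_loss (f01 v t0) A B.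
split.
- by rewrite (phiE 0 (lexx 0)) set_itv1 Rintegral_set1 addr0.
- exact: growth_eq (fun t t0 => QFDE v t0) (growth_integral phiE mq qK).
apply: growth_eq (growth_integral_compl phiE mq qK) => t t0.
have -> : (fun u => 1 - (1 - f t u)) = f t by apply/funext => u; ring.
rewrite (QFDE v t0).
suff aux (y A B : R) : - ((1 - y) * A - y * B) = (1 - (1 - y)) * B - (1 - y) * A by exact: aux.
ring.
Qed.

End solution.

(** * Explicit constants *)

Section constants.
Context (R : realType).
Implicit Types (cb delta eps K T : R).

(** The exponent exceeds 2 K T, the number of half-lives 1 / (2 K) contained in a time T. *)
Definition core_const eps K T : R := eps / 2 ^+ (Num.truncn (2 * K * T)).+1.

Definition gauss_base cb delta eps K T : R :=
  let a0 := core_const eps K T in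
  Num.min 1 (gain_const cb delta * a0 * Num.min (4 * T)^-1 (4 * K)^-1) * a0 / 4.

Lemma core_const_bounds eps K T : 0 < eps < 1 -> 0 < core_const eps K T <= 1.
Proof.
move=> /andP[e0 e1]; rewrite /core_const; set n := (Num.truncn _).+1.
have n0 : 0 < (2 : R) ^+ n by exact: exprn_gt0.
have n1 : 1 <= (2 : R) ^+ n by rewrite exprn_ege1// ler1n.
apply/andP; split; first exact: divr_gt0.
by rewrite ler_pdivrMr// mul1r; lra.
Qed.

Lemma gauss_base_bounds cb delta eps K T : 0 < cb -> 0 < delta -> 0 < eps < 1 -> 0 < K -> 0 < T ->
  0 < gauss_base cb delta eps K T < 1.
Proof.
move=> cb0 d0 e01 K0 T0; rewrite /gauss_base /=; set a0 := core_const _ _ _.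
have /andP[a00 a01] : 0 < a0 <= 1 by exact: core_const_bounds.
set q := Num.min 1 _.
have q0 : 0 < q.
  have m0 : 0 < Num.min (4 * T)^-1 (4 * K)^-1.
    by rewrite lt_min !invr_gt0; apply/andP; split; lra.
  by rewrite lt_min ltr01 (mulr_gt0 (mulr_gt0 (gain_const_gt0 cb0 d0) a00) m0).
have q1 : q <= 1 by rewrite ge_min lexx.
have qa0 : 0 < q * a0 by exact: mulr_gt0.
by apply/andP; split; nra.
Qed.

End constants.

Section two_sided.
Context (R : realType).
Variables (g : R) (b : R -> R) (cb delta : R) (c : vec3 R).
Hypotheses (g02 : 0 <= g <= 2) (mb : measurable_fun setT b) (b0 : forall x, 0 <= b x).
Hypotheses (cb0 : 0 < cb) (bcb : forall x, `|x| <= 2^-1 -> cb <= b x) (d0 : 0 < delta).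
Variables (Z : set (vec3 R)) (h : R -> vec3 R -> R) (K : vec3 R -> R).
Hypotheses (mZ : measurable Z) (Z0 : leb3 R Z = 0%E).
Hypotheses (mh : forall t : R, 0 <= t -> measurable_fun setT (h t)).
Hypotheses (h01 : forall (t : R) v, 0 <= t -> 0 <= h t v <= 1).
Hypothesis gainK : forall (t : R) v, 0 <= t -> (gain g b (h t) v <= (K v)%:E)%E.
Hypothesis lossK : forall (t : R) v, 0 <= t -> (gain g b (fun u => (1 - h t u)%R) v <= (K v)%:E)%E.
Hypothesis growth_h : forall v, ~ Z v -> growth (h^~ v) (fun t =>
  (1 - h t v) * fine (gain g b (h t) v) - h t v * fine (gain g b (fun u => (1 - h t u)%R) v)).
Hypothesis growth_compl : forall v, ~ Z v -> growth (fun t => 1 - h t v) (fun t =>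
  (1 - (1 - h t v)) * fine (gain g b (fun u => (1 - h t u)%R) v) -
  (1 - h t v) * fine (gain g b (fun u => (1 - (1 - h t u))%R) v)).
Variables (eps r0 T K1 : R).
Hypotheses (e01 : 0 < eps < 1) (cr0 : vnorm c <= r0) (T1 : 1 <= T) (K10 : 0 < K1).
Hypothesis K_core : forall v, vnorm (vsub v c) <= delta -> K v <= K1.
Hypothesis K_ball : forall n v, vnorm (vsub v c) ^+ 2 <= delta ^+ 2 * (2 * 2 ^+ n + 1) / 2 ->
  K v <= 2 ^+ n * K1.
Hypothesis core0 : forall v, ~ Z v -> vnorm (vsub v c) <= delta -> eps <= h 0 v <= 1 - eps.

(** Core bounds are needed for h and 1 - h at once, because the gain of h carries the factor 1 -
    h(w) with w in the core. For this reason the assumptions are symmetric under exchanging h and 1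
    - h. *)
Lemma gaussian_lower (t : R) v : T^-1 <= t <= T -> ~ Z v ->
  expR (ln (gauss_base cb delta eps K1 T) *
    (1 + 8 * r0 ^+ 2 / delta ^+ 2 + 8 / delta ^+ 2 * vnorm v ^+ 2)) <= h t v.
Proof.
have /andP[a00 a01] := core_const_bounds K1 T e01.
have KT : K1 * T <= (Num.truncn (2 * K1 * T)).+1%:R / 2.
  by have := truncnS_gt (2 * K1 * T); lra.
have compl01 (s : R) u : 0 <= s -> 0 <= 1 - h s u <= 1.
  by move=> s0; have /andP[p0 p1] := h01 u s0; apply/andP; split; lra.
have mcompl (s : R) : 0 <= s -> measurable_fun setT (fun u => 1 - h s u).
  by move=> s0; have m := mh s0; mfun.
have compl_lossK (s : R) u : 0 <= s -> (gain g b (fun w => (1 - (1 - h s w))%R) u <= (K u)%:E)%E.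
  have -> : (fun w => 1 - (1 - h s w)) = h s by apply/funext => w; ring.
  exact: gainK.
have low_h u (Zu : ~ Z u) (uc : vnorm (vsub u c) <= delta) : eps <= h 0 u.
  by case/andP: (core0 Zu uc).
have low_c u (Zu : ~ Z u) (uc : vnorm (vsub u c) <= delta) : eps <= 1 - h 0 u.
  by case/andP: (core0 Zu uc) => _; lra.
have core_h := core_lower b0 h01 gainK lossK growth_h K10 K_core low_h KT.
have core_c := core_lower (h := fun s u => 1 - h s u) b0 compl01 lossK compl_lossK growth_compl K10 K_core low_c KT.
exact: (spread_gaussian g02 mb b0 cb0 bcb d0 mZ Z0 mh h01 gainK lossK growth_h (ltW a00) core_c T1 K10 a00 a01
  K_ball core_h cr0).
Qed.

End two_sided.
(** * The Gaussian bounds *)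

Section gaussian_constants.
Context (R : realType).

(** For a < 1 the power with exponent p >= 2 may be smaller than the square; the summand 1 covers
    this range and is later absorbed into [gauss_C1]. *)
Lemma sqr_le_powR_pexp (a : R) : 0 <= a -> a ^+ 2 <= 1 + a `^ @pexp R.
Proof.
move=> a0; have [a1|a1] := leP a 1.
  apply: (@le_trans _ _ 1); first by rewrite expr_le1.
  by rewrite lerDl powR_ge0.
rewrite -powR_mulrn//; apply: (@le_trans _ _ (a `^ @pexp R)); last by rewrite lerDr.
apply: ler_powR; first exact: ltW.
have l2 : 0 < ln (2 : R) by apply: ln_gt0; rewrite ltr1n.
rewrite /pexp ler_pdivlMr// ler_pM2l// ler_ln ?posrE//; lra.
Qed.

Lemma nat_lower_bound (F : nat -> R) N : (forall n, 0 < F n) ->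
  exists2 m, 0 < m & forall n, (n <= N)%N -> m <= F n.
Proof.
move=> F0; elim: N => [|N [m m0 IH]]; first by exists (F 0) => // n; rewrite leqn0 => /eqP ->.
exists (Num.min m (F N.+1)) => [|n]; first by rewrite lt_min m0 F0.
rewrite leq_eqVlt ltnS => /orP[/eqP ->|/IH h]; first by rewrite ge_min lexx orbT.
by rewrite ge_min h.
Qed.

Lemma nat_upper_bound (F : nat -> R) N : exists M, forall n, (n <= N)%N -> F n <= M.
Proof.
elim: N => [|N [m IH]]; first by exists (F 0) => // n; rewrite leqn0 => /eqP ->.
exists (Num.max m (F N.+1)) => n.
rewrite leq_eqVlt ltnS => /orP[/eqP ->|/IH h]; first by rewrite le_max lexx orbT.
by rewrite le_max h.
Qed.

Variables (E CB cb delta eps r0 : R).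

(** On the ball reached at step n, |v| ^ 2 <= 2 |v - c| ^ 2 + 2 r0 ^ 2 gives 1 + |v| ^ 2 <= 2^n (1 +
    3 delta ^ 2 + 2 r0 ^ 2). Hence [collision_bound] is at most 2^n times this constant there. *)
Definition ball_bound : R := (128 * CB * E + 1) * (1 + 3 * delta ^+ 2 + 2 * r0 ^+ 2).

Definition time_horizon (t : R) : nat := Num.truncn (Num.max t t^-1).

(* [n.+1] bounds both [t] and [t^-1] when [n = time_horizon t], so that the constants take finitely many
   values on compact sets of positive times. *)
Definition log_base (n : nat) : R := ln (gauss_base cb delta eps ball_bound n.+1%:R).

(** The last summand 8 / delta ^ 2 pays for the 1 in |v| ^ 2 <= 1 + |v|^p. *)
Definition gauss_C1 (t : R) : R :=
  expR (log_base (time_horizon t) * (1 + 8 * r0 ^+ 2 / delta ^+ 2 + 8 / delta ^+ 2)).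

Definition gauss_C2 (t : R) : R := - log_base (time_horizon t) * (8 / delta ^+ 2).

Hypotheses (E0 : 0 <= E) (CB0 : 0 <= CB) (cb0 : 0 < cb) (d0 : 0 < delta) (e01 : 0 < eps < 1).

Lemma ball_bound_gt0 : 0 < ball_bound.
Proof.
apply: mulr_gt0.
  by have := mulr_ge0 CB0 E0; lra.
have h1 := sqr_ge0 delta; have h2 := sqr_ge0 r0; lra.
Qed.

Lemma log_base_lt0 n : log_base n < 0.
Proof. by apply: ln_lt0; apply: gauss_base_bounds => //; exact: ball_bound_gt0. Qed.

Lemma gauss_C2_gt0 t : 0 < gauss_C2 t.
Proof. by rewrite mulr_gt0 ?oppr_gt0 ?log_base_lt0// divr_gt0// exprn_gt0. Qed.

Lemma time_horizon_itv (t : R) : 0 < t -> (time_horizon t).+1%:R^-1 <= t <= (time_horizon t).+1%:R.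
Proof.
move=> t0.
have h := ltW (truncnS_gt (Num.max t t^-1)); move: h; rewrite ge_max => /andP[h1 h2].
by rewrite h1 andbT -[leRHS]invrK lef_pV2// posrE// invr_gt0.
Qed.

Lemma time_horizon_le (T t : R) : 1 <= T -> T^-1 <= t <= T -> (time_horizon t <= Num.truncn T)%N.
Proof.
move=> T1 /andP[t1 t2]; have T0 : 0 < T := lt_le_trans ltr01 T1.
have t0 : 0 < t by apply: lt_le_trans t1; rewrite invr_gt0.
apply: le_truncn; rewrite ge_max t2 -[leRHS]invrK lef_pV2// posrE// invr_gt0//.
Qed.

Lemma gauss_C1_bounded_below (T : R) : 1 <= T ->
  exists2 m, 0 < m & forall t, T^-1 <= t <= T -> m <= gauss_C1 t.
Proof.
move=> T1.
have [|m m0 h] := @nat_lower_bound (fun n => expR (log_base n * (1 + 8 * r0 ^+ 2 / delta ^+ 2 + 8 / delta ^+ 2))) (Num.truncn T).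
  by move=> n; exact: expR_gt0.
by exists m => // t tT; apply: h; exact: time_horizon_le.
Qed.

Lemma gauss_C2_bounded_above (T : R) : 1 <= T ->
  exists M, forall t, T^-1 <= t <= T -> gauss_C2 t <= M.
Proof.
move=> T1; have [M h] := nat_upper_bound (fun n => - log_base n * (8 / delta ^+ 2)) (Num.truncn T).
by exists M => t tT; apply: (h (time_horizon t)); exact: time_horizon_le.
Qed.

(** With x = |v| ^ 2, the choices y = |v| ^ 2 and y = |v|^p yield the lower and the upper bound with
    the same constants. *)
Lemma gauss_le (t x y : R) : x <= 1 + y ->
  gauss_C1 t * expR (- (gauss_C2 t * y)) <=
  expR (log_base (time_horizon t) * (1 + 8 * r0 ^+ 2 / delta ^+ 2 + 8 / delta ^+ 2 * x)).
Proof.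
move=> xy; rewrite /gauss_C1 -expRD ler_expR /gauss_C2.
have L0 := ltW (log_base_lt0 (time_horizon t)); set L := log_base _ in L0 *.
have B0 : 0 <= 8 / delta ^+ 2 by rewrite divr_ge0// sqr_ge0.
set A := 1 + _; set B := 8 / _ in B0 *.
have := ler_wnM2l L0 (ler_wpM2l B0 xy); lra.
Qed.

End gaussian_constants.
Lemma vnorm_sqr_le (R : realType) (v c : vec3 R) :
  vnorm v ^+ 2 <= 2 * vnorm (vsub v c) ^+ 2 + 2 * vnorm c ^+ 2.
Proof.
rewrite !vnorm_sqr /vsub /vmk /vx /vy /vz /=.
have h1 := sqr_ge0 (v.1.1 - 2 * c.1.1); have h2 := sqr_ge0 (v.1.2 - 2 * c.1.2).
have h3 := sqr_ge0 (v.2 - 2 * c.2); lra.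
Qed.

(** * Both bounds for a solution *)

Section solution_bounds.
Context (R : realType).
Variables (g : R) (b : R -> R) (cb : R) (f0 : vec3 R -> R) (f : R -> vec3 R -> R).
Variables (eps : R) (vbar : vec3 R) (r0 delta : R).
Hypotheses (g02 : 0 <= g <= 2) (mb : measurable_fun (@itvm11 R) b).
Hypothesis b0 : forall x : R, -1 <= x <= 1 -> 0 <= b x.
Hypothesis b_sym : forall th : R, 0 <= th <= pi -> b (cos (pi - th)) = b (cos th).
Hypothesis b_fin : (0 < Cb_ext b < +oo)%E.
Hypotheses (cb0 : 0 < cb) (bcb : forall th : R, pi / 4 <= th <= 3 * pi / 4 -> cb < b (cos th)).
Hypotheses (f0L : inL12 f0) (f001 : forall v, 0 <= f0 v <= 1).
Hypothesis sol : BFD_solution g b f0 f.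
Hypotheses (e01 : 0 < eps < 1) (vr : vnorm vbar < r0) (d0 : 0 < delta).
Hypothesis core : forall v, vnorm (vsub v vbar) <= delta -> eps <= f0 v <= 1 - eps.

Let CB := fine (Cb_ext b).
Let E := fine (norm12 f0).
Let K1 := ball_bound E CB delta r0.

Lemma fine_Cb_ge0 : 0 <= CB.
Proof. by apply: fine_ge0; case/andP: b_fin => /ltW. Qed.

Lemma fine_norm12_ge0 (h : vec3 R -> R) : 0 <= fine (norm12 h).
Proof.
apply: fine_ge0; apply: integral_ge0 => v _; rewrite lee_fin mulr_ge0//.
by rewrite addr_ge0// sqr_ge0.
Qed.

Let Kc1 : 1 <= 128 * CB * E + 1.
Proof. by have := mulr_ge0 fine_Cb_ge0 (fine_norm12_ge0 f0); rewrite -/E; lra. Qed.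

Let K_ball n v : vnorm (vsub v vbar) ^+ 2 <= delta ^+ 2 * (2 * 2 ^+ n + 1) / 2 ->
  collision_bound CB E v <= 2 ^+ n * K1.
Proof.
move=> hv; rewrite mulrCA; apply: ler_wpM2l; first exact: le_trans ler01 Kc1.
have n1 : 1 <= (2 : R) ^+ n by rewrite exprn_ege1// ler1n.
have h1 := vnorm_sqr_le v vbar.
have h2 : vnorm vbar ^+ 2 <= r0 ^+ 2.
  by rewrite ler_pXn2r ?nnegrE ?vnorm_ge0 ?(ltW vr)// (le_trans (vnorm_ge0 vbar))// ltW.
have h3 := ler_wpM2r (sqr_ge0 delta) n1; have h4 := ler_wpM2r (sqr_ge0 r0) n1.
by rewrite mul1r in h3; rewrite mul1r in h4; lra.
Qed.

Let K_core v : vnorm (vsub v vbar) <= delta -> collision_bound CB E v <= K1.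
Proof.
move=> hv; rewrite -[K1]mul1r -(expr0 2); apply: K_ball; rewrite expr0.
have h : vnorm (vsub v vbar) ^+ 2 <= delta ^+ 2 by rewrite ler_pXn2r ?nnegrE ?vnorm_ge0 ?(ltW d0).
by have := sqr_ge0 delta; lra.
Qed.

Let f01 (t : R) v : 0 <= t -> 0 <= f t v <= 1.
Proof. by move=> t0; have [_ [_ [h _]]] := sol; exact: h. Qed.

Let mf (t : R) : 0 <= t -> measurable_fun setT (f t).
Proof. by move=> t0; have [h _] := sol; case: (h t t0). Qed.

Lemma solution_gaussian_bounds (t : R) : 0 < t ->
  {ae leb3 R, forall v : vec3 R,
    gauss_C1 E CB cb delta eps r0 t * expR (- (gauss_C2 E CB cb delta eps r0 t * vnorm v ^+ 2)) <= f t v /\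
    f t v <= 1 - gauss_C1 E CB cb delta eps r0 t *
      expR (- (gauss_C2 E CB cb delta eps r0 t * vnorm v `^ @pexp R))}.
Proof.
move=> t0; have [Z [mZ Zn HZ]] := solution_growth g02 mb b0 b_sym b_fin f0L f001 sol.
exists Z; split=> // v /=; apply: contra_notP => Zv.
have gK := gain_collision_bound g02 mb b0 b_sym b_fin f0L f001 sol.
have lK := loss_collision_bound g02 mb b0 b_fin f0L f001 sol.
have lK' (s : R) u : 0 <= s ->
    (gain g (kext b) (fun w => (1 - (1 - f s w))%R) u <= (collision_bound CB E u)%:E)%E.
  have -> : (fun w => 1 - (1 - f s w)) = f s by apply/funext => w; ring.
  exact: gK.
have G1 u (Zu : ~ Z u) := let: And3 _ h _ := HZ u Zu in h.
have G2 u (Zu : ~ Z u) := let: And3 _ _ h := HZ u Zu in h.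
(* The application to h = 1 - f asks for the growth inequality of its complement 1 - (1 - f), which
   is that of f. *)
have G3 u : ~ Z u -> growth (fun s => 1 - (1 - f s u)) (fun s =>
    (1 - (1 - (1 - f s u))) * fine (gain g (kext b) (fun w => (1 - (1 - f s w))%R) u) -
    (1 - (1 - f s u)) * fine (gain g (kext b) (fun w => (1 - (1 - (1 - f s w)))%R) u)).
  move=> Zu; have := G1 u Zu.
  have -> : (fun s => 1 - (1 - f s u)) = f^~ u by apply/funext => s; ring.
  apply: growth_eq => s _.
  have -> : (fun w => 1 - (1 - f s w)) = f s by apply/funext => w; ring.
  have -> : (fun w => 1 - (1 - (1 - f s w))) = (fun w => 1 - f s w) by apply/funext => w; ring.
  by congr (_ * _ - _ * _); ring.
have core1 u (Zu : ~ Z u) (hu : vnorm (vsub u vbar) <= delta) : eps <= f 0 u <= 1 - eps.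
  by have [-> _ _] := HZ u Zu; exact: core.
have core2 u (Zu : ~ Z u) (hu : vnorm (vsub u vbar) <= delta) : eps <= 1 - f 0 u <= 1 - eps.
  by have /andP[p q] := core1 u Zu hu; apply/andP; split; lra.
have c01 (s : R) u : 0 <= s -> 0 <= 1 - f s u <= 1.
  by move=> s0; have /andP[p q] := f01 u s0; apply/andP; split; lra.
have mc (s : R) : 0 <= s -> measurable_fun setT (fun u => 1 - f s u).
  by move=> s0; have m := mf s0; mfun.
have T1 : 1 <= (time_horizon t).+1%:R :> R by rewrite ler1n.
have K10 : 0 < K1 := ball_bound_gt0 delta r0 (fine_norm12_ge0 f0) fine_Cb_ge0.
have low1 := gaussian_lower g02 (mfun_kext mb) (kext_ge0 b0) cb0 (kext_lower bcb) d0 mZ Zn mf f01 gK lK G1 G2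
  e01 (ltW vr) T1 K10 K_core K_ball core1 (time_horizon_itv t0) Zv.
have low2 := gaussian_lower (h := fun s u => 1 - f s u) g02 (mfun_kext mb) (kext_ge0 b0) cb0 (kext_lower bcb)
  d0 mZ Zn mc c01 lK lK' G2 G3 e01 (ltW vr) T1 K10 K_core K_ball core2 (time_horizon_itv t0) Zv.
have E0 := fine_norm12_ge0 f0; have CB0 := fine_Cb_ge0.
split.
  apply: le_trans low1; apply: gauss_le => //.
  by rewrite lerDr.
rewrite lerBrDl -lerBrDr; apply: le_trans low2; apply: gauss_le => //.
by apply: sqr_le_powR_pexp; exact: vnorm_ge0.
Qed.

End solution_bounds.

(* C1, C2 take the arguments (||f0||_{1,2}, gamma, C_b, c_b, delta, eps, r0, t). *)
Theorem theorem5p3 (R : realType) :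
  exists C1 C2 : R -> R -> R -> R -> R -> R -> R -> R -> R,
  forall (gamma : R) (b : R -> R) (cb : R) (f0 : vec3 R -> R)
         (f : R -> vec3 R -> R) (eps : R) (vbar : vec3 R) (r0 delta : R),
  (* kernel assumptions *)
  0 <= gamma <= 2 ->
  measurable_fun (@itvm11 R) b ->
  (forall x : R, -1 <= x <= 1 -> 0 <= b x) ->
  (forall th : R, 0 <= th <= pi -> b (cos (pi - th)) = b (cos th)) ->
  (* (H1) *)
  (0 < Cb_ext b < +oo)%E ->
  (* (H2) *)
  0 < cb -> (forall th : R, pi / 4 <= th <= 3 * pi / 4 -> cb < b (cos th)) ->
  (* initial datum and solution *)
  inL12 f0 -> (forall v, 0 <= f0 v <= 1) ->
  BFD_solution gamma b f0 f ->
  (* local positivity of f0 and 1 - f0 *)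
  0 < eps < 1 -> 0 < r0 -> vnorm vbar < r0 -> 0 < delta ->
  (forall v, vnorm (vsub v vbar) <= delta -> eps <= f0 v <= 1 - eps) ->
  let c1 := C1 (fine (norm12 f0)) gamma (fine (Cb_ext b)) cb delta eps r0 in
  let c2 := C2 (fine (norm12 f0)) gamma (fine (Cb_ext b)) cb delta eps r0 in
  (forall t : R, 0 < t -> 0 < c1 t /\ 0 < c2 t) /\
  (forall t : R, 0 < t ->
     {ae leb3 R, forall v : vec3 R,
        c1 t * expR (- (c2 t * vnorm v ^+ 2)) <= f t v
        /\ f t v <= 1 - c1 t * expR (- (c2 t * vnorm v `^ @pexp R))}) /\
  (forall T : R, 1 <= T ->
     exists2 m : R, 0 < m & forall t : R, T^-1 <= t <= T -> m <= c1 t) /\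
  (forall T : R, 1 <= T ->
     exists M : R, forall t : R, T^-1 <= t <= T -> c2 t <= M).
Proof.
exists (fun E _ CB cb delta eps r0 => gauss_C1 E CB cb delta eps r0).
exists (fun E _ CB cb delta eps r0 => gauss_C2 E CB cb delta eps r0).
move=> gamma b cb f0 f eps vbar r0 delta g02 mb b0 b_sym b_fin cb0 bcb f0L f001 sol e01 r00 vr d0 core c1 c2.
have E0 := fine_norm12_ge0 f0; have CB0 := fine_Cb_ge0 b_fin.
split; [|split; [|split]].
- by move=> t _; split; [exact: expR_gt0|exact: gauss_C2_gt0].
- by move=> t t0; exact: (solution_gaussian_bounds g02 mb b0 b_sym b_fin cb0 bcb f0L f001 sol e01 vr d0 core t0).
- by move=> T T1; exact: gauss_C1_bounded_below.
- by move=> T T1; exact: gauss_C2_bounded_above.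
Qed.
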